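(* Let $\varphi\in\Phi_{\mathrm w}(\mathbb{R}^n)$ satisfy (A0), (A1) and (A2). Then the Hardy--Littlewood maximal operator $M$ is bounded from $L^\varphi(\mathbb{R}^n)$ to $L^\varphi(\mathbb{R}^n)$ if and only if there exists $\psi\in\Phi_{\mathrm w}(\mathbb{R}^n)$ such that $\varphi$ and $\psi$ are weakly equivalent and $\psi$ satisfies (A0), (A1), (A2) and (aInc).
   Context: $|A|$ denotes Lebesgue measure. A function $f$ is $L$-almost increasing ($L\ge1$) if $f(s)\le L f(t)$ for all $s<t$. Below $\Omega=\mathbb{R}^n$. Weak $\Phi$-functions: $\varphi:\Omega\times[0,\infty)\to[0,\infty]$ belongs to $\Phi_{\mathrm w}(\Omega)$ if: (i) for every measurable $f:\Omega\to\mathbb{R}$ the function $x\mapsto\varphi(x,|f(x)|)$ is measurable, and for every $x\in\Omega$ the function $t\mapsto\varphi(x,t)$ is non-decreasing; (ii) $\varphi(x,0)=\lim_{t\to0^+}\varphi(x,t)=0$ and $\lim_{t\to\infty}\varphi(x,t)=\infty$ for every $x\in\Omega$; (iii) $t\mapsto\varphi(x,t)/t$ is $L$-almost increasing on $(0,\infty)$ with $L$ independent of $x$. If $\varphi$ does not depend on $x$ we write $\varphi\in\Phi_{\mathrm w}$. Weak equivalence: $\varphi$ and $\psi$ are weakly equivalent if there exist $L\ge1$ and $h\in L^1(\Omega)$ such that $\psi(x,t)\le\varphi(x,Lt)+h(x)$ and $\varphi(x,t)\le\psi(x,Lt)+h(x)$ for all $t\ge0$ and almost all $x\in\Omega$.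 Generalized inverse: $\varphi^{-1}(x,t):=\inf\{\tau\ge0:\varphi(x,\tau)\ge t\}$. (aInc): there exist $p>1$ and $a\ge1$ such that $\frac{\varphi(x,t)}{t^p}\le a\frac{\varphi(x,s)}{s^p}$ for all $0<t<s$ and almost all $x\in\Omega$. (A0): there exists $\beta\in(0,1]$ such that $\beta\le\varphi^{-1}(x,1)\le\frac1\beta$ for almost every $x\in\Omega$. (A1): there exists $\beta\in(0,1)$ such that $\beta\varphi^{-1}(x,t)\le\varphi^{-1}(y,t)$ for every $t\in[1,\frac1{|B|}]$, almost every $x,y\in B\cap\Omega$ and every ball $B$ with $|B|\le1$. (A2): there exist $\varphi_\infty\in\Phi_{\mathrm w}$, $h\in L^1(\Omega)\cap L^\infty(\Omega)$, $\beta\in(0,1]$ and $s>0$ such that, for almost every $x\in\Omega$, $\varphi(x,\beta t)\le\varphi_\infty(t)+h(x)$ whenever $\varphi_\infty(t)\in[0,s]$, and $\varphi_\infty(\beta t)\le\varphi(x,t)+h(x)$ whenever $\varphi(x,t)\in[0,s]$. Generalized Orlicz space: $L^\varphi(\Omega)$ is the set of measurable $f$ with $\int_\Omega\varphi(x,\lambda|f(x)|)\,dx<\infty$ for some $\lambda>0$, with the quasinorm $\|f\|_{L^\varphi(\Omega)}=\inf\{\lambda>0:\int_\Omega\varphi(x,|f(x)|/\lambda)\,dx\le1\}$. Maximal function: $Mf(x)=\sup_B\frac1{|B|}\int_{B}|f(y)|\,dy$, the supremum being over all open balls $B\subset\mathbb{R}^n$ containing $x$. Boundedness of $M$ means that there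 is $K$ with $\|Mf\|_{L^\varphi(\mathbb{R}^n)}\le K\|f\|_{L^\varphi(\mathbb{R}^n)}$ for all $f\in L^\varphi(\mathbb{R}^n)$. *)

(* Defs.v *)
From HB Require Import structures.
From mathcomp Require Import all_boot all_order all_algebra.
From mathcomp Require Import all_classical all_reals all_analysis measurable_realfun.

Set Implicit Arguments.
Unset Strict Implicit.
Unset Printing Implicit Defensive.
Import Order.TTheory GRing.Theory Num.Theory.
Import numFieldNormedType.Exports.

Local Open Scope classical_set_scope.
Local Open Scope ring_scope.

(* n-dimensional Lebesgue measure is not in the library. On the Borel sets of
   R^n it is the n-fold product of the one-dimensional one, transported along
   (x, v) |-> x :: v; Lebesgue measurable sets and Lebesgue measure are then
   obtained by completion. *)
Section borel_lebesgue_tuple.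
Context {R : realType}.

Local Notation mR := (measurableTypeR R).

Definition pair_cons n (p : mR * n.-tuple R) : n.+1.-tuple R :=
  [the n.+1.-tuple R of (p.1 : R) :: p.2].

Definition uncons n (v : n.+1.-tuple R) : mR * n.-tuple R :=
  (thead v, [tuple of behead v]).

Lemma pair_consK n : cancel (@pair_cons n) (@uncons n).
Proof. by case=> x v; congr pair; exact/val_inj. Qed.

Lemma measurable_pair_cons n :
  measurable_fun [set: mR * n.-tuple R] (@pair_cons n).
Proof. exact: (@measurable_cons _ _ (mR * n.-tuple R)%type R fst n snd).
Qed.

Lemma measurable_uncons n :
  measurable_fun [set: n.+1.-tuple R] (@uncons n).
Proof.
apply/measurable_fun_pair; last exact: measurable_behead.
by move=> _ Y mY; exact: (measurable_tnth (ord0 : 'I_n.+1) measurableT mY).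
Qed.

Section step.
Variables (n : nat) (m : {sigma_finite_measure set (n.-tuple R) -> \bar R}).

Definition lebesgue_cons : set (n.+1.-tuple R) -> \bar R :=
  pushforward (@lebesgue_measure R \x m)%E (@pair_cons n).

Let lebesgue_cons0 : lebesgue_cons set0 = 0%E.
Proof. by rewrite /lebesgue_cons /pushforward preimage_set0 measure0. Qed.

Let lebesgue_cons_ge0 A : (0 <= lebesgue_cons A)%E.
Proof. exact: (measure_ge0 (@lebesgue_measure R \x m)%E). Qed.

Let lebesgue_cons_sigma_additive : semi_sigma_additive lebesgue_cons.
Proof.
move=> F mF tF mUF; rewrite /lebesgue_cons /pushforward preimage_bigcup.
have mp B : measurable B -> measurable (@pair_cons n @^-1` B).
  by move=> mB; rewrite -[X in measurable X]setTI; exact: measurable_pair_cons.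
apply: measure_semi_sigma_additive.
- by move=> k; exact: mp.
- apply/trivIsetP => /= i j _ _ ij; rewrite -preimage_setI.
  by move/trivIsetP : tF => /(_ _ _ _ _ ij) ->//; rewrite preimage_set0.
- by rewrite -preimage_bigcup; exact: mp.
Qed.

HB.instance Definition _ := isMeasure.Build _ _ _ lebesgue_cons
  lebesgue_cons0 lebesgue_cons_ge0 lebesgue_cons_sigma_additive.

Let lebesgue_cons_sigma_finite : sigma_finite setT lebesgue_cons.
Proof.
have /sigma_finiteP[F [FT ndF Foo]] := sigma_finiteT (@lebesgue_measure R).
have /sigma_finiteP[G [GT ndG Goo]] := sigma_finiteT m.
exists (fun k => @uncons n @^-1` (F k `*` G k)) => [|k].
  apply/esym; rewrite -subTset => v _.
  have [i _ Fi] : (\bigcup_i F i) (uncons v).1 by rewrite -FT.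
  have [j _ Gj] : (\bigcup_i G i) (uncons v).2 by rewrite -GT.
  exists (maxn i j) => //; split => /=.
    by move: Fi; exact/subsetPset/ndF/leq_maxl.
  by move: Gj; exact/subsetPset/ndG/leq_maxr.
have [mF Fk] := Foo k; have [mG Gk] := Goo k.
split.
  rewrite -[X in measurable X]setTI; apply: measurable_uncons => //.
  exact: measurableX.
rewrite /lebesgue_cons /pushforward.
rewrite (_ : _ @^-1` _ = F k `*` G k); last first.
  rewrite -comp_preimage (_ : _ \o _ = id) ?preimage_id//.
  exact/funext/pair_consK.
by rewrite product_measure1E// lte_mul_pinfty// ge0_fin_numE.
Qed.

HB.instance Definition _ := Measure_isSigmaFinite.Build _ _ _ lebesgue_cons
  lebesgue_cons_sigma_finite.

End step.

Fixpoint borel_lebesgue n : {sigma_finite_measure set (n.-tuple R) -> \bar R} :=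
  match n with
  | 0 => \d_([tuple] : 0.-tuple R)
  | k.+1 => lebesgue_cons (borel_lebesgue k)
  end.

End borel_lebesgue_tuple.

(* The points of Rn R n are the n-tuples; its measurable sets are the
   Caratheodory-measurable sets of the outer measure of borel_lebesgue n,
   that is, the Lebesgue measurable subsets of R^n. *)
Definition Rn (R : realType) (n : nat) : Type :=
  caratheodory_type ((@borel_lebesgue R n)^*)%mu.

HB.instance Definition _ (R : realType) (n : nat) := Measurable.copy (Rn R n)
  (caratheodory_type ((@borel_lebesgue R n)^*)%mu).

Definition lebesgue_Rn {R : realType} {n : nat} :
    {measure set (Rn R n) -> \bar R} :=
  @completed_measure_extension _ _ _ (@borel_lebesgue R n).

Section orlicz.
Context {R : realType} {n : nat}.
Local Notation E := (Rn R n).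
Local Notation mu := (@lebesgue_Rn R n).
Implicit Types (phi psi : E -> R -> \bar R) (B : set E) (f : E -> \bar R).

Definition eucl_dist (x y : E) : R :=
  Num.sqrt (\sum_(i < n) (tnth x i - tnth y i) ^+ 2).

Definition euclidean_ball B :=
  exists (c : E) (r : R), 0 < r /\ B = [set x | eucl_dist c x < r].

(* on the interval ]0, +oo[ *)
Definition almost_increasing (L : R) (g : R -> \bar R) :=
  forall s t : R, 0 < s -> s < t -> (g s <= L%:E * g t)%E.

(* A function Omega * [0, +oo[ -> [0, +oo] is represented by
   phi : E -> R -> \bar R, of which only the values at t >= 0 are used. *)
Definition weak_Phi phi :=
  [/\ forall x (t : R), 0 <= t -> (0 <= phi x t)%E,
      forall f : E -> R, measurable_fun [set: E] f ->
        measurable_fun [set: E] (fun x => phi x `|f x|),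
      forall x (s t : R), 0 <= s -> s <= t -> (phi x s <= phi x t)%E,
      forall x, [/\ phi x 0 = 0%E,
                    phi x t @[t --> 0^'+] --> 0%E &
                    phi x t @[t --> +oo] --> +oo%E] &
      exists2 L : R, 1 <= L &
        forall x, almost_increasing L (fun t => phi x t * t^-1%:E)%E].

Definition weakly_equivalent phi psi :=
  exists (L : R) (h : E -> R), [/\ 1 <= L, h \in Lfun mu 1 &
    {ae mu, forall x, forall t : R, 0 <= t ->
      (psi x t <= phi x (L * t)%R + (h x)%:E)%E /\
      (phi x t <= psi x (L * t)%R + (h x)%:E)%E}].

(* Since phi x t --> +oo, the set below is nonempty for every real t. *)
Definition ginv phi (x : E) (t : R) : R :=
  inf [set tau | 0 <= tau /\ (t%:E <= phi x tau)%E].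

Definition aInc phi :=
  exists (p a : R), [/\ 1 < p, 1 <= a &
    {ae mu, forall x, forall t s : R, 0 < t -> t < s ->
      (phi x t * (t `^ p)^-1%:E <= a%:E * (phi x s * (s `^ p)^-1%:E))%E}].

Definition A0 phi :=
  exists beta : R, [/\ 0 < beta, beta <= 1 &
    {ae mu, forall x, beta <= ginv phi x 1 <= beta^-1}].

(* "Almost every x, y in B": all x, y in B outside a common null set. *)
Definition A1 phi :=
  exists beta : R, [/\ 0 < beta, beta < 1 &
    forall B, euclidean_ball B -> (mu B <= 1)%E ->
      exists2 N : set E, mu.-negligible N &
        forall x y, (B `\` N) x -> (B `\` N) y ->
          forall t : R, 1 <= t -> (t%:E <= (mu B)^-1)%E ->
            beta * ginv phi x t <= ginv phi y t].

Definition A2 phi :=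
  exists (phioo : R -> \bar R) (h : E -> R) (beta s : R),
    [/\ weak_Phi (fun _ => phioo),
        h \in Lfun mu 1 /\ h \in Lfun mu +oo%E,
        0 < beta <= 1, 0 < s &
    {ae mu, forall x, forall t : R, 0 <= t ->
      ((phioo t <= s%:E)%E -> (phi x (beta * t)%R <= phioo t + (h x)%:E)%E) /\
      ((phi x t <= s%:E)%E -> (phioo (beta * t)%R <= phi x t + (h x)%:E)%E)}].

(* phi x extended to [0, +oo] by its limit +oo, because the maximal function
   may take the value +oo. *)
Definition phi_ext phi (x : E) (u : \bar R) : \bar R :=
  if u is r%:E then phi x r else +oo%E.

Definition modular phi f : \bar R :=
  (\int[mu]_x phi_ext phi x `|f x|)%E.

Definition in_Lphi phi f :=
  measurable_fun [set: E] f /\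
  exists2 lambda : R, 0 < lambda &
    (modular phi (fun x => lambda%:E * f x) < +oo)%E.

(* the infimum of the empty set is +oo *)
Definition Lphi_norm phi f : \bar R :=
  ereal_inf [set lambda%:E | lambda in
    [set lambda : R | 0 < lambda /\
      (modular phi (fun x => f x * lambda^-1%:E) <= 1)%E]].

Definition HL_maximal_Rn f (x : E) : \bar R :=
  ereal_sup [set ((mu B)^-1 * \int[mu]_(y in B) `|f y|)%E |
    B in [set B | euclidean_ball B /\ B x]].

Definition maximal_bounded phi :=
  exists K : R, forall f, in_Lphi phi f ->
    (Lphi_norm phi (HL_maximal_Rn f) <= K%:E * Lphi_norm phi f)%E.

End orlicz.

(* Main.v *)
Require Import Defs.
From mathcomp Require Import all_boot all_order all_algebra.
From mathcomp Require Import all_classical all_reals all_analysis measurable_realfun.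
From mathcomp Require Import ring lra.

(** Both directions rest on one comparison. By (A1) the values phi(x, t) and
    phi(y, c t) are comparable for two points of a small ball B as long as they lie
    between 1 and 1 / |B|, and by (A2) small values are comparable, up to an
    integrable error, to those of a function phioo of t alone.

    Sufficiency of (aInc). Let psi satisfy (aInc) with exponent p > 1, let f have
    modular at most 1 and let a be the average of f over a ball B containing x. At
    least half of a comes from the points of B where f > a / 2. At such a point y
    the density psi(y, f(y)) is, by (aInc), at least a constant times
    (f(y) / a)^p psi(y, c a), and psi(y, c a) can be replaced by psi(x, c a): by (A1)
    if it is at least 1 (pointwise_large; it cannot exceed 1 / |B|, because f has
    modular at most 1), and through phioo if it is small (pointwise_small). For the
    latter phioo must inherit the growth of psi near zero; it does because the
    integrable error is small somewhere, the space having infinite measure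
    (phioo_growth). Taking p-th roots and averaging gives
      psi(x, c a) <= C (average of F^(1/p) over B)^p + h(x),
    where F = psi(., f) + h is integrable. So psi(x, c Mf(x)) is bounded by
    C (M(F^(1/p))(x))^p + h(x), and the Hardy-Littlewood theorem in L^p
    (strong_type) bounds its integral. That theorem is derived from Vitali's
    selection of disjoint balls and a dyadic interpolation argument, for the
    supremum over balls with rational data, which dominates a multiple of Mf. Weak
    equivalence then carries the bound from psi to phi, since modulars of multiples
    can be made small by the almost monotonicity of phi(x, t) / t.

    Necessity. If M is bounded, test it on f = u on a ball of radius d, with u and d
    such that f has modular at most 1. On the j-th annulus around the ball, of
    radii about rho^j d, Mf is at least about u / rho^(j n), while the measure of the
    annulus grows like rho^(j n). If phi grew only linearly between t and k t,
    where u is a multiple of k t, then all the annuli, about log k in number, would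
    contribute equally to the modular of Mf, which is bounded (testing). Hence
    phi(x, k t) >= 2 k phi(x, t) for a large k whenever phi(x, t) is not small
    (growth_large), and phioo(k t) >= 2 k phioo(t) for small values of phioo
    (growth_small). Such a gain over linear growth at a single scale iterates to the
    power p with k^p = 2 k (power_growth). Finally psi is glued from phioo for small
    t, a multiple of t^p in the middle and a multiple of phi for large t (glued): it
    satisfies (aInc), and it is comparable to phi where phi is at least 1, whence
    (A0) and (A1), and elsewhere up to the error in (A2), whence the weak
    equivalence. *)

Set Implicit Arguments.
Unset Strict Implicit.
Unset Printing Implicit Defensive.
Import Order.TTheory GRing.Theory Num.Theory.
Import numFieldNormedType.Exports.

Local Open Scope classical_set_scope.
Local Open Scope ring_scope.

(** * Euclidean balls and their measure *)

Section boxes.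
Context {R : realType}.

Definition box n (c : n.-tuple R) (a : R) : set (n.-tuple R) :=
  [set v | forall i, `|tnth v i - tnth c i| < a].

Lemma measurable_box n (c : n.-tuple R) a : measurable (box c a).
Proof.
have -> : box c a = \bigcap_(i in [set: 'I_n])
    ((fun v : n.-tuple R => tnth v i) @^-1`
       `](tnth c i - a), (tnth c i + a)[%classic).
  by apply/seteqP; split=> v /= vc i;
    [move=> _|]; have := vc i; rewrite /= in_itv/= ltr_distl//; apply.
apply: fin_bigcap_measurable => // i _; rewrite -[X in measurable X]setTI.
by apply: (measurable_tnth i) => //; exact: measurable_itv.
Qed.

Lemma borel_lebesgue_box n (c : n.-tuple R) (a : R) : 0 < a ->
  borel_lebesgue n (box c a) = ((2 * a) ^+ n)%:E.
Proof.
move=> a0; elim: n c => [|n IH] c.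
  rewrite /= expr0 /dirac indicE mem_set// => -[]//.
rewrite /= /lebesgue_cons /pushforward.
have -> : @pair_cons R n @^-1` box c a =
    `](thead c - a), (thead c + a)[%classic `*` box [tuple of behead c] a.
  apply/seteqP; split=> -[x v] /=.
    move=> xv; split.
      by have := xv ord0; rewrite /= in_itv/= ltr_distl.
    move=> i; have := xv (lift ord0 i).
    rewrite [tnth (pair_cons _) _]tnthS/= tnth_behead.
    congr (`| _ - tnth _ _| < _); apply/val_inj => /=.
    by rewrite inordK// ltnS ltn_ord.
  rewrite in_itv/= -ltr_distl => -[xc vc] i.
  case: (unliftP ord0 i) => [j ->|->]; last by rewrite tnth0.
  have := vc j; rewrite [tnth (pair_cons _) _]tnthS/= tnth_behead.
  congr (`| _ - tnth _ _| < _); apply/val_inj => /=.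
  by rewrite inordK// ltnS ltn_ord.
rewrite product_measure1E//; last exact: measurable_box.
transitivity ((2 * a)%:E * ((2 * a) ^+ n)%:E)%E; last by rewrite -EFinM exprS.
congr (_ * _)%E; last exact: IH.
etransitivity; first exact: (lebesgue_measure_itv `](thead c - a), (thead c + a)[).
by rewrite /= lte_fin ltrD2l gtrN// -EFinB; congr EFin; lra.
Qed.

End boxes.

Section Rn_geometry.
Context {R : realType} {n : nat}.
Local Notation E := (Rn R n).
Local Notation mu := (@lebesgue_Rn R n).

Lemma measurable_Rn (A : set (n.-tuple R)) :
  measurable A -> measurable (A : set E).
Proof. exact: caratheodory_measurable_mu_ext. Qed.

Lemma lebesgue_RnE (A : set (n.-tuple R)) :
  measurable A -> mu A = borel_lebesgue n A.
Proof. exact: measurable_mu_extE. Qed.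

Lemma lebesgue_Rn_complete : measure_is_complete mu.
Proof. exact: measure_is_complete_caratheodory. Qed.

Lemma lebesgue_Rn_box (c : n.-tuple R) (a : R) : 0 < a ->
  mu (box c a) = ((2 * a) ^+ n)%:E.
Proof.
by move=> a0; rewrite lebesgue_RnE ?borel_lebesgue_box//; exact: measurable_box.
Qed.

Definition eball (c : E) (r : R) : set E := [set x | eucl_dist c x < r].

Lemma euclidean_ball_eball c (r : R) : 0 < r -> euclidean_ball (eball c r).
Proof. by move=> r0; exists c, r. Qed.

Lemma measurable_eball c r : measurable (eball c r).
Proof.
apply: measurable_Rn; rewrite -[X in measurable X]setTI.
have -> : eball c r = (fun x => eucl_dist c x) @^-1` `]-oo, r[%classic.
  by apply/seteqP; split => x /=; rewrite in_itv.
have : measurable_fun [set: n.-tuple R] (fun x => eucl_dist c x).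
  have msq : measurable_fun [set: R] (@Num.sqrt R).
    by apply: continuous_measurable_fun; exact: sqrt_continuous.
  apply: (measurableT_comp msq).
  apply: measurable_sum => i; apply: measurable_funX.
  by apply: measurable_funB => //; exact: measurable_tnth.
by apply => //; exact: measurable_itv.
Qed.

Lemma eucl_dist_ge0 (x y : E) : 0 <= eucl_dist x y.
Proof. exact: sqrtr_ge0. Qed.

Lemma eucl_dist_sym (x y : E) : eucl_dist x y = eucl_dist y x.
Proof.
by rewrite /eucl_dist; congr Num.sqrt; apply: eq_bigr => i _; rewrite -sqrrN opprB.
Qed.

Lemma eucl_distxx (x : E) : eucl_dist x x = 0.
Proof. by rewrite /eucl_dist big1 ?sqrtr0// => i _; rewrite subrr expr0n. Qed.

Lemma sqr_eucl_dist (x y : E) :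
  eucl_dist x y ^+ 2 = \sum_(i < n) (tnth x i - tnth y i) ^+ 2.
Proof. by rewrite sqr_sqrtr// sumr_ge0// => i _; exact: sqr_ge0. Qed.

(** The quadratic polynomial t |-> |a + t b|^2 is nonnegative at its minimum. *)
Lemma cauchy_schwarz (a b : 'I_n -> R) :
  (\sum_i a i * b i) ^+ 2 <= (\sum_i a i ^+ 2) * (\sum_i b i ^+ 2).
Proof.
set A := \sum_i a i ^+ 2; set B := \sum_i b i ^+ 2; set C := \sum_i a i * b i.
have B0 : 0 <= B by apply: sumr_ge0 => i _; exact: sqr_ge0.
have H t : 0 <= A + 2 * t * C + t ^+ 2 * B.
  have -> : A + 2 * t * C + t ^+ 2 * B = \sum_i (a i + t * b i) ^+ 2.
    rewrite /A /B /C !mulr_sumr -!big_split/=; apply: eq_bigr => i _; ring.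
  by apply: sumr_ge0 => i _; exact: sqr_ge0.
have [B00|B_neq0] := eqVneq B 0.
  have [->|C0] := eqVneq C 0; first by rewrite expr0n/= B00 mulr0.
  have := H (- (A + 1) / (2 * C)); rewrite B00 mulr0 addr0.
  have -> : A + 2 * (- (A + 1) / (2 * C)) * C = -1 by field.
  by rewrite lerNr oppr0 ler10.
have Bp : 0 < B by rewrite lt_def B_neq0.
have := H (- C / B).
have -> : A + 2 * (- C / B) * C + (- C / B) ^+ 2 * B = (A * B - C ^+ 2) / B.
  by field.
by rewrite pmulr_lge0 ?invr_gt0// subr_ge0.
Qed.

Lemma eucl_dist_triangle (y x z : E) :
  eucl_dist x z <= eucl_dist x y + eucl_dist y z.
Proof.
rewrite -(@ler_pXn2r _ 2)// ?nnegrE ?addr_ge0 ?eucl_dist_ge0//.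
rewrite sqrrD !sqr_eucl_dist.
pose a i : R := tnth x i - tnth y i; pose b i : R := tnth y i - tnth z i.
have -> : \sum_(i < n) (tnth x i - tnth z i) ^+ 2 =
    \sum_i a i ^+ 2 + (\sum_i a i * b i) *+ 2 + \sum_i b i ^+ 2.
  rewrite -sumrMnl -!big_split/=; apply: eq_bigr => i _; rewrite /a /b; ring.
rewrite lerD2r lerD2l lerMn2r/=.
apply: le_trans (ler_norm _) _.
rewrite -(@ler_pXn2r _ 2)// ?nnegrE ?mulr_ge0 ?eucl_dist_ge0//.
by rewrite exprMn !sqr_eucl_dist real_normK ?num_real ?cauchy_schwarz.
Qed.

Lemma eball_center c (r : R) : 0 < r -> eball c r c.
Proof. by move=> r0; rewrite /eball/= eucl_distxx. Qed.

Lemma box_sub_eball (c : E) (r : R) : (0 < n)%N -> 0 < r ->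
  box c (r / n%:R) `<=` eball c r.
Proof.
move=> n0 r0 x xc; rewrite /eball/= -(@ltr_pXn2r _ 2)// ?nnegrE ?eucl_dist_ge0 ?ltW//.
have nR : 0 < n%:R :> R by rewrite ltr0n.
rewrite sqr_eucl_dist.
apply: (@lt_le_trans _ _ (\sum_(i < n) (r / n%:R) ^+ 2)).
  apply: ltr_sum; first by apply/hasP; exists (Ordinal n0) => //; rewrite mem_index_enum.
  move=> i _; rewrite -(real_normK (num_real (_ - _))) ltr_pXn2r ?nnegrE ?normr_ge0//.
    by rewrite distrC xc.
  by rewrite divr_ge0 ?ltW.
rewrite sumr_const card_ord expr_div_n -[_ *+ n]mulr_natl.
have -> : n%:R * (r ^+ 2 / n%:R ^+ 2) = r ^+ 2 / n%:R :> R by field; rewrite gt_eqF.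
by rewrite ler_pdivrMr// ler_peMr ?sqr_ge0// ler1n.
Qed.

Lemma eball_sub_box (c : E) (r : R) : eball c r `<=` box c r.
Proof.
move=> x xc i; apply: le_lt_trans xc.
rewrite -(@ler_pXn2r _ 2)// ?nnegrE ?eucl_dist_ge0// sqr_eucl_dist real_normK ?num_real//.
rewrite (bigD1 i)//= -(sqrrN (tnth x i - _)) opprB lerDl.
by apply: sumr_ge0 => j _; exact: sqr_ge0.
Qed.

(** The volume of a ball is only used up to a factor depending on the
    dimension, and inscribed and circumscribed cubes provide such bounds. *)
Definition ballc : R := (2 / n%:R) ^+ n.

Hypothesis n0 : (0 < n)%N.

Lemma ballc_gt0 : 0 < ballc.
Proof. by rewrite exprn_gt0// divr_gt0// ltr0n. Qed.

Lemma eball_ge c (r : R) : 0 < r -> ((ballc * r ^+ n)%:E <= mu (eball c r))%E.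
Proof.
move=> r0; have nR : 0 < n%:R :> R by rewrite ltr0n.
rewrite /ballc -exprMn mulrAC -mulrA -(@lebesgue_Rn_box c) ?divr_gt0//.
apply: le_measure; rewrite ?inE; [| |exact: box_sub_eball].
- by apply: measurable_Rn; exact: measurable_box.
- exact: measurable_eball.
Qed.

Lemma eball_le c (r : R) : 0 < r -> (mu (eball c r) <= ((2 * r) ^+ n)%:E)%E.
Proof.
move=> r0; rewrite -(@lebesgue_Rn_box c)//.
apply: le_measure; rewrite ?inE; [| |exact: eball_sub_box].
- exact: measurable_eball.
- by apply: measurable_Rn; exact: measurable_box.
Qed.

Lemma eball_fin c (r : R) : 0 < r -> mu (eball c r) \is a fin_num.
Proof.
by move=> r0; rewrite ge0_fin_numE// (le_lt_trans (eball_le c r0))// ltry.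
Qed.

Lemma eball_gt0 c (r : R) : 0 < r -> (0 < mu (eball c r))%E.
Proof.
move=> r0; apply: lt_le_trans (eball_ge c r0).
by rewrite lte_fin mulr_gt0 ?ballc_gt0// exprn_gt0.
Qed.

Definition vol c r : R := fine (mu (eball c r)).

Lemma volE c (r : R) : 0 < r -> mu (eball c r) = (vol c r)%:E.
Proof. by move=> r0; rewrite fineK// eball_fin. Qed.

Lemma vol_gt0 c (r : R) : 0 < r -> 0 < vol c r.
Proof. by move=> r0; rewrite -lte_fin -volE// eball_gt0. Qed.

Lemma vol_ge c (r : R) : 0 < r -> ballc * r ^+ n <= vol c r.
Proof. by move=> r0; rewrite -lee_fin -volE// eball_ge. Qed.

Lemma vol_le c (r : R) : 0 < r -> vol c r <= (2 * r) ^+ n.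
Proof. by move=> r0; rewrite -lee_fin -volE// eball_le. Qed.

Lemma lebesgue_Rn_setT : mu setT = +oo%E.
Proof.
apply/eqyP => r r0; pose s := Num.max 1 (r / 2).
have s0 : 0 < s by rewrite lt_max ltr01.
apply: (@le_trans _ _ (mu (box [tuple of nseq n 0] s))); last first.
  by apply: le_measure; rewrite ?inE//; apply: measurable_Rn; exact: measurable_box.
rewrite lebesgue_Rn_box// lee_fin (@le_trans _ _ (2 * s))//.
  by rewrite mulrC -ler_pdivrMr// le_max lexx orbT.
by rewrite ler_eXnr// (@le_trans _ _ 2)// ?ler1n// ler_peMr// le_max lexx.
Qed.

Definition qpoint (q : n.-tuple rat) : E := [tuple of map ratr q].

Lemma qpoint_dense (x : E) (e : R) : 0 < e -> exists q, eucl_dist x (qpoint q) < e.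
Proof.
move=> e0; have en : 0 < e / n%:R by rewrite divr_gt0// ltr0n.
have H (i : 'I_n) : exists q : rat, `|ratr q - tnth x i| < e / n%:R.
  have : tnth x i - e / n%:R < tnth x i + e / n%:R by lra.
  by move=> /rat_in_itvoo[q]; rewrite in_itv/= -ltr_distl; exists q.
have [f fP] := choice H.
exists [tuple f i | i < n]; apply: box_sub_eball => // i.
by rewrite tnth_map tnth_mktuple; exact: fP.
Qed.

End Rn_geometry.

(** * Integration and interpolation *)

Section misc_powR.
Context {R : realType}.
Implicit Types a x y : R.

Lemma le_powR a x y : 0 <= a -> 0 <= x -> x <= y -> x `^ a <= y `^ a.
Proof.
by move=> a0 x0 xy; apply: ge0_ler_powR; rewrite ?nnegrE// (le_trans x0).
Qed.

Lemma lt_powR a x y : 0 < a -> 0 <= x -> x < y -> x `^ a < y `^ a.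
Proof.
by move=> a0 x0 xy; apply: gt0_ltr_powR; rewrite ?nnegrE// (le_trans x0)// ltW.
Qed.

End misc_powR.

Section misc_integral.
Context d (T : measurableType d) (R : realType) (mu : {measure set T -> \bar R}).

Import HBNNSimple.

(** The integral of a nonnegative function is a supremum over the simple
    functions below it, so that it is monotone even when the functions are not
    known to be measurable. *)
Lemma ge0_le_integralT (f g : T -> \bar R) :
  (forall x, 0 <= f x)%E -> (forall x, f x <= g x)%E ->
  (\int[mu]_x f x <= \int[mu]_x g x)%E.
Proof.
move=> f0 fg; have g0 x : (0 <= g x)%E := le_trans (f0 x) (fg x).
rewrite !ge0_integralTE//; apply: ereal_sup_le => _ [h hf <-].
by exists h => // x; exact: le_trans (fg x).
Qed.

Lemma ae_ge0_le_integralT (f g : T -> \bar R) :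
  measure_is_complete mu -> measurable_fun setT g ->
  (forall x, 0 <= f x)%E -> (forall x, 0 <= g x)%E ->
  {ae mu, forall x, f x <= g x}%E ->
  (\int[mu]_x f x <= \int[mu]_x g x)%E.
Proof.
move=> cmu mg f0 g0 [N [mN N0 fgN]].
pose g' x := if x \in N then +oo%E else g x.
have gg' : (\int[mu]_x g x = \int[mu]_x g' x)%E.
  apply: ge0_ae_eq_integral => //.
  - apply: (ae_measurable_fun cmu _ mg).
    exists N; split=> // x /=; apply: contra_notP => xN _.
    by rewrite /g' memNset.
  - by move=> x _; rewrite /g'; case: ifP => // _; exact: leey.
  - exists N; split=> // x /=; apply: contra_notP => xN _.
    by rewrite /g' memNset.
rewrite gg'; apply: ge0_le_integralT => // x; rewrite /g'.
by case: ifPn => [_|/negP xN]; [exact: leey|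
  apply: contra_notP xN => fgx; exact/mem_set/fgN].
Qed.

Lemma measurable_truncation (G : T -> R) (l : R) : measurable_fun setT G ->
  measurable_fun setT (fun x => G x * (l < 2 * G x)%R%:R).
Proof.
move=> mG; apply: measurable_funM => //.
have -> : (fun x => (l < 2 * G x)%R%:R) = \1_[set x | l < 2 * G x] :> (T -> R).
  apply/funext => x; rewrite indicE; case: (boolP (l < 2 * G x)%R) => h.
    by rewrite mem_set.
  by rewrite memNset//; exact/negP.
apply: measurable_indic; rewrite -[X in measurable X]setTI.
have -> : [set x | l < 2 * G x] = (fun x => 2 * G x) @^-1` `]l, +oo[%classic.
  by apply/seteqP; split => x /=; rewrite in_itv/= andbT.
have : measurable_fun setT (fun x => 2 * G x) by exact: measurable_funM.
by apply => //; exact: measurable_itv.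
Qed.

Lemma integral_le_truncation (A : set T) (G : T -> R) (l : R) :
  measurable A -> measurable_fun setT G -> 0 <= l -> (forall x, 0 <= G x) ->
  (\int[mu]_(x in A) (G x)%:E <=
   \int[mu]_(x in A) (G x * (l < 2 * G x)%R%:R)%:E + (l / 2)%:E * mu A)%E.
Proof.
move=> mA mG l0 G0; rewrite -integral_cst//.
have mG1 := measurable_truncation l mG.
have mA1 : measurable_fun A (fun x => (G x * (l < 2 * G x)%R%:R)%:E).
  by apply/measurable_EFinP; exact: measurable_funTS.
rewrite -ge0_integralD//; first last.
- by move=> x _; rewrite lee_fin divr_ge0.
- by move=> x _; rewrite lee_fin mulr_ge0.
apply: ge0_le_integral => //.
- by move=> x _; rewrite lee_fin.
- by apply/measurable_EFinP; exact: measurable_funTS.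
- by apply: emeasurable_funD.
- move=> x _; rewrite -EFinD lee_fin; case: ltP => [_|].
    by rewrite mulr1 lerDl divr_ge0.
  by rewrite mulr0 add0r ler_pdivlMr// mulrC.
Qed.

End misc_integral.

Section marcinkiewicz.
Context d (T : measurableType d) (R : realType) (mu : {measure set T -> \bar R}).

Let dy (N k : nat) : R := 2 ^+ k / 2 ^+ N.

Let dy_gt0 N k : 0 < dy N k.
Proof. by rewrite divr_gt0 ?exprn_gt0. Qed.

Let dyS N k : dy N k.+1 = 2 * dy N k.
Proof. by rewrite /dy exprS mulrA. Qed.

Let dySS N k : dy N.+1 k.+1 = dy N k.
Proof. by rewrite /dy !exprS; field; rewrite expf_neq0. Qed.

(** A geometric sum is comparable to its largest term, here the last one below
    the cutoff g. *)
Let dyadic_sum (a g : R) N m : 0 < a -> 0 <= g ->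
  \sum_(k < m) (dy N k `^ a * (dy N k < g)%R%:R) <=
    (2 `^ a / (2 `^ a - 1)) * g `^ a.
Proof.
move=> a0 g0; set q := 2 `^ a.
have q1 : 0 < q - 1.
  by rewrite subr_gt0 -[ltLHS](congr1 (@^~ a) (@powR1 R)) lt_powR// ltr1n.
have dq N' k : dy N' k.+1 `^ a = q * dy N' k `^ a.
  by rewrite dyS powRM// ltW.
have all_le m' : \sum_(k < m') (dy N k `^ a * (dy N k < g)%R%:R) <=
    dy N m' `^ a / (q - 1).
  elim: m' => [|m' IH]; first by rewrite big_ord0 divr_ge0 ?powR_ge0// ltW.
  rewrite big_ord_recr/= (le_trans (lerD IH (_ : _ <= dy N m' `^ a)))//.
    by rewrite ler_piMr ?powR_ge0// lern1 leq_b1.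
  by rewrite dq le_eqVlt; apply/orP/or_introl/eqP; field; exact: lt0r_neq0.
elim: m => [|m IH].
  rewrite big_ord0 mulr_ge0 ?powR_ge0// divr_ge0 ?powR_ge0// ltW//.
rewrite big_ord_recr/=; case: ltP => [dg|_]; last by rewrite mulr0 addr0.
rewrite mulr1 (le_trans (lerD (all_le m) (lexx _)))//.
rewrite (_ : _ + _ = q / (q - 1) * dy N m `^ a); last by field; exact: lt0r_neq0.
rewrite ler_wpM2l ?divr_ge0 ?powR_ge0// ?(ltW q1)//.
by rewrite le_powR ?ltW.
Qed.

Variables (S : T -> \bar R) (G : T -> R) (C p : R).
Hypotheses (p1 : 1 < p) (C0 : 0 <= C) (S0 : forall x, (0 <= S x)%E)
  (mS : forall l : R, measurable [set x | (l%:E < S x)%E])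
  (G0 : forall x, 0 <= G x) (mG : measurable_fun setT G)
  (weakS : forall l : R, 0 < l -> (mu [set x | (l%:E < S x)%E] <=
     (C / l)%:E * \int[mu]_x (G x * (l < 2 * G x)%R%:R)%:E)%E).

Let lev N k := [set x | ((dy N k)%:E < S x)%E].

Let mlev N k : measurable (lev N k). Proof. exact: mS. Qed.

(* S `^ p is compared with the dyadic levels 2 ^ i, for -N <= i < N; the index k
   stands for i + N. *)
Let Phi N x : R := \sum_(k < N + N) ((2 * dy N k) `^ p * \1_(lev N k) x).

Let Phi_ge0 N x : 0 <= Phi N x.
Proof. by apply: sumr_ge0 => k _; rewrite mulr_ge0 ?powR_ge0// indicE. Qed.

Let mPhi N : measurable_fun setT (Phi N).
Proof.
by apply: measurable_sum => k; apply: measurable_funM => //;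
  apply: measurable_indic.
Qed.

Let nd_Phi x : nondecreasing_seq (Phi ^~ x).
Proof.
apply/nondecreasing_seqP => N; rewrite /Phi addSn addnS big_ord_recl/=.
rewrite big_ord_recr/= addrCA -[leLHS]addr0 lerD//.
  apply: ler_sum => k _.
    have -> : lev N.+1 (bump 0 k) = lev N k by rewrite /lev dySS.
    by rewrite dySS.
by rewrite addr_ge0// mulr_ge0 ?powR_ge0// indicE.
Qed.

Let Phi_ge_term N k x : (k < N + N)%N -> ((dy N k)%:E < S x)%E ->
  (2 * dy N k) `^ p <= Phi N x.
Proof.
move=> kN kS; rewrite /Phi (bigD1 (Ordinal kN))//=.
rewrite indicE mem_set// mulr1 lerDl.
by apply: sumr_ge0 => i _; rewrite mulr_ge0 ?powR_ge0// indicE.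
Qed.

Let p_gt0 : 0 < p. Proof. exact: lt_trans ltr01 p1. Qed.

Let S_le_lim x : ((S x `^ p) <= limn (fun N => (Phi N x)%:E))%E.
Proof.
have -> : limn (fun N => (Phi N x)%:E) = ereal_sup (range (fun N => (Phi N x)%:E)).
  apply/cvg_lim => //; apply: ereal_nondecreasing_cvgn => N M NM.
  by rewrite lee_fin nd_Phi.
case Sx : (S x) (S0 x) => [s| |]//=; last first.
  move=> _; rewrite gt_eqF// leye_eq; apply/eqP/eqyP => r r0.
  have [N rN] : exists N : nat, r <= N%:R.
    by exists (Num.truncn r).+1; rewrite ltW// truncnS_gt.
  apply: (@le_trans _ _ (Phi N.+1 x)%:E); last by apply: ereal_sup_ubound; exists N.+1.
  rewrite lee_fin (le_trans rN)//.
  have kN : (N + N.+1 < N.+1 + N.+1)%N by rewrite addSn.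
  apply: le_trans (Phi_ge_term kN _); last by rewrite Sx ltry.
  rewrite -dyS (_ : dy _ _ = 2 ^+ N.+1); last first.
    by rewrite /dy -addSn exprD mulfK// expf_neq0.
  apply: (@le_trans _ _ (2 ^+ N.+1)); first by rewrite -natrX ler_nat ltnW// ltnW// ltn_expl.
  by rewrite le1r_powR// ?(ltW p1)// -natrX ler1n expn_gt0.
rewrite lee_fin le_eqVlt => /orP[/eqP <-|s0].
  rewrite powR0 ?gt_eqF//; apply: (@le_trans _ _ (Phi 0 x)%:E); first by rewrite lee_fin.
  by apply: ereal_sup_ubound; exists 0%N.
have [N [sN1 sN2]] : exists N : nat, 2 ^- N < s /\ s <= 2 ^+ N :> R.
  pose N := maxn (Num.truncn s).+1 (Num.truncn s^-1).+1.
  have H (r : R) : (Num.truncn r < N)%N -> r < 2 ^+ N.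
    move=> rN; apply: (@lt_le_trans _ _ N%:R).
      by rewrite (lt_le_trans (truncnS_gt r))// ler_nat.
    by rewrite -natrX ler_nat ltnW// ltn_expl.
  exists N; split.
    by rewrite -ltf_pV2 ?posrE ?invr_gt0 ?exprn_gt0// invrK H// leq_maxr.
  by rewrite ltW// H// leq_maxl.
have exk : exists k, s <= dy N k by exists (N + N)%N; rewrite /dy exprD mulfK// expf_neq0.
have kNN : (ex_minn exk <= N + N)%N.
  case: ex_minnP => k _; apply.
  by rewrite /dy exprD mulfK// expf_neq0.
case: ex_minnP kNN => -[|k] sk kmin kNN.
  by move: sk; rewrite /dy expr0 mul1r leNgt sN1.
apply: (@le_trans _ _ (Phi N x)%:E); last by apply: ereal_sup_ubound; exists N.
rewrite lee_fin; apply: le_trans (Phi_ge_term kNN _).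
  by rewrite -dyS le_powR ?(ltW p_gt0) ?(ltW s0).
rewrite Sx lte_fin ltNge; apply/negP => /kmin; by rewrite ltnn.
Qed.

Definition marcinkiewicz_constant : R :=
  C * 2 `^ p * (2 `^ (p - 1) / (2 `^ (p - 1) - 1)) * 2 `^ (p - 1).

Let int_Phi N : (\int[mu]_x (Phi N x)%:E <=
  marcinkiewicz_constant%:E * \int[mu]_x (G x `^ p)%:E)%E.
Proof.
have mGk l : measurable_fun setT (fun x => (G x * (l < 2 * G x)%R%:R)).
  exact: measurable_truncation.
have -> : (\int[mu]_x (Phi N x)%:E =
    \sum_(k < N + N) (((2 * dy N k) `^ p)%:E * mu (lev N k)))%E.
  under eq_integral do rewrite /Phi -sumEFin.
  rewrite ge0_integral_sum//.
  - apply: eq_bigr => k _; under eq_integral do rewrite EFinM.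
    rewrite ge0_integralZl_EFin//.
    + by rewrite integral_indic// setIT.
    + by apply/measurable_EFinP/measurable_indic.
    + exact: powR_ge0.
  - move=> k; apply/measurable_EFinP/measurable_funM => //.
  - by move=> k x _; rewrite lee_fin mulr_ge0 ?powR_ge0.
pose c k := (2 * dy N k) `^ p * (C / dy N k).
have c0 k : 0 <= c k by rewrite mulr_ge0 ?powR_ge0// divr_ge0// ltW.
apply: (@le_trans _ _ (\sum_(k < N + N)
    \int[mu]_x (c k * (G x * (dy N k < 2 * G x)%R%:R))%:E)%E).
  apply: lee_sum => k _; under eq_integral do rewrite EFinM.
  rewrite ge0_integralZl_EFin//; last 2 first.
  - by move=> x _; rewrite lee_fin mulr_ge0.
  - exact/measurable_EFinP.
  by rewrite /c EFinM -muleA lee_wpmul2l ?lee_fin ?powR_ge0// weakS.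
rewrite -ge0_integral_sum//; last 2 first.
- by move=> k; apply/measurable_EFinP; apply: measurable_funM => //; exact: mGk.
- by move=> k x _; rewrite lee_fin mulr_ge0// mulr_ge0.
have M0 : 0 <= marcinkiewicz_constant.
  rewrite /marcinkiewicz_constant !mulr_ge0 ?powR_ge0// invr_ge0.
  by rewrite subr_ge0 -[leLHS](powRr0 2) ler_powR ?ler1n// subr_ge0 ltW.
rewrite -ge0_integralZl_EFin//; last 2 first.
- by move=> x _; rewrite lee_fin powR_ge0.
- by apply/measurable_EFinP; exact: measurableT_comp (measurable_powR p) mG.
apply: ge0_le_integralT => x; first by apply: sume_ge0 => k _; rewrite lee_fin mulr_ge0// mulr_ge0.
rewrite sumEFin -EFinM lee_fin.
have -> : \sum_(k < N + N) c k * (G x * (dy N k < 2 * G x)%R%:R) =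
    (C * 2 `^ p * G x) *
    \sum_(k < N + N) (dy N k `^ (p - 1) * (dy N k < 2 * G x)%R%:R).
  rewrite mulr_sumr; apply: eq_bigr => k _; rewrite /c powRM// ?(ltW (dy_gt0 _ _))//.
  rewrite -(mulr_powRB1 (ltW (dy_gt0 N k)) p_gt0); field.
  by rewrite gt_eqF.
have pB1 : 0 < p - 1 by rewrite subr_gt0.
have := dyadic_sum N (N + N) pB1 (mulr_ge0 (ler0n _ 2) (G0 x)).
move=> /(ler_wpM2l (mulr_ge0 (mulr_ge0 C0 (powR_ge0 2 p)) (G0 x))) /le_trans; apply.
rewrite powRM// /marcinkiewicz_constant -(mulr_powRB1 (G0 x) p_gt0).
by rewrite le_eqVlt; apply/orP/or_introl/eqP; ring.
Qed.

(** A weak type inequality with the truncation at half the level integrates to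
    a strong one: at the dyadic levels the truncated functions sum up to a
    geometric series. *)
Lemma marcinkiewicz : (\int[mu]_x (S x `^ p) <=
  marcinkiewicz_constant%:E * \int[mu]_x (G x `^ p)%:E)%E.
Proof.
apply: (@le_trans _ _ (\int[mu]_x limn (fun N => (Phi N x)%:E))%E).
  by apply: ge0_le_integralT => // x; exact: poweR_ge0.
rewrite (monotone_convergence mu measurableT).
- apply: lime_le; last by apply: nearW => N; exact: int_Phi.
  apply: ereal_nondecreasing_is_cvgn => N M NM.
  by apply: ge0_le_integralT => x; rewrite lee_fin// nd_Phi.
- by move=> N; exact/measurable_EFinP.
- by move=> N x _; rewrite lee_fin.
- by move=> x _ N M NM; rewrite lee_fin nd_Phi.
Qed.

End marcinkiewicz.

(** * The maximal operator on balls *)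

Section vitali.
Context {R : realType} {n : nat} (n0 : (0 < n)%N).
Local Notation E := (Rn R n).
Local Notation mu := (@lebesgue_Rn R n).

Lemma eball_triple (c c' : E) (r r' : R) : r' <= r ->
  eball c r `&` eball c' r' !=set0 -> eball c' r' `<=` eball c (3 * r).
Proof.
move=> rr' [z [zc zc']] y yc'; rewrite /eball/= in zc zc' yc' *.
have := eucl_dist_triangle c' c y; have := eucl_dist_triangle z c c'.
have := eucl_dist_sym z c'; lra.
Qed.

(** Vitali's selection: a ball of maximal radius, tripled, swallows every ball
    which it meets; discard those and repeat. *)
Lemma vitali_selection (I : eqType) (c : I -> E) (r : I -> R) (s : seq I) :
  exists D : seq I, [/\ {subset D <= s}, uniq D,
    trivIset [set` D] (fun i => eball (c i) (r i)) &
    forall i, i \in s -> exists2 j, j \in D &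
      eball (c i) (r i) `<=` eball (c j) (3 * r j)].
Proof.
have [m] := ubnP (size s); elim: m s => // m IH [|i0 s0] sm.
  by exists [::]; split => //; exact: trivIset_set0.
set s := i0 :: s0.
have [i iS imax] : exists2 i, i \in s & forall j, j \in s -> r j <= r i.
  rewrite /s; elim: (s0) (i0) => [|j t IHt] i1.
    by exists i1 => [|j]; rewrite inE// => /eqP ->.
  have [k kt kmax] := IHt j; have [ki|ik] := leP (r k) (r i1).
    exists i1; rewrite ?inE ?eqxx// => l; rewrite inE => /predU1P[->//|/kmax].
    by move=> /le_trans; apply.
  exists k; first by rewrite inE kt orbT.
  by move=> l; rewrite inE => /predU1P[->|/kmax//]; exact: ltW.
pose t := [seq j <- s | `[< eball (c i) (r i) `&` eball (c j) (r j) = set0 >] && (j != i)].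
have ts : (size t < m)%N.
  rewrite -ltnS (leq_trans _ sm)// ltnS size_filter -(count_predC (fun j => `[< eball (c i) (r i) `&` eball (c j) (r j) = set0 >] && (j != i)) s).
  rewrite -[ltnLHS]addn0 ltn_add2l -has_count; apply/hasP; exists i => //=.
  by rewrite eqxx andbF.
have [D [Dt uD tD coverD]] := IH t ts.
exists (i :: D); split.
- move=> j; rewrite inE => /predU1P[->//|/Dt]; by rewrite mem_filter => /andP[].
- rewrite /= uD andbT; apply/negP => /Dt; rewrite mem_filter eqxx andbF//.
- have disj j : j \in D -> eball (c i) (r i) `&` eball (c j) (r j) = set0.
    by move=> /Dt; rewrite mem_filter => /andP[/andP[/asboolP]].
  move=> j k; rewrite /= !inE => /predU1P[->|jD] /predU1P[->|kD]//.
  + by move=> /set0P/eqP; rewrite disj.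
  + by move=> /set0P/eqP; rewrite setIC disj.
  + exact: tD.
- move=> j js; have [jt|] := boolP (j \in t).
    by have [k kD jk] := coverD _ jt; exists k => //; rewrite inE kD orbT.
  rewrite mem_filter js andbT negb_and negbK => /orP[/asboolP/eqP/set0P jI|/eqP->].
    by exists i; rewrite ?inE ?eqxx//; apply: eball_triple => //; exact: imax.
  exists i; rewrite ?inE ?eqxx// => y; rewrite /eball/=.
  have := eucl_dist_ge0 (c i) y; lra.
Qed.

End vitali.

Section maximal_function.
Context {R : realType} {n : nat} (n0 : (0 < n)%N).
Local Notation E := (Rn R n).
Local Notation mu := (@lebesgue_Rn R n).

(** The balls with rational data are comparable to all the balls, and there
    are only countably many of them: this makes the superlevel sets of the
    maximal function measurable and lets exceptional null sets, given ball by
    ball, be united. An index that does not decode to a ball stands for a unit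
    ball, so that every index is meaningful. *)
Definition qcenter (k : nat) : E :=
  if @unpickle (n.-tuple rat * rat)%type k is Some (q, _) then qpoint q
  else qpoint [tuple of nseq n 0].

Definition qradius (k : nat) : R :=
  if @unpickle (n.-tuple rat * rat)%type k is Some (_, r) then
    if 0 < r then ratr r else 1
  else 1.

Definition qball k := eball (qcenter k) (qradius k).

Lemma qradius_gt0 k : 0 < qradius k.
Proof.
by rewrite /qradius; case: unpickle => [[_ r]|//]; case: ifP => // r0; rewrite ltr0q.
Qed.

Lemma qball_cover (c : E) (r : R) : 0 < r ->
  exists k, eball c r `<=` qball k /\ qradius k < 2 * r.
Proof.
move=> r0; have [q cq] := qpoint_dense n0 c (divr_gt0 r0 (ltr0n R 2)).
have /rat_in_itvoo[s] : r + r / 2 < 2 * r by lra.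
rewrite in_itv/= => /andP[rs sr].
have s0 : 0 < s by rewrite -(ltr0q R) (lt_trans _ rs)// addr_gt0// divr_gt0.
exists (pickle (q, s)); rewrite /qball /qcenter /qradius pickleK s0; split => // x.
rewrite /eball/= => cx; have := eucl_dist_triangle c (qpoint q) x.
by rewrite (eucl_dist_sym (qpoint q) c); lra.
Qed.

Definition avg (G : E -> \bar R) (k : nat) : \bar R :=
  ((mu (qball k))^-1 * \int[mu]_(y in qball k) G y)%E.

Definition qmax (G : E -> \bar R) (x : E) : \bar R :=
  ereal_sup [set avg G k | k in [set k | qball k x]].

Lemma measurable_qball k : measurable (qball k).
Proof. exact: measurable_eball. Qed.

Lemma qvolE k : mu (qball k) = (vol (qcenter k) (qradius k))%:E.
Proof. by rewrite -volE//; exact: qradius_gt0. Qed.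

Lemma qvol_gt0 k : 0 < vol (qcenter k) (qradius k).
Proof. by apply: vol_gt0 => //; exact: qradius_gt0. Qed.

Lemma avgE G k :
  avg G k = ((vol (qcenter k) (qradius k))^-1%:E * \int[mu]_(y in qball k) G y)%E.
Proof. by rewrite /avg qvolE inver gt_eqF// qvol_gt0. Qed.

Lemma avg_ge0 G k : (forall x, 0 <= G x)%E -> (0 <= avg G k)%E.
Proof.
move=> G0; rewrite avgE; apply: mule_ge0; last exact: integral_ge0.
by rewrite lee_fin invr_ge0 ltW// qvol_gt0.
Qed.

Lemma in_qball x : exists k, qball k x.
Proof.
by have [k [kx _]] := qball_cover x ltr01; exists k; apply: kx; exact: eball_center.
Qed.

Lemma qmax_ge0 G x : (forall x, 0 <= G x)%E -> (0 <= qmax G x)%E.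
Proof.
move=> G0; have [k kx] := in_qball x.
apply: (le_trans (avg_ge0 k G0)); apply: ereal_sup_ubound; by exists k.
Qed.

Lemma qmax_levelE G (l : R) : [set x | (l%:E < qmax G x)%E] =
  \bigcup_(k in [set k | (l%:E < avg G k)%E]) qball k.
Proof.
apply/seteqP; split=> x /=.
  by move=> /ereal_sup_gt[_ [k kx <-]] lk; exists k.
move=> [k lk kx]; apply: (lt_le_trans lk).
by apply: ereal_sup_ubound; exists k.
Qed.

Lemma measurable_qmax_level G (l : R) : measurable [set x | (l%:E < qmax G x)%E].
Proof.
by rewrite qmax_levelE; apply: bigcup_measurable => k _; exact: measurable_qball.
Qed.

Lemma measurable_qmax G : measurable_fun setT (qmax G).
Proof.
move=> mT; apply: (measurability _ (ErealGenOInfty.measurableE R)) => //.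
move=> _ [_ [l ->] <-]; rewrite setTI.
have -> : qmax G @^-1` `]l%:E, +oo[ = [set x | (l%:E < qmax G x)%E].
  by apply/seteqP; split => x /=; rewrite in_itv/= andbT.
exact: measurable_qmax_level.
Qed.

Definition weak_constant : R := 6 ^+ n / @ballc R n.

Lemma weak_constant_gt0 : 0 < weak_constant.
Proof. by apply: divr_gt0; [rewrite exprn_gt0|exact: ballc_gt0]. Qed.

Lemma triple_vol (c : E) (r : R) : 0 < r ->
  vol c (3 * r) <= weak_constant * vol c r.
Proof.
move=> r0; rewrite (le_trans (vol_le c (_ : 0 < 3 * r)))// ?mulr_gt0//.
rewrite mulrA (_ : 2 * 3 = 6)//; last by ring.
rewrite exprMn /weak_constant -mulrA ler_wpM2l ?exprn_ge0//.
by rewrite ler_pdivlMl ?ballc_gt0// vol_ge.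
Qed.

(** The selected balls are disjoint, and their tripled copies cover all of them
    with comparable measure. *)
Lemma weak_type_finite (G : E -> \bar R) (l : R) (s : seq nat) : 0 < l ->
  (forall x, 0 <= G x)%E -> measurable_fun setT G ->
  (forall k, k \in s -> (l%:E < avg G k)%E) ->
  (mu (\bigcup_(k in [set` s]) qball k) <= (weak_constant / l)%:E * \int[mu]_x G x)%E.
Proof.
move=> l0 G0 mG ls.
have [D [Ds uD tD cover]] := vitali_selection qcenter qradius s.
have w0 := weak_constant_gt0.
have wl0 : 0 <= weak_constant / l by rewrite divr_ge0 ?(ltW w0) ?(ltW l0).
apply: (@le_trans _ _ (\sum_(k <- D) mu (eball (qcenter k) (3 * qradius k)))%E).
  apply: (@le_trans _ _ (mu (\big[setU/set0]_(k <- D) eball (qcenter k) (3 * qradius k)))).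
    apply: le_measure; rewrite ?inE.
    - by apply: bigcup_measurable => k _; exact: measurable_qball.
    - by apply: bigsetU_measurable => k _; exact: measurable_eball.
    - move=> x [k /= ks kx]; rewrite -bigcup_seq.
      by have [j jD kj] := cover _ ks; exists j => //; exact: kj.
  elim: (D) => [|j t IH]; first by rewrite !big_nil measure0.
  rewrite !big_cons; apply: le_trans (leeD2l _ IH).
  apply: measureU2; first exact: measurable_eball.
  by apply: bigsetU_measurable => k _; exact: measurable_eball.
have lqvol k : k \in D -> (mu (eball (qcenter k) (3 * qradius k)) <=
    (weak_constant / l)%:E * \int[mu]_(y in qball k) G y)%E.
  move=> /Ds/ls; have r0 := qradius_gt0 k; have v0 := qvol_gt0 k.
  rewrite avgE muleC lte_pdivlMr// => lG.
  rewrite volE ?mulr_gt0//.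
  apply: (@le_trans _ _ ((weak_constant / l)%:E * (l * vol (qcenter k) (qradius k))%:E)%E).
    rewrite -EFinM lee_fin mulrA divfK ?gt_eqF//; exact: triple_vol.
  apply: lee_wpmul2l; first by rewrite lee_fin.
  by rewrite EFinM ltW.
apply: (@le_trans _ _ (\sum_(k <- D) ((weak_constant / l)%:E * \int[mu]_(y in qball k) G y))%E).
  by rewrite big_seq [leRHS]big_seq; apply: lee_sum.
rewrite -ge0_sume_distrr; last by move=> k _; exact: integral_ge0.
apply: lee_wpmul2l; first by rewrite lee_fin.
rewrite -ge0_integral_bigsetU//.
- apply: ge0_subset_integral => //.
  by apply: bigsetU_measurable => k _; exact: measurable_qball.
- by move=> k; exact: measurable_qball.
- exact: measurable_funS mG.
Qed.

(** By continuity from below along the first N balls. *)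
Lemma weak_type (G : E -> \bar R) (l : R) : 0 < l ->
  (forall x, 0 <= G x)%E -> measurable_fun setT G ->
  (mu [set x | (l%:E < qmax G x)%E] <= (weak_constant / l)%:E * \int[mu]_x G x)%E.
Proof.
move=> l0 G0 mG.
pose s N := [seq k <- iota 0 N | (l%:E < avg G k)%E].
pose U N := \bigcup_(k in [set` s N]) qball k.
have mU N : measurable (U N).
  by apply: bigcup_measurable => k _; exact: measurable_qball.
have -> : [set x | (l%:E < qmax G x)%E] = \bigcup_N U N.
  rewrite qmax_levelE; apply/seteqP; split => x.
    move=> [k /= lk kx]; exists k.+1 => //; exists k => //=.
    by rewrite mem_filter lk mem_iota/=.
  move=> [N _ [k /=]]; rewrite mem_filter => /andP[lk _] kx; by exists k.
have cvgU : (mu \o U) N @[N --> \oo] --> mu (\bigcup_N U N).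
  apply: nondecreasing_cvg_mu => //; first exact: bigcup_measurable.
  move=> N M NM; apply/subsetPset => x [k /=]; rewrite mem_filter mem_iota.
  move=> /andP[lk kN] kx; exists k => //=; rewrite mem_filter lk mem_iota/=.
  by rewrite add0n in kN *; exact: leq_trans NM.
rewrite -(cvg_lim _ cvgU)//; apply: lime_le; first by apply/cvg_ex; eexists; exact: cvgU.
apply: nearW => N; apply: weak_type_finite => // k.
by rewrite mem_filter => /andP[].
Qed.

(** The part of G that does not exceed l / 2 contributes at most l / 2 to an
    average, so the weak type estimate applies to the other part. *)
Lemma weak_type_half (G : E -> R) (l : R) : 0 < l ->
  (forall x, 0 <= G x) -> measurable_fun setT G ->
  (mu [set x | (l%:E < qmax (EFin \o G) x)%E] <=
   (2 * weak_constant / l)%:E * \int[mu]_x (G x * (l < 2 * G x)%R%:R)%:E)%E.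
Proof.
move=> l0 G0 mG.
pose G1 x := G x * (l < 2 * G x)%R%:R.
have mG1 : measurable_fun setT G1 by exact: measurable_truncation.
have G10 x : 0 <= G1 x by rewrite mulr_ge0.
have -> : 2 * weak_constant / l = weak_constant / (l / 2).
  by field; rewrite gt_eqF.
have w := @weak_type (EFin \o G1) (l / 2) (divr_gt0 l0 (ltr0n R 2)).
apply: (le_trans _ (w _ _)); last 2 first.
- by move=> x; rewrite lee_fin.
- exact/measurable_EFinP.
apply: le_measure; rewrite ?inE; [exact: measurable_qmax_level..|].
rewrite !qmax_levelE => x [k /= lk kx]; exists k => //=.
have v0 := qvol_gt0 k.
move: lk; rewrite !avgE => lk.
rewrite muleC lte_pdivlMr//.
have : (l%:E * (vol (qcenter k) (qradius k))%:E < \int[mu]_(y in qball k) (EFin \o G) y)%E.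
  by rewrite -lte_pdivlMr// muleC.
have intle : (\int[mu]_(y in qball k) (EFin \o G) y <=
    \int[mu]_(y in qball k) (G1 y)%:E + (l / 2 * vol (qcenter k) (qradius k))%:E)%E.
  rewrite EFinM -qvolE; apply: integral_le_truncation => //.
  - exact: measurable_qball.
  - exact: ltW.
move=> /lt_le_trans/(_ intle); rewrite -lteBlDr//.
apply: le_lt_trans; rewrite -EFinM -EFinB lee_fin le_eqVlt; apply/orP/or_introl/eqP.
by field.
Qed.

Definition strong_constant (p : R) : R :=
  marcinkiewicz_constant (2 * weak_constant) p.

Lemma strong_type (G : E -> R) (p : R) : 1 < p ->
  (forall x, 0 <= G x) -> measurable_fun setT G ->
  (\int[mu]_x (qmax (EFin \o G) x `^ p) <=
   (strong_constant p)%:E * \int[mu]_x (G x `^ p)%:E)%E.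
Proof.
move=> p1 G0 mG; apply: marcinkiewicz => //.
- by rewrite mulr_ge0// ltW// weak_constant_gt0.
- by move=> x; apply: qmax_ge0 => y; rewrite lee_fin.
- by move=> l; exact: measurable_qmax_level.
- by move=> l l0; exact: weak_type_half.
Qed.

Definition maximal_constant : R := 4 ^+ n / @ballc R n.

Lemma maximal_constant_gt0 : 0 < maximal_constant.
Proof. by apply: divr_gt0; [rewrite exprn_gt0|exact: ballc_gt0]. Qed.

(** Every ball lies in one with rational data and less than twice the radius. *)
Lemma maximal_le_qmax (f : E -> \bar R) x : measurable_fun setT f ->
  (HL_maximal_Rn f x <= maximal_constant%:E * qmax (fun y => `|f y|) x)%E.
Proof.
move=> mf; apply: ge_ereal_sup => _ [_ [[c [r [r0 ->]]] cx] <-].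
have [k [ck kr]] := qball_cover c r0.
have v0 := vol_gt0 n0 c r0.
rewrite -/(eball c r) volE// inver gt_eqF//.
have intle : (\int[mu]_(y in eball c r) `|f y| <= \int[mu]_(y in qball k) `|f y|)%E.
  apply: ge0_subset_integral; [exact: measurable_eball|exact: measurable_qball| | |].
  - by apply: measurable_funTS; exact: measurableT_comp.
  - by move=> y _; exact: abse_ge0.
  - exact: ck.
apply: (@le_trans _ _ (maximal_constant%:E * avg (fun y => `|f y|) k)%E); last first.
  apply: lee_wpmul2l; first by rewrite lee_fin (ltW maximal_constant_gt0).
  by apply: ereal_sup_ubound; exists k => //; exact: ck.
rewrite avgE muleA -EFinM; apply: lee_pmul => //.
- by rewrite lee_fin invr_ge0 ltW.
- exact: integral_ge0.
rewrite lee_fin ler_pdivlMr ?qvol_gt0// ler_pdivrMl//.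
rewrite (le_trans (vol_le _ (qradius_gt0 k)))//.
apply: (@le_trans _ _ ((4 * r) ^+ n)).
  by rewrite ler_pXn2r ?nnegrE ?mulr_ge0 ?ltW ?qradius_gt0//; lra.
rewrite exprMn /maximal_constant mulrA ler_pdivlMr ?ballc_gt0//.
by rewrite -mulrA mulrC ler_wpM2r ?exprn_ge0// mulrC vol_ge.
Qed.

End maximal_function.

(** * Weak Phi-functions *)

Section dilation.
Context {R : realType}.
Implicit Types (g : R -> \bar R) (p a k t s : R).

Lemma powRV t p : 0 <= t -> t^-1 `^ p = (t `^ p)^-1.
Proof. by move=> t0; rewrite -[t^-1]powR_inv1// -powRrM mulN1r powRN. Qed.

(** The form in which the growth conditions (aInc) and, for p = 1, the
    almost monotonicity of g(t) / t enter the estimates. *)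
Definition dilates p a g := forall k t, 1 <= k -> 0 < t ->
  ((k `^ p)%:E * g t <= a%:E * g (k * t)%R)%E.

Lemma dilatesP p a g : 1 <= a -> (forall t, 0 < t -> (0 <= g t)%E) ->
  (forall t s, 0 < t -> t < s ->
     (g t * (t `^ p)^-1%:E <= a%:E * (g s * (s `^ p)^-1%:E))%E) <->
  dilates p a g.
Proof.
move=> a1 g0; split=> H.
  move=> k t; rewrite le_eqVlt => /predU1P[<-|k1] t0.
    by rewrite powR1 mul1r; apply: lee_wpmul2r; rewrite ?lee_fin ?g0.
  have k0 : 0 < k := lt_trans ltr01 k1.
  have ktp : 0 < (k * t) `^ p by rewrite powR_gt0// mulr_gt0.
  have tp : 0 < t `^ p by rewrite powR_gt0.
  have tkt : t < k * t by rewrite ltr_pMl.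
  have ktp0 : (0 <= ((k * t) `^ p)%:E)%E by rewrite lee_fin ltW.
  have := lee_wpmul2l ktp0 (H _ _ t0 tkt).
  rewrite muleCA -EFinM [X in (_ * X%:E)%E](_ : _ = k `^ p); last first.
    by rewrite powRM ?(ltW k0) ?(ltW t0)// mulfK// gt_eqF.
  rewrite muleC => /le_trans; apply.
  by rewrite muleCA (muleCA ((k * t) `^ p)%:E) -EFinM divff ?gt_eqF// mule1.
move=> t s t0 ts; have s0 := lt_trans t0 ts.
have sp : 0 < s `^ p by rewrite powR_gt0.
have tp : 0 < t `^ p by rewrite powR_gt0.
have k1 : 1 <= s / t by rewrite ler_pdivlMr// mul1r ltW.
have := H _ _ k1 t0; rewrite divfK ?gt_eqF// => /(lee_wpmul2l (x := (s `^ p)^-1%:E)).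
rewrite lee_fin invr_ge0 (ltW sp) => /(_ isT).
have -> : (s / t) `^ p = s `^ p / t `^ p.
  by rewrite powRM ?invr_ge0 ?(ltW s0) ?(ltW t0)// powRV ?(ltW t0).
rewrite muleA -EFinM mulrA mulVf ?gt_eqF// mul1r muleC => /le_trans; apply.
by rewrite muleCA (muleC (g s)).
Qed.

Lemma dilates_contract p a g c t : dilates p a g -> 0 < c <= 1 -> 0 < t ->
  (g (c * t)%R <= (a * c `^ p)%:E * g t)%E.
Proof.
move=> H /andP[c0 c1] t0.
have k1 : 1 <= c^-1 by rewrite invf_ge1.
have cp : 0 < c `^ p by rewrite powR_gt0.
have := H _ _ k1 (mulr_gt0 c0 t0); rewrite mulKf ?gt_eqF// => /(lee_wpmul2l (x := (c `^ p)%:E)).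
rewrite lee_fin (ltW cp) => /(_ isT).
have -> : c^-1 `^ p = (c `^ p)^-1 by rewrite powRV ?(ltW c0).
by rewrite muleA -EFinM mulfV ?gt_eqF// mul1e muleA -EFinM (mulrC a).
Qed.

Lemma dilates_le p q a g : q <= p -> (forall t, 0 < t -> (0 <= g t)%E) ->
  dilates p a g -> dilates q a g.
Proof.
move=> qp g0 H k t k1 t0; apply: le_trans (H _ _ k1 t0).
by apply: lee_wpmul2r; [exact: g0|rewrite lee_fin ler_powR].
Qed.

End dilation.

Section weak_Phi.
Context {R : realType} {n : nat} (n0 : (0 < n)%N).
Local Notation E := (Rn R n).
Local Notation mu := (@lebesgue_Rn R n).
Implicit Types (phi psi : E -> R -> \bar R).

Lemma ae_exE (P : E -> Prop) : {ae mu, forall x, P x} <->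
  exists N : set E, [/\ measurable N, mu N = 0%E & forall x, ~ N x -> P x].
Proof.
split=> [[N [mN N0 PN]]|[N [mN N0 PN]]]; exists N; split=> // x.
  by apply: contra_notP => Px; exact: PN.
by move=> /=; apply: contra_notP; exact: PN.
Qed.

Section one_function.
Variables (phi : E -> R -> \bar R) (phiP : weak_Phi phi).

Lemma Phi_ge0 x (t : R) : 0 <= t -> (0 <= phi x t)%E.
Proof. by case: phiP => H _ _ _ _; exact: H. Qed.

Lemma Phi_le x (s t : R) : 0 <= s -> s <= t -> (phi x s <= phi x t)%E.
Proof. by case: phiP => _ _ H _ _; exact: H. Qed.

Lemma Phi_0 x : phi x 0 = 0%E.
Proof. by case: phiP => _ _ _ /(_ x)[]. Qed.

Lemma Phi_cvg0 x (e : R) : 0 < e -> exists2 t : R, 0 < t & (phi x t < e%:E)%E.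
Proof.
case: phiP => _ _ _ /(_ x)[_ + _] _ e0 => cvg0.
have phie : \forall t \near 0^'+, (phi x t < e%:E)%E.
  by apply: (cvg0 [set u | (u < e%:E)%E]); apply: open_ereal_lt'; rewrite lte_fin.
have phie0 : \forall t \near (0 : R)^'+, (phi x t < e%:E)%E /\ 0 < t.
  by apply: filterI => //; exact: nbhs_right_gt.
have [t [te t0]] := @filter_ex _ _ (at_right_proper_filter (0 : R)) _ phie0.
by exists t.
Qed.

Lemma Phi_cvgoo x (M : R) : exists2 t : R, 0 < t & (M%:E <= phi x t)%E.
Proof.
case: phiP => _ _ _ /(_ x)[_ _ +] _ => /cvgeyPge/(_ M) [t [_ tM]].
exists (Num.max 1 (t + 1)); first by rewrite lt_max ltr01.
by apply: tM; rewrite lt_max ltrDl ltr01 orbT.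
Qed.

Lemma Phi_dilates : exists2 L : R, 1 <= L & forall x, dilates 1 L (phi x).
Proof.
case: (phiP) => _ _ _ _ [L L1 H]; exists L => // x.
apply/dilatesP => // [t t0|t s t0 ts]; first by apply: Phi_ge0; exact: ltW.
have s0 := lt_trans t0 ts.
by have := H x _ _ t0 ts; rewrite !powRr1 ?(ltW t0) ?(ltW s0).
Qed.

Lemma measurable_Phi (f : E -> R) : measurable_fun setT f ->
  measurable_fun setT (fun x => phi x `|f x|).
Proof. by case: phiP => _ + _ _ _; apply. Qed.

Lemma ginv_le x (t tau : R) : 0 <= t -> (tau%:E <= phi x t)%E -> ginv phi x tau <= t.
Proof. by move=> t0 h; apply: ge_inf => //; exists 0 => ? []. Qed.

Lemma ginv_lt x (t tau : R) : ginv phi x tau < t -> (tau%:E <= phi x t)%E.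
Proof.
have [u u0 uM] := Phi_cvgoo x tau.
move=> /inf_lt[|s [s0 sM] st]; first by exists u; split => //; exact: ltW.
by apply: (le_trans sM); apply: Phi_le => //; exact: ltW.
Qed.

End one_function.

(** The inverse at 1 only tells where phi(x, .) passes the value 1. *)
Lemma A0P phi : weak_Phi phi -> A0 phi -> exists b : R, 0 < b <= 1 /\
  {ae mu, forall x, (forall t : R, 0 <= t -> t < b -> (phi x t < 1)%E) /\
                    (forall t : R, b^-1 < t -> (1 <= phi x t)%E)}.
Proof.
move=> phiP [b [b0 b1 /ae_exE[N [mN N0 H]]]]; exists b; rewrite b0 b1; split => //.
apply/ae_exE; exists N; split => // x /H/andP[bx xb]; split=> t.
  move=> t0 tb; rewrite ltNge; apply/negP => /(ginv_le t0).
  by rewrite leNgt (lt_le_trans tb).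
by move=> bt; apply: ginv_lt => //; exact: le_lt_trans bt.
Qed.

(** In terms of the values of phi rather than of its inverse, and with one null
    set for all the balls: it suffices to unite those of the balls with rational
    data. This costs the factor 4, as such a ball around x and y is larger. *)
Lemma A1P phi : weak_Phi phi -> A1 phi -> exists b : R, 0 < b < 1 /\
  exists N : set E, [/\ measurable N, mu N = 0%E & forall x y : E, ~ N x -> ~ N y ->
    forall r tau s t : R, eucl_dist x y < r -> 1 <= tau -> tau * (4 * r) ^+ n <= 1 ->
    0 <= s -> s < b * t -> (tau%:E <= phi x s)%E -> (tau%:E <= phi y t)%E].
Proof.
move=> phiP [b [b0 b1 H]]; exists b; rewrite b0 b1; split => //.
have HN k : exists Nk : set E, [/\ measurable Nk, mu Nk = 0%E &
    (mu (qball k) <= 1)%E -> forall x y, (qball k `\` Nk) x -> (qball k `\` Nk) y ->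
      forall t : R, 1 <= t -> (t%:E <= (mu (qball k))^-1)%E ->
        b * ginv phi x t <= ginv phi y t].
  have [k1|k1] := boolP (mu (qball k) <= 1)%E; last by exists set0; split.
  have [N [M [mM M0 NM]] HN] := H _ (euclidean_ball_eball (@qcenter R n k) (@qradius_gt0 R n k)) k1.
  exists M; split => // _ x y [kx Mx] [ky My]; apply: HN; split => //.
    by move=> /NM.
  by move=> /NM.
have [N HN'] := choice HN.
have mNk : measurable (\bigcup_k N k).
  by apply: bigcup_measurable => k _; have [] := HN' k.
exists (\bigcup_k N k); split => //.
- apply/(negligibleP mu mNk)/negligible_bigcup => k.
  by have [mk k0 _] := HN' k; exact/(negligibleP mu mk).
- move=> x y Nx Ny r tau s t xyr tau1 taur s0 sbt taux.
  have r0 : 0 < r by apply: le_lt_trans xyr; exact: eucl_dist_ge0.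
  have [k [xk kr]] := qball_cover n0 x r0.
  have kx : qball k x by apply: xk; exact: eball_center.
  have ky : qball k y by exact: xk.
  have r4 : 0 < (4 * r) ^+ n by rewrite exprn_gt0// mulr_gt0.
  have vk : vol (@qcenter R n k) (@qradius R n k) <= (4 * r) ^+ n.
    rewrite (le_trans (vol_le (@qcenter R n k) (@qradius_gt0 R n k)))//.
    by rewrite ler_pXn2r// ?nnegrE; have := @qradius_gt0 R n k; lra.
  have v0 := qvol_gt0 n0 k.
  have [_ _ HNk] := HN' k.
  rewrite qvolE in HNk.
  have k1 : ((vol (@qcenter R n k) (@qradius R n k))%:E <= 1)%E.
    rewrite lee_fin (le_trans vk)// (le_trans _ taur)// ler_peMl// ltW//.
  have tauv : (tau%:E <= ((vol (@qcenter R n k) (@qradius R n k))%:E)^-1)%E.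
    rewrite inver gt_eqF; last exact: v0.
    rewrite lee_fin -[leRHS]mul1r ler_pdivlMr; last exact: v0.
    by rewrite (le_trans _ taur)// ler_wpM2l// (le_trans ler01).
  apply: (ginv_lt phiP).
  have : b * ginv phi y tau <= ginv phi x tau.
    apply: (HNk k1) => //; split => // Nk.
      by apply: Ny; exists k.
    by apply: Nx; exists k.
  have := ginv_le s0 taux; move=> gs.
  by move=> /le_trans/(_ gs)/le_lt_trans/(_ sbt); rewrite ltr_pM2l.
Qed.

(** The error term is made nonnegative, and the second inequality is freed from
    its range condition: beyond that range its left-hand side is small anyway. *)
Lemma A2P phi : weak_Phi phi -> A2 phi ->
  exists (phioo : R -> \bar R) (h : E -> R) (b s : R),
  [/\ weak_Phi (fun _ : E => phioo),
      [/\ h \in Lfun mu 1, measurable_fun setT h, forall x, 0 <= h x &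
         (\int[mu]_x (h x)%:E < +oo)%E],
      0 < b <= 1, 0 < s &
      {ae mu, forall x, forall t : R, 0 <= t ->
        ((phioo t <= s%:E)%E -> (phi x (b * t)%R <= phioo t + (h x)%:E)%E) /\
        ((phioo (b * t)%R <= s%:E)%E ->
           (phioo (b * t)%R <= phi x t + (h x)%:E)%E)}].
Proof.
move=> phiP [phioo [h [b [s [phiooP [h1 _] bP s0 /ae_exE[N [mN N0 H]]]]]]].
have h1' : Num.norm \o h \in Lfun mu 1 by exact: Lfun_norm.
have /Lfun1_integrable/integrableP[mh intb] := h1'.
exists phioo, (Num.norm \o h), b, s; split; [exact: phiooP| |exact: bP|exact: s0|].
- split; [exact: h1'|exact/measurable_EFinP|by move=> x; exact: normr_ge0|].
  apply: le_lt_trans intb; apply: ge0_le_integralT => x.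
    by rewrite lee_fin; exact: normr_ge0.
  by rewrite /= lee_fin normr_id.
- apply/ae_exE; exists N; split; [exact: mN|exact: N0|move=> x /H{}H t t0]; have [H1 H2] := H t t0.
  have hx : ((h x)%:E <= `|h x|%:E)%E by rewrite lee_fin ler_norm.
  split=> ts.
    by apply: le_trans (H1 ts) _; exact: leeD2l.
  have [phis|phis] := leP (phi x t) s%:E.
    by apply: le_trans (H2 phis) _; exact: leeD2l.
  apply: (le_trans ts); apply: (le_trans (ltW phis)).
  by apply: leeDl; rewrite lee_fin; exact: normr_ge0.
Qed.

End weak_Phi.

(** * From (aInc) to the boundedness of the maximal operator *)

Section average.
Context d (T : measurableType d) (R : realType) (mu : {measure set T -> \bar R}).

(** Half of an average comes from the points where the function exceeds half
    the average. A growth condition can be applied at these points, so this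
    plays the role of Jensen's inequality. *)
Lemma half_average (B : set T) (f : T -> R) (G : T -> \bar R) (a v kappa : R) :
  measurable B -> mu B = v%:E -> measurable_fun setT f -> (forall y, 0 <= f y) ->
  measurable_fun setT G -> (forall y, 0 <= G y)%E -> 0 <= a -> 0 <= kappa ->
  ((a * v)%:E <= \int[mu]_(y in B) (f y)%:E)%E ->
  {ae mu, forall y, B y -> a < 2 * f y -> ((kappa * f y)%:E <= G y)%E} ->
  ((kappa * (a / 2) * v)%:E <= \int[mu]_(y in B) G y)%E.
Proof.
move=> mB muB mf f0 mG G0 a0 k0 af fG.
pose f1 y := f y * (a < 2 * f y)%R%:R.
have mf1 : measurable_fun setT f1 by exact: measurable_truncation.
have mf1B : measurable_fun B (fun x => (f1 x)%:E).
  by apply/measurable_EFinP; exact: measurable_funTS.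
have f10 y : 0 <= f1 y by rewrite mulr_ge0.
have half : ((a / 2 * v)%:E <= \int[mu]_(y in B) (f1 y)%:E)%E.
  have := le_trans af (integral_le_truncation mu mB mf a0 f0).
  rewrite muB -EFinM -leeBlDr// -EFinB; apply: le_trans.
  by rewrite lee_fin le_eqVlt; apply/orP/or_introl/eqP; field.
apply: (@le_trans _ _ (\int[mu]_(y in B) (kappa%:E * (f1 y)%:E))%E).
  rewrite ge0_integralZl_EFin//; last by move=> y _; rewrite lee_fin.
  by rewrite -mulrA EFinM; apply: lee_wpmul2l; rewrite ?lee_fin.
apply: ae_ge0_le_integral => //.
- by move=> y _; rewrite -EFinM lee_fin mulr_ge0.
- by apply: measurable_funeM.
- exact: measurable_funTS.
- move: fG => [M [mM M0 HM]]; exists M; split => // y /=; apply: contra_notP => My.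
  have {}HM : B y -> a < 2 * f y -> ((kappa * f y)%:E <= G y)%E.
    by apply: contrapT => H; apply: My; apply: HM.
  move=> By; rewrite /f1 -EFinM; case: ltP => [af2|_].
    by rewrite mulr1 HM.
  by rewrite mulr0 mulr0.
Qed.

(** Otherwise h would be at least e on a set of infinite measure. *)
Lemma exists_small (N : set T) (h : T -> R) (e : R) :
  measurable N -> mu N = 0%E -> mu setT = +oo%E ->
  measurable_fun setT h -> (forall x, 0 <= h x) ->
  (\int[mu]_x (h x)%:E < +oo)%E -> 0 < e -> exists x, ~ N x /\ h x < e.
Proof.
move=> mN N0 muT mh h0 ih e0; apply: contrapT => H.
have Hx x : ~ N x -> e <= h x.
  by move=> Nx; rewrite leNgt; apply/negP => hx; apply: H; exists x.
suff : (+oo <= \int[mu]_x (h x)%:E)%E by rewrite leNgt ih.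
apply: (@le_trans _ _ (\int[mu]_x (e%:E))%E).
  by rewrite integral_cst// muT gt0_muley// lte_fin.
apply: ae_ge0_le_integral => //.
- by move=> x _; rewrite lee_fin ltW.
- by move=> x _; rewrite lee_fin.
- exact/measurable_EFinP.
- exists N; split => // x /=; apply: contra_notP => Nx _.
  by rewrite lee_fin Hx.
Qed.

Lemma measurable_scaled_fine (f : T -> \bar R) (l : R) : measurable_fun setT f ->
  measurable_fun setT (fun x => l * `|fine (f x)|).
Proof.
move=> mf; apply: measurable_funM => //; apply: measurableT_comp => //.
exact: (measurableT_comp (fine_measurable measurableT) mf).
Qed.

End average.

(* The standing assumptions collect what (A0), (A1), (A2) and (aInc) say outside a
   null set N, where t0 marks the range on which phioo is under control. *)
Section pointwise.
Context {R : realType} {n : nat} (n0 : (0 < n)%N).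
Local Notation E := (Rn R n).
Local Notation mu := (@lebesgue_Rn R n).
Local Notation qr := (@qradius R n).
Local Notation qc := (@qcenter R n).
Local Notation qvol k := (vol (qc k) (qr k)).

Lemma dilates_ratio (p a : R) (g : R -> \bar R) (u w : R) : dilates p a g -> 0 < u -> u <= w ->
  (((w / u) `^ p)%:E * g u <= a%:E * g w)%E.
Proof.
move=> dg u0 uw; have := dg (w / u) u _ u0; rewrite divfK ?gt_eqF//; apply.
by rewrite ler_pdivlMr// mul1r.
Qed.

Variables (psi : E -> R -> \bar R) (phioo : R -> \bar R) (h : E -> R) (N : set E).
Variables (p D T b1 b2 s t0 : R).
Hypotheses (psiP : weak_Phi psi) (phiooP : weak_Phi (fun _ : E => phioo)).
Hypotheses (mN : measurable N) (N0 : mu N = 0%E).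
Hypotheses (p1 : 1 < p) (D1 : 1 <= D) (T0 : 0 < T) (b10 : 0 < b1).
Hypotheses (b20 : 0 < b2) (b21 : b2 <= 1) (t00 : 0 < t0).
Hypotheses (mh : measurable_fun setT h) (h0 : forall x, 0 <= h x).
Hypothesis ih : (\int[mu]_x (h x)%:E < +oo)%E.
Hypothesis dilpsi : forall x, ~ N x -> dilates p D (psi x).
Hypothesis psiT : forall x, ~ N x -> (1 <= psi x T)%E.
Hypothesis psiA1 : forall x y : E, ~ N x -> ~ N y ->
  forall r tau s t : R, eucl_dist x y < r -> 1 <= tau -> tau * (4 * r) ^+ n <= 1 ->
  0 <= s -> s < b1 * t -> (tau%:E <= psi x s)%E -> (tau%:E <= psi y t)%E.
Hypothesis psiA2a : forall x, ~ N x -> forall t : R, 0 <= t ->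
  (phioo t <= s%:E)%E -> (psi x (b2 * t)%R <= phioo t + (h x)%:E)%E.
Hypothesis psiA2b : forall x, ~ N x -> forall t : R, 0 <= t ->
  (phioo (b2 * t)%R <= s%:E)%E -> (phioo (b2 * t)%R <= psi x t + (h x)%:E)%E.
Hypothesis phioot0 : (phioo (t0 / b2) <= s%:E)%E.

Let D0 : 0 < D. Proof. exact: lt_le_trans ltr01 D1. Qed.
Let p0 : 0 < p. Proof. exact: lt_trans ltr01 p1. Qed.

Let phioo_ge0 t : 0 <= t -> (0 <= phioo t)%E.
Proof. by move=> t_ge0; exact: (@Phi_ge0 _ _ _ phiooP point). Qed.

Let phioo_le u t : 0 <= u -> u <= t -> (phioo u <= phioo t)%E.
Proof. by move=> u_ge0 ut; exact: (@Phi_le _ _ _ phiooP point). Qed.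

(** The growth of psi near zero passes to its limit function: far away the
    error h is arbitrarily small somewhere, because the whole space has infinite
    measure. *)
Lemma phioo_growth t u : 0 < t -> t <= u -> u <= t0 ->
  (phioo (b2 * t)%R <= (D * (t / u) `^ p)%:E * phioo (u / b2)%R)%E.
Proof.
move=> tgt0 tu ut0; have u0 : 0 < u := lt_le_trans tgt0 tu.
have ub2 : 0 < u / b2 by rewrite divr_gt0.
have phu : (phioo (u / b2)%R <= s%:E)%E.
  by apply: le_trans phioot0; apply: phioo_le; rewrite ?(ltW ub2)// ler_pM2r ?invr_gt0.
have phuf : phioo (u / b2) \is a fin_num.
  by rewrite ge0_fin_numE ?(le_lt_trans phu) ?ltry// phioo_ge0// ltW.
have pht : (phioo (b2 * t)%R <= phioo (u / b2)%R)%E.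
  apply: phioo_le; first by rewrite mulr_ge0 ?ltW.
  by rewrite mulrC ler_pdivlMr// -mulrA (le_trans _ tu)// ler_piMr ?(ltW tgt0)// mulr_ile1// ltW.
set q := D * (t / u) `^ p; have q0 : 0 <= q by rewrite mulr_ge0 ?(ltW D0)// powR_ge0.
apply/lee_addgt0Pr => e e0.
pose e' := e / (q + 1).
have q1 : 0 < q + 1 by rewrite ltr_wpDl.
have e'0 : 0 < e' by rewrite divr_gt0.
have [x [Nx hx]] := exists_small mN N0 (lebesgue_Rn_setT n0) mh h0 ih e'0.
apply: le_trans (psiA2b Nx (ltW tgt0) (le_trans pht phu)) _.
have -> : e = q * e' + e' by rewrite -{2}(mul1r e') -mulrDl /e' mulrC divfK// gt_eqF.
rewrite EFinD addeA; apply: leeD; last by rewrite lee_fin ltW.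
have tu1 : 0 < t / u <= 1 by rewrite divr_gt0//= ler_pdivrMr// mul1r.
have := dilates_contract (dilpsi Nx) tu1 u0; rewrite divfK ?gt_eqF// => /le_trans; apply.
rewrite -/q (EFinM q e') -ge0_muleDr; last 2 first.
- by apply: phioo_ge0; exact: ltW.
- by rewrite lee_fin ltW.
apply: lee_wpmul2l; first by rewrite lee_fin.
have := psiA2a Nx (ltW ub2) phu; rewrite mulrC divfK ?gt_eqF// => /le_trans; apply.
by apply: leeD2l; rewrite lee_fin ltW.
Qed.


(** Constants of the pointwise estimate. Two points of a ball of radius r are at
    distance less than 2 r, so (A1) compares values up to 1 / (8 r)^n, and
    scale_vol is a lower bound for the volume divided by (8 r)^n. With scale_A1 a
    density exceeding that threshold would have integral at least 2 over the ball.
    Beyond pointwise_large the averages are at most avg_bound, and scale_A2 shrinks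
    the values of f up to T and the averages up to avg_bound into the range
    below t0. *)
Definition scale_vol : R := @ballc R n / 8 ^+ n.
Definition scale_A1 : R := Num.min 2^-1 (scale_vol / (4 * D)).
Definition large_scale : R := b1 * scale_A1 / 2.
Definition avg_bound : R := Num.max (T + T * D / scale_vol) (T / large_scale).
Definition scale_A2 : R := Num.min b2 (t0 / (b2 * (T + avg_bound))).
Definition small_scale : R := b2 ^+ 2 * scale_A2 / 2.
Definition pw_scale : R := Num.min large_scale (b2 * small_scale).
Definition pw_const : R := Num.max D (D ^+ 2 * s).

Let v0 : 0 < scale_vol.
Proof. by apply: divr_gt0; [exact: ballc_gt0|rewrite exprn_gt0]. Qed.

Let e0 : 0 < scale_A1.
Proof. by rewrite lt_min invr_gt0 ltr0n/= divr_gt0// mulr_gt0. Qed.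

Let c10 : 0 < large_scale.
Proof. by rewrite divr_gt0// mulr_gt0. Qed.

Let A0' : 0 < avg_bound.
Proof. by rewrite lt_max (divr_gt0 T0 c10) orbT. Qed.

Let eta0 : 0 < scale_A2.
Proof. by rewrite lt_min b20 divr_gt0// mulr_gt0// addr_gt0. Qed.

Let c20 : 0 < small_scale.
Proof. by rewrite divr_gt0// mulr_gt0// exprn_gt0. Qed.

Lemma pw_scale_gt0 : 0 < pw_scale.
Proof. by rewrite lt_min c10 mulr_gt0. Qed.

Lemma pw_const_ge1 : 1 <= pw_const.
Proof. by rewrite le_max D1. Qed.

Section one_function.
Variables (f : E -> R).
Hypotheses (mf : measurable_fun setT f) (f0 : forall y, 0 <= f y).
Hypothesis intf : (\int[mu]_y psi y (f y) <= 1)%E.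

(** The error term of (A2) is included in the density, whose p-th root then
    dominates f also where psi itself may vanish. *)
Definition dens (y : E) : \bar R := (psi y (f y) + (h y)%:E)%E.
Definition rdens (y : E) : R := fine (dens y) `^ p^-1.

Lemma measurable_psif : measurable_fun setT (fun y => psi y (f y)).
Proof.
have := measurable_Phi psiP mf; congr (measurable_fun _ _).
by apply/funext => y; rewrite ger0_norm.
Qed.

Lemma measurable_dens : measurable_fun setT dens.
Proof.
by apply: emeasurable_funD; [exact: measurable_psif|exact/measurable_EFinP].
Qed.

Lemma dens_ge0 y : (0 <= dens y)%E.
Proof. by apply: adde_ge0; [exact: Phi_ge0|rewrite lee_fin]. Qed.

Lemma psif_le_dens y : (psi y (f y) <= dens y)%E.
Proof. by apply: leeDl; rewrite lee_fin. Qed.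

Lemma int_dens : (\int[mu]_y dens y <= 1 + \int[mu]_y (h y)%:E)%E.
Proof.
rewrite ge0_integralD; last 5 first.
- by [].
- by move=> y _; exact: Phi_ge0.
- exact: measurable_psif.
- by move=> y _; rewrite lee_fin.
- exact/measurable_EFinP.
exact: leeD2r.
Qed.

Lemma dens_fin : {ae mu, forall y, dens y \is a fin_num}.
Proof.
have : mu.-integrable setT dens.
  apply/integrableP; split; first exact: measurable_dens.
  under eq_integral do rewrite gee0_abs ?dens_ge0//.
  by apply: le_lt_trans int_dens _; rewrite lte_add_pinfty// ltry.
by move=> /(integrable_ae measurableT); apply: filterS => y; exact.
Qed.

Lemma measurable_rdens : measurable_fun setT rdens.
Proof.
apply: (measurableT_comp (measurable_powR p^-1)).
exact: (measurableT_comp (fine_measurable measurableT) measurable_dens).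
Qed.

Lemma rdens_ge0 y : 0 <= rdens y.
Proof. exact: powR_ge0. Qed.

Lemma rdens_powR y : (rdens y `^ p)%:E = (fine (dens y))%:E.
Proof.
by rewrite -powRrM mulVf ?gt_eqF// powRr1// fine_ge0// dens_ge0.
Qed.

Lemma rdens_ge y (q : R) : dens y \is a fin_num -> 0 <= q ->
  ((q `^ p)%:E <= dens y)%E -> q <= rdens y.
Proof.
move=> yfin q0; rewrite -{1}(fineK yfin) lee_fin => qy.
have -> : q = (q `^ p) `^ p^-1 by rewrite -powRrM mulfV ?gt_eqF// powRr1.
by apply: le_powR => //; rewrite ?invr_ge0 ?(ltW p0)// powR_ge0.
Qed.

Let fE : E -> \bar R := EFin \o f.
Let gE : E -> \bar R := EFin \o rdens.

(** Beyond T the function f is dominated by its density. *)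
Lemma avg_le k : (avg fE k <= (T + T * D / qvol k)%:E)%E.
Proof.
have vk : 0 < qvol k := qvol_gt0 n0 k.
have int1 : (\int[mu]_(y in qball k) psi y (f y) <= 1)%E.
  apply: le_trans intf; apply: ge0_subset_integral.
  - exact: measurable_qball.
  - by [].
  - exact: measurable_psif.
  - by move=> y _; exact: Phi_ge0.
  - by [].
have : (\int[mu]_(y in qball k) (f y)%:E <= (T * qvol k + T * D)%:E)%E.
  apply: (@le_trans _ _ (\int[mu]_(y in qball k) (T%:E + (T * D)%:E * psi y (f y)))%E).
    apply: ae_ge0_le_integral.
    - exact: measurable_qball.
    - by move=> y _; rewrite lee_fin.
    - by apply/measurable_EFinP; exact: measurable_funTS.
    - move=> y _; apply: adde_ge0; first by rewrite lee_fin ltW.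
      by apply: mule_ge0; [rewrite lee_fin mulr_ge0 ?ltW|exact: Phi_ge0].
    - apply: measurable_funTS; apply: emeasurable_funD; first exact: measurable_cst.
      by apply: measurable_funeM; exact: measurable_psif.
    - apply/ae_exE; exists N; split=> // y Ny _.
      have [fT|/ltW Tf] := leP (f y) T.
        apply: le_trans (_ : T%:E <= _)%E; first by rewrite lee_fin.
        apply: leeDl; apply: mule_ge0; [by rewrite lee_fin mulr_ge0 ?ltW|exact: Phi_ge0].
      apply: (@le_trans _ _ ((T * D)%:E * psi y (f y))%E); last first.
        by apply: leeDr; rewrite lee_fin ltW.
      have := dilates_ratio (dilpsi Ny) T0 Tf => H.
      have T0' : (0 <= T%:E)%E by rewrite lee_fin ltW.
      have := lee_wpmul2l T0' H; rewrite [leRHS]muleA -EFinM; apply: le_trans.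
      rewrite muleA -EFinM -[leLHS]mule1; apply: lee_pmul.
      + by rewrite lee_fin.
      + by [].
      + rewrite lee_fin -ler_pdivrMl// mulrC le1r_powR ?(ltW p1)//.
        by rewrite ler_pdivlMr// mul1r.
      + exact: psiT.
  rewrite ge0_integralD; last 5 first.
  - exact: measurable_qball.
  - by move=> y _; rewrite lee_fin ltW.
  - exact: measurable_cst.
  - move=> y _; apply: mule_ge0; [by rewrite lee_fin mulr_ge0 ?ltW|exact: Phi_ge0].
  - by apply: measurable_funTS; apply: measurable_funeM; exact: measurable_psif.
  rewrite integral_cst; last exact: measurable_qball.
  rewrite ge0_integralZl_EFin; last 4 first.
  - exact: measurable_qball.
  - by move=> y _; exact: Phi_ge0.
  - by apply: measurable_funTS; exact: measurable_psif.
  - by rewrite mulr_ge0 ?ltW.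
  rewrite qvolE -EFinM EFinD; apply: leeD2l.
  rewrite -[leRHS]mule1; apply: lee_wpmul2l; last exact: int1.
  by rewrite lee_fin mulr_ge0 ?ltW.
move=> H; rewrite (avgE n0) muleC lee_pdivrMr; last exact: vk.
apply: (le_trans H).
by rewrite -EFinM lee_fin mulrDl divfK ?gt_eqF.
Qed.

(** The p-th root turns the bound by a p-th power into one that is linear in f, to
    which half_average applies. *)
Lemma avg_rdens_ge k (a X : R) : 0 < a -> (avg fE k = a%:E)%E -> 0 <= X ->
  (forall y, ~ N y -> qball k y -> a < 2 * f y ->
     ((X * (2 * f y / a) `^ p)%:E <= dens y)%E) ->
  (X%:E <= avg gE k `^ p)%E.
Proof.
move=> a0 ak X0 H; have vk : 0 < qvol k := qvol_gt0 n0 k.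
pose kappa := X `^ p^-1 * (2 / a).
have kappa0 : 0 <= kappa by rewrite mulr_ge0 ?powR_ge0// divr_ge0// ltW.
have key : ((kappa * (a / 2) * qvol k)%:E <= \int[mu]_(y in qball k) gE y)%E.
  apply: (@half_average _ _ _ mu (qball k) f).
  - exact: measurable_qball.
  - exact: qvolE.
  - exact: mf.
  - exact: f0.
  - by apply/measurable_EFinP; exact: measurable_rdens.
  - by move=> y; rewrite lee_fin rdens_ge0.
  - exact: ltW.
  - exact: kappa0.
  - rewrite EFinM -ak (avgE n0) muleAC -EFinM mulVf ?gt_eqF// mul1e.
    exact: lexx.
  - have [M [mM M0 HM]] := (ae_exE _).1 dens_fin.
    apply/ae_exE; exists (M `|` N); split.
    + exact: measurableU.
    + by apply/(negligibleP mu (measurableU _ _ mM mN))/negligibleU; exact/negligibleP.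
    + move=> y /not_orP[My Ny] By af; rewrite lee_fin.
      have f0' : 0 <= f y := f0 y.
      apply: rdens_ge; [exact: HM|by rewrite mulr_ge0|].
      have -> : (kappa * f y) `^ p = X * (2 * f y / a) `^ p.
        rewrite /kappa -mulrA powRM ?powR_ge0//; last first.
          by rewrite mulr_ge0// divr_ge0// ltW.
        rewrite -powRrM mulVf ?gt_eqF// powRr1//; congr (_ * _ `^ _).
        by rewrite mulrAC.
      exact: H.
have : ((X `^ p^-1)%:E <= avg gE k)%E.
  rewrite (avgE n0) muleC lee_pdivlMr// -EFinM; apply: le_trans key.
  rewrite lee_fin le_eqVlt; apply/orP/or_introl/eqP.
  rewrite /kappa; field; exact: lt0r_neq0.
move=> H1; have -> : X%:E = ((X `^ p^-1)%:E `^ p)%E.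
  by rewrite poweR_EFin -powRrM mulVf ?gt_eqF// powRr1.
apply: gt0_ler_poweR => //.
- exact: ltW.
- by rewrite in_itv/= leey andbT lee_fin powR_ge0.
- by rewrite in_itv/= leey andbT; apply: avg_ge0 => // y; rewrite lee_fin rdens_ge0.
Qed.

(** Where psi exceeds 1, condition (A1) compares its values in a ball, unless
    they exceed the inverse of the volume; then the integral over the ball would
    be too large. *)
Lemma pointwise_large x k (a : R) : ~ N x -> qball k x -> 0 < a ->
  (avg fE k = a%:E)%E -> (8 * qr k) ^+ n <= 1 ->
  (1 <= psi x (large_scale * a)%R)%E ->
  (psi x (large_scale * a)%R <= D%:E * (avg gE k `^ p))%E.
Proof.
move=> Nx Bx a0 ak r1 psi1; have vk : 0 < qvol k := qvol_gt0 n0 k.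
have rk := @qradius_gt0 R n k.
have r8 : 0 < (8 * qr k) ^+ n by rewrite exprn_gt0// mulr_gt0.
set m := ((8 * qr k) ^+ n)^-1.
have m1 : 1 <= m by rewrite invf_ge1.
have mv : scale_vol <= m * qvol k.
  rewrite /m mulrC ler_pdivlMr// /scale_vol exprMn mulrA divfK ?expf_neq0//.
  exact: vol_ge.
have le_half : scale_A1 <= 2^-1 by rewrite ge_min lexx.
have ea0 : 0 < scale_A1 * a by rewrite mulr_gt0.
have eaf y : a < 2 * f y -> scale_A1 * a <= f y.
  move=> af; rewrite (le_trans (ler_wpM2r (ltW a0) le_half))//.
  by rewrite mulrC ler_pdivrMr// mulrC ltW.
(* (A1) applies because large_scale is half of b1 * scale_A1. *)
have A1y tau : 1 <= tau -> tau <= m -> (tau%:E <= psi x (large_scale * a)%R)%E ->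
    forall y, ~ N y -> qball k y -> (tau%:E <= psi y (scale_A1 * a)%R)%E.
  move=> tau1 taum taux y Ny By.
  have xyr : eucl_dist x y < 2 * qr k.
    have := eucl_dist_triangle (qc k) x y; move: Bx By; rewrite /qball /eball/=.
    by rewrite (eucl_dist_sym x (qc k)); lra.
  apply: (psiA1 Nx Ny xyr tau1 _ _ _ taux).
  - rewrite mulrA (_ : 4 * 2 = 8)//; last by ring.
    by rewrite -ler_pdivlMr// mul1r.
  - by rewrite mulr_ge0 ?ltW.
  - rewrite /large_scale mulrA ltr_pM2r// ltr_pdivrMr// ltr_pMr ?mulr_gt0//.
    by rewrite ltr1n.
have psify tau y : 0 <= tau -> (tau%:E <= psi y (scale_A1 * a)%R)%E -> ~ N y -> a < 2 * f y ->
    ((tau * (f y / (scale_A1 * a)) `^ p)%:E <= D%:E * psi y (f y))%E.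
  move=> tau0 tauy Ny af.
  have := dilates_ratio (dilpsi Ny) ea0 (eaf _ af); apply: le_trans.
  by rewrite mulrC EFinM; apply: lee_wpmul2l; rewrite ?lee_fin ?powR_ge0.
have psim : (psi x (large_scale * a)%R <= m%:E)%E.
  rewrite leNgt; apply/negP => /ltW mpsi.
  pose kappa := m / (D * (scale_A1 * a)).
  have kappa0 : 0 <= kappa by rewrite divr_ge0 ?mulr_ge0 ?ltW// (lt_le_trans ltr01 m1).
  have key : ((kappa * (a / 2) * qvol k)%:E <= \int[mu]_(y in qball k) psi y (f y))%E.
    apply: (@half_average _ _ _ mu (qball k) f).
    - exact: measurable_qball.
    - exact: qvolE.
    - exact: mf.
    - exact: f0.
    - exact: measurable_psif.
    - by move=> y; exact: Phi_ge0.
    - exact: ltW.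
    - exact: kappa0.
    - by rewrite EFinM -ak (avgE n0) muleAC -EFinM mulVf ?gt_eqF// mul1e; exact: lexx.
    - apply/ae_exE; exists N; split; [exact: mN|exact: N0|move=> y Ny By af].
      have m0 : 0 <= m := le_trans ler01 m1.
      have := psify m y m0 (A1y m m1 (lexx _) mpsi y Ny By) Ny af => H.
      rewrite -(@lee_pmul2l _ D%:E)// ?lte_fin//; apply: le_trans H.
      rewrite -EFinM lee_fin /kappa.
      have -> : D * (m / (D * (scale_A1 * a)) * f y) = m * (f y / (scale_A1 * a)).
        by field; rewrite !gt_eqF.
      rewrite ler_wpM2l// le1r_powR ?(ltW p1)//.
      by rewrite ler_pdivlMr// mul1r eaf.
  have int1 : (\int[mu]_(y in qball k) psi y (f y) <= 1)%E.
    apply: le_trans intf; apply: ge0_subset_integral.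
    - exact: measurable_qball.
    - by [].
    - exact: measurable_psif.
    - by move=> y _; exact: Phi_ge0.
    - by [].
  have := le_trans key int1; rewrite lee_fin leNgt => /negP; apply.
  apply: (@lt_le_trans _ _ 2); first by rewrite ltr1n.
  have -> : kappa * (a / 2) * qvol k = m * qvol k / (2 * D * scale_A1).
    by rewrite /kappa; field; rewrite !gt_eqF.
  rewrite ler_pdivlMr ?mulr_gt0//; apply: le_trans mv.
  have : scale_A1 <= scale_vol / (4 * D) by rewrite ge_min lexx orbT.
  rewrite ler_pdivlMr ?mulr_gt0//; apply: le_trans.
  by rewrite le_eqVlt; apply/orP/or_introl/eqP; ring.
have [tau tauE] : exists tau, psi x (large_scale * a) = tau%:E.
  exists (fine (psi x (large_scale * a))); rewrite fineK// ge0_fin_numE.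
    by rewrite (le_lt_trans psim)// ltry.
  exact: le_trans psi1.
rewrite tauE in psi1 psim A1y *; rewrite !lee_fin in psi1 psim.
have tau0 : 0 <= tau := le_trans ler01 psi1.
rewrite -[leLHS]mul1e -(divff (lt0r_neq0 D0)) EFinM -muleA.
apply: lee_wpmul2l; first by rewrite lee_fin ltW.
rewrite -EFinM mulrC; apply: (@avg_rdens_ge k a).
- exact: a0.
- exact: ak.
- by rewrite divr_ge0// ltW.
- move=> y Ny By af; apply: le_trans (psif_le_dens y).
  have := psify tau y tau0 (A1y tau psi1 psim (lexx _) y Ny By) Ny af => H.
  rewrite -(@lee_pmul2l _ D%:E)// ?lte_fin//; apply: le_trans H.
  rewrite -EFinM lee_fin.
  have -> : D * (tau / D * (2 * f y / a) `^ p) = tau * (2 * f y / a) `^ p.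
    by field; rewrite gt_eqF.
  rewrite ler_wpM2l//.
  apply: le_powR; rewrite ?(ltW p0)//.
    by rewrite mulr_ge0 ?invr_ge0 ?(ltW a0)// mulr_ge0.
  rewrite invfM mulrA ler_wpM2r ?invr_ge0 ?(ltW a0)// mulrC ler_wpM2l//.
  by rewrite -[leLHS]invrK lef_pV2 ?posrE ?invr_gt0.
Qed.

(** Small values are compared through the limit function, which does not depend
    on the point: its growth takes the place of (A1). Large values of f, beyond T,
    are covered by the growth of psi itself, because the averages are bounded. *)
Lemma pointwise_small k (a : R) : 0 < a -> a <= avg_bound ->
  (avg fE k = a%:E)%E ->
  (phioo (small_scale * a)%R <= s%:E)%E /\
  (phioo (small_scale * a)%R <= pw_const%:E * (avg gE k `^ p))%E.
Proof.
move=> a0 aA ak.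
have TA0 : 0 < T + avg_bound by rewrite addr_gt0.
have eta_b2 : scale_A2 <= b2 by rewrite ge_min lexx.
have eta_t0 : b2 * scale_A2 * (T + avg_bound) <= t0.
  have : scale_A2 <= t0 / (b2 * (T + avg_bound)) by rewrite ge_min lexx orbT.
  by rewrite ler_pdivlMr ?mulr_gt0// mulrCA mulrA.
have be0 : 0 < b2 * scale_A2 by rewrite mulr_gt0.
have eta_u w : w <= T + avg_bound -> b2 * scale_A2 * w <= t0.
  by move=> wA; apply: le_trans eta_t0; rewrite ler_pM2l.
pose t := b2 * scale_A2 * (a / 2).
have t_gt0 : 0 < t by rewrite mulr_gt0// divr_gt0.
have tt0 : t <= t0 by apply: eta_u; have := ltW T0; lra.
have -> : small_scale * a = b2 * t by rewrite /small_scale /t; ring.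
have phit0 : (phioo (b2 * t)%R <= s%:E)%E.
  apply: le_trans phioot0; apply: phioo_le; first by rewrite mulr_ge0 ?ltW.
  rewrite ler_pdivlMr// mulrC mulrA (le_trans _ tt0)// ler_piMl ?(ltW t_gt0)//.
  by rewrite mulr_ile1// ltW.
split; first exact: phit0.
have [P PE] : exists P, phioo (b2 * t) = P%:E.
  exists (fine (phioo (b2 * t))); rewrite fineK// ge0_fin_numE.
    by rewrite (le_lt_trans phit0)// ltry.
  by apply: phioo_ge0; rewrite mulr_ge0 ?ltW.
have P0 : 0 <= P by rewrite -lee_fin -PE; apply: phioo_ge0; rewrite mulr_ge0 ?ltW.
have Ps : (P <= D * (t / t0) `^ p * s).
  rewrite -lee_fin -PE; apply: le_trans (phioo_growth t_gt0 tt0 (lexx _)) _.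
  rewrite [leRHS]EFinM; apply: lee_wpmul2l => //.
  by rewrite lee_fin mulr_ge0 ?(ltW D0)// powR_ge0.
have C1 := pw_const_ge1; have C0 : 0 < pw_const := lt_le_trans ltr01 C1.
rewrite PE -[leLHS]mul1e -(divff (lt0r_neq0 C0)) EFinM -muleA.
apply: lee_wpmul2l; first by rewrite lee_fin ltW.
rewrite -EFinM mulrC; apply: (@avg_rdens_ge k a).
- exact: a0.
- exact: ak.
- by rewrite divr_ge0// ltW.
move=> y Ny By af.
have fy0 : 0 < f y by rewrite -(@pmulr_rgt0 _ 2)// (lt_trans a0).
have [fT|/ltW Tf] := leP (f y) T.
- pose u := b2 * scale_A2 * f y.
  have u0 : 0 < u by rewrite mulr_gt0.
  have tu : t <= u.
    by rewrite ler_pM2l// ler_pdivrMr// mulrC ltW.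
  have ut0 : u <= t0 by apply: eta_u; have := ltW A0'; lra.
  have ub2 : u / b2 = scale_A2 * f y by rewrite /u; field; rewrite gt_eqF.
  have Fy : (phioo (u / b2)%R <= dens y)%E.
    have -> : u / b2 = b2 * (scale_A2 * f y / b2).
      by rewrite ub2; field; rewrite gt_eqF.
    apply: le_trans (psiA2b Ny _ _) _.
    + by rewrite divr_ge0 ?mulr_ge0 ?ltW.
    + have -> : b2 * (scale_A2 * f y / b2) = u / b2.
        by rewrite ub2; field; rewrite gt_eqF.
      apply: le_trans phioot0; apply: phioo_le; first by rewrite divr_ge0 ?ltW.
      by rewrite ler_pM2r ?invr_gt0.
    + apply: leeD2r; apply: Phi_le => //; first by rewrite divr_ge0 ?mulr_ge0 ?ltW.
      by rewrite ler_pdivrMr// mulrC ler_pM2l.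
  have := phioo_growth t_gt0 tu ut0; rewrite PE => PF.
  have {}PF : (P%:E <= (D * (t / u) `^ p)%:E * dens y)%E.
    apply: (le_trans PF); apply: lee_wpmul2l => //.
    by rewrite lee_fin mulr_ge0 ?(ltW D0)// powR_ge0.
  have tuE : t / u = (2 * f y / a)^-1 by rewrite /t /u; field; rewrite !gt_eqF.
  have Z0 : 0 < (2 * f y / a) `^ p by rewrite powR_gt0// divr_gt0// mulr_gt0.
  rewrite tuE powRV in PF; last by rewrite divr_ge0 ?(ltW a0)// mulr_ge0 ?(ltW fy0).
  set Z := (2 * f y / a) `^ p in Z0 PF *.
  have -> : dens y = ((Z / D)%:E * ((D * Z^-1)%:E * dens y))%E.
    rewrite muleA -EFinM (_ : Z / D * (D * Z^-1) = 1) ?mul1e//.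
    by field; rewrite (gt_eqF D0) (gt_eqF Z0).
  apply: (@le_trans _ _ ((Z / D)%:E * P%:E)%E).
    rewrite -EFinM lee_fin.
    have -> : Z / D * P = P * Z / D by ring.
    rewrite mulrAC ler_wpM2l ?mulr_ge0 ?(ltW Z0)//.
    by rewrite lef_pV2 ?posrE// le_max lexx.
  by apply: lee_wpmul2l; rewrite ?lee_fin ?divr_ge0 ?(ltW Z0) ?(ltW D0).
- apply: le_trans (psif_le_dens y).
  rewrite -(@lee_pmul2l _ D%:E)// ?lte_fin//.
  apply: le_trans (dilates_ratio (dilpsi Ny) T0 Tf).
  apply: (@le_trans _ _ ((f y / T) `^ p)%:E); last first.
    rewrite -[leLHS]mule1; apply: lee_wpmul2l; [by rewrite lee_fin powR_ge0|exact: psiT].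
  rewrite -EFinM lee_fin.
  apply: (@le_trans _ _ ((b2 * scale_A2 * f y / t0) `^ p)); last first.
    apply: le_powR; rewrite ?(ltW p0)//.
      by rewrite divr_ge0 ?(ltW t00)// mulr_ge0 ?ltW.
    have bT : b2 * scale_A2 * T <= t0 by apply: eta_u; have := ltW A0'; lra.
    rewrite ler_pdivrMr// (_ : f y / T * t0 = f y * t0 / T); last by ring.
    rewrite ler_pdivlMr// (_ : _ * f y * T = f y * (b2 * scale_A2 * T)); last by ring.
    by rewrite ler_pM2l.
  have -> : b2 * scale_A2 * f y / t0 = t / t0 * (2 * f y / a).
    by rewrite /t; field; rewrite !gt_eqF.
  have Z0 : 0 <= 2 * f y / a by rewrite divr_ge0 ?(ltW a0)// mulr_ge0 ?(ltW fy0).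
  have tt : 0 <= t / t0 by rewrite divr_ge0 ?ltW.
  rewrite (powRM _ tt Z0).
  rewrite mulrA; apply: ler_wpM2r; first exact: powR_ge0.
  rewrite mulrA ler_pdivrMr//.
  apply: (@le_trans _ _ (D * (D * (t / t0) `^ p * s))); first by rewrite ler_pM2l.
  have -> : D * (D * (t / t0) `^ p * s) = (t / t0) `^ p * (D ^+ 2 * s) by ring.
  by apply: ler_wpM2l; [exact: powR_ge0|rewrite le_max lexx orbT].
Qed.

(** If psi is less than 1 at the scaled average, or if the ball is not small, then
    the average is bounded; otherwise (A1) applies. *)
Lemma pointwise_avg x k : ~ N x -> qball k x ->
  exists2 a : R, 0 <= a /\ avg fE k = a%:E &
    (psi x (pw_scale * a)%R <= pw_const%:E * (avg gE k `^ p) + (h x)%:E)%E.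
Proof.
move=> Nx Bx; have rk := @qradius_gt0 R n k.
have vk : 0 < qvol k := qvol_gt0 n0 k.
have fE0 y : (0 <= fE y)%E by rewrite lee_fin.
have gE0 y : (0 <= gE y)%E by rewrite lee_fin rdens_ge0.
have [a aE] : exists a : R, avg fE k = a%:E.
  exists (fine (avg fE k)); rewrite fineK// ge0_fin_numE ?avg_ge0//.
  by rewrite (le_lt_trans (avg_le k))// ltry.
have a_ge0 : 0 <= a by rewrite -lee_fin -aE avg_ge0.
exists a; first by split.
have rhs0 : (0 <= pw_const%:E * (avg gE k `^ p))%E.
  by apply: mule_ge0; [rewrite lee_fin (le_trans ler01)// pw_const_ge1|exact: poweR_ge0].
have hx : (0 <= (h x)%:E)%E by rewrite lee_fin.
move: a_ge0; rewrite le_eqVlt => /predU1P[<-|a0].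
  by rewrite mulr0 (Phi_0 psiP); apply: adde_ge0.
have small : a <= avg_bound ->
    (psi x (pw_scale * a)%R <= pw_const%:E * (avg gE k `^ p) + (h x)%:E)%E.
  move=> aA; have [phs phC] := pointwise_small a0 aA aE.
  apply: (@le_trans _ _ (psi x (b2 * (small_scale * a))%R)).
    apply: Phi_le => //; first by rewrite mulr_ge0 ?(ltW pw_scale_gt0) ?(ltW a0).
    by rewrite mulrA ler_pM2r// ge_min lexx orbT.
  apply: (le_trans (psiA2a Nx _ phs)); first by rewrite mulr_ge0 ?ltW.
  exact: leeD2r.
have [r1|r1] := leP ((8 * qr k) ^+ n) 1; last first.
  apply: small; rewrite /avg_bound le_max; apply/orP; left.
  rewrite -lee_fin -aE; apply: le_trans (avg_le k) _; rewrite lee_fin lerD2l.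
  rewrite ler_pM2l ?mulr_gt0// lef_pV2 ?posrE//.
  apply: le_trans (vol_ge n0 (qc k) rk).
  rewrite /scale_vol ler_pdivrMr ?exprn_gt0// -mulrA ler_peMr ?(ltW (ballc_gt0 n0))//.
  by rewrite -exprMn mulrC ltW.
have [psi1|psi1] := leP 1%E (psi x (large_scale * a)%R); last first.
  apply: small; rewrite /avg_bound le_max; apply/orP; right.
  rewrite ler_pdivlMr// mulrC leNgt; apply/negP => /ltW Tc.
  have := le_trans (psiT Nx) (Phi_le psiP x (ltW T0) Tc).
  by rewrite leNgt psi1.
apply: (@le_trans _ _ (psi x (large_scale * a)%R)).
  apply: Phi_le => //; first by rewrite mulr_ge0 ?(ltW pw_scale_gt0) ?(ltW a0).
  by rewrite ler_pM2r// ge_min lexx.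
apply: (le_trans (pointwise_large Nx Bx a0 aE r1 psi1)).
apply: (@le_trans _ _ (pw_const%:E * (avg gE k `^ p))%E); last by apply: leeDl.
by apply: lee_wpmul2r; [exact: poweR_ge0|rewrite lee_fin le_max lexx].
Qed.

(** As psi need not be left-continuous, the passage to the supremum of the averages
    costs a factor 2. *)
Lemma pointwise_qmax x : ~ N x ->
  (phi_ext psi x ((pw_scale / 2)%:E * qmax fE x) <=
   pw_const%:E * (qmax gE x `^ p) + (h x)%:E)%E.
Proof.
move=> Nx; have c0 := pw_scale_gt0.
have C0 : 0 <= pw_const := le_trans ler01 pw_const_ge1.
have gE0 y : (0 <= gE y)%E by rewrite lee_fin rdens_ge0.
have fE0 y : (0 <= fE y)%E by rewrite lee_fin.
have qg0 : (0 <= qmax gE x)%E by exact: qmax_ge0.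
have base k : qball k x -> exists2 a : R, 0 <= a /\ avg fE k = a%:E &
    (psi x (pw_scale * a)%R <= pw_const%:E * (qmax gE x `^ p) + (h x)%:E)%E.
  move=> kx; have [a aE ha] := pointwise_avg Nx kx; exists a => //.
  apply: (le_trans ha); apply: leeD2r; apply: lee_wpmul2l; first by rewrite lee_fin.
  apply: gt0_ler_poweR; rewrite ?(ltW p0)// ?in_itv/= ?leey ?andbT//.
    exact: avg_ge0.
  by apply: ereal_sup_ubound; exists k.
have rhs0 : (0 <= pw_const%:E * (qmax gE x `^ p) + (h x)%:E)%E.
  by apply: adde_ge0; [apply: mule_ge0; [rewrite lee_fin|exact: poweR_ge0]|rewrite lee_fin].
have psi_lt (l : R) : 0 <= l -> (l%:E < qmax fE x)%E ->
    (psi x (pw_scale * l)%R <= pw_const%:E * (qmax gE x `^ p) + (h x)%:E)%E.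
  move=> l0 /ereal_sup_gt[_ [k kx <-]] lk.
  have [a [a0 aE] ha] := base k kx; apply: le_trans ha.
  apply: Phi_le => //; first by rewrite mulr_ge0 ?(ltW c0).
  by rewrite ler_pM2l// ltW// -lte_fin -aE.
have qf0 : (0 <= qmax fE x)%E by exact: qmax_ge0.
case qE : (qmax fE x) qf0 => [q| |]//.
- rewrite lee_fin -EFinM /= le_eqVlt => /predU1P[<-|q0].
    by rewrite mulr0 (Phi_0 psiP).
  rewrite -mulrA (mulrC 2^-1); apply: psi_lt; first by rewrite divr_ge0 ?ltW.
  by rewrite qE lte_fin ltr_pdivrMr// ltr_pMr// ltr1n.
- move=> _; rewrite gt0_muley ?lte_fin ?divr_gt0//= leye_eq; apply/eqP/eqyP => M M0.
  have [t t_gt0 Mt] := Phi_cvgoo psiP x M; apply: (le_trans Mt).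
  have -> : t = pw_scale * (t / pw_scale) by field; rewrite gt_eqF.
  by apply: psi_lt; [rewrite divr_ge0 ?ltW|rewrite qE ltry].
Qed.

(** The maximal theorem in L^p for the p-th root of the density. *)
Lemma modular_qmax :
  (\int[mu]_x phi_ext psi x ((pw_scale / 2)%:E * qmax fE x) <=
   (pw_const * @strong_constant R n p)%:E * (1 + \int[mu]_x (h x)%:E) +
   \int[mu]_x (h x)%:E)%E.
Proof.
have C0 : 0 <= pw_const := le_trans ler01 pw_const_ge1.
have mq : measurable_fun setT (fun x => qmax gE x `^ p)%E.
  exact: (measurableT_comp (measurable_poweR p) (measurable_qmax _)).
have fE0 y : (0 <= fE y)%E by rewrite lee_fin.
have mhE : measurable_fun setT (fun x => (h x)%:E) by exact/measurable_EFinP.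
apply: (@le_trans _ _ (\int[mu]_x (pw_const%:E * (qmax gE x `^ p) + (h x)%:E))%E).
  apply: ae_ge0_le_integralT.
  - exact: lebesgue_Rn_complete.
  - by apply: emeasurable_funD; [exact: measurable_funeM|exact: mhE].
  - move=> x; have : (0 <= (pw_scale / 2)%:E * qmax fE x)%E.
      by apply: mule_ge0; [rewrite lee_fin divr_ge0 ?(ltW pw_scale_gt0)|exact: qmax_ge0].
    by case: (_ * _)%E => [r||]//= r0; apply: Phi_ge0.
  - move=> x; apply: adde_ge0; last by rewrite lee_fin.
    by apply: mule_ge0; [rewrite lee_fin|exact: poweR_ge0].
  - by apply/ae_exE; exists N; split; [exact: mN|exact: N0|exact: pointwise_qmax].
rewrite ge0_integralD; last 5 first.
- by [].
- by move=> x _; apply: mule_ge0; [rewrite lee_fin|exact: poweR_ge0].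
- exact: measurable_funeM.
- by move=> x _; rewrite lee_fin.
- exact: mhE.
apply: leeD2r; rewrite ge0_integralZl_EFin; last 4 first.
- by [].
- by move=> x _; exact: poweR_ge0.
- exact: mq.
- exact: C0.
rewrite EFinM -muleA; apply: lee_wpmul2l; first by rewrite lee_fin.
apply: (le_trans (strong_type n0 p1 rdens_ge0 measurable_rdens)).
apply: lee_wpmul2l.
  rewrite lee_fin; apply: mulr_ge0; last exact: powR_ge0.
  apply: mulr_ge0.
    apply: mulr_ge0; last exact: powR_ge0.
    by apply: mulr_ge0 => //; exact: ltW (@weak_constant_gt0 R n n0).
  apply: divr_ge0; first exact: powR_ge0.
  by rewrite subr_ge0 -[leLHS](powRr0 2) ler_powR ?ler1n// subr_ge0 ltW.
apply: le_trans int_dens; apply: ge0_le_integralT => x; first by rewrite lee_fin powR_ge0.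
by rewrite rdens_powR; case: (dens x) (dens_ge0 x) => [r||]//=; rewrite leey.
Qed.

End one_function.

End pointwise.

Section phi_ext.
Context {R : realType} {n : nat} (n0 : (0 < n)%N).
Local Notation E := (Rn R n).
Local Notation mu := (@lebesgue_Rn R n).

Section one_function.
Variables (phi : E -> R -> \bar R) (phiP : weak_Phi phi).

Lemma phi_ext_ge0 x u : (0 <= u)%E -> (0 <= phi_ext phi x u)%E.
Proof. by case: u => [r||]//= r0; exact: Phi_ge0. Qed.

Lemma phi_ext_le x u v : (0 <= u)%E -> (u <= v)%E ->
  (phi_ext phi x u <= phi_ext phi x v)%E.
Proof.
case: u => [r||]//=; case: v => [s||]//=; rewrite ?lee_fin ?leey// => r0 rs.
exact: Phi_le.
Qed.

Lemma measurable_phi_ext (f : E -> \bar R) : measurable_fun setT f ->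
  measurable_fun setT (fun x => phi_ext phi x `|f x|%E).
Proof.
move=> mf.
have -> : (fun x => phi_ext phi x `|f x|%E) = (fun x =>
    if (`|f x|%E == +oo%E) then +oo%E else phi x `|fine (f x)|).
  by apply/funext => x; case: (f x).
apply: measurable_fun_ifT.
- apply: (measurable_fun_bool true).
  have -> : (fun x => `|f x|%E == +oo%E) @^-1` [set true] = (fun x => `|f x|%E) @^-1` [set +oo%E].
    by apply/seteqP; split => x /= /eqP.
  have : measurable_fun setT (fun x => `|f x|%E) by exact: measurableT_comp.
  by apply; [exact: measurableT|exact: emeasurable_set1].
- exact: measurable_cst.
- apply: (measurable_Phi phiP).
  exact: (measurableT_comp (fine_measurable measurableT) mf).
Qed.

Lemma modular_ae_fin (f : E -> \bar R) : measurable_fun setT f ->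
  (modular phi f < +oo)%E -> {ae mu, forall x, f x \is a fin_num}.
Proof.
move=> mf fin.
have : mu.-integrable setT (fun x => phi_ext phi x `|f x|%E).
  apply/integrableP; split; first exact: measurable_phi_ext.
  by under eq_integral do rewrite gee0_abs ?phi_ext_ge0 ?abse_ge0//.
move=> /(integrable_ae measurableT); apply: filterS => x /(_ I).
by case: (f x).
Qed.

(** The contraction of modulars: by the almost monotonicity of phi(x, t) / t they
    can be made as small as desired. *)
Lemma phi_ext_contract L (c : R) x u : dilates 1 L (phi x) -> 1 <= L -> 0 < c <= 1 ->
  (0 <= u)%E -> (phi_ext phi x (c%:E * u) <= (L * c)%:E * phi_ext phi x u)%E.
Proof.
move=> dL L1 /andP[c0 c1]; have L0 : 0 < L := lt_le_trans ltr01 L1.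
case: u => [t||]//=.
  rewrite lee_fin le_eqVlt => /predU1P[<-|t0].
    by rewrite mulr0 Phi_0// mule0.
  by have := dilates_contract dL (_ : 0 < c <= 1) t0; rewrite powRr1 ?(ltW c0)// c0; apply.
by move=> _; rewrite [X in (_ <= X)%E]gt0_muley ?leey// lte_fin mulr_gt0.
Qed.

End one_function.

Lemma phi_ext_equiv (phi psi : E -> R -> \bar R) (L : R) (h : E -> R) x :
  0 < L -> (forall t : R, 0 <= t -> (psi x t <= phi x (L * t)%R + (h x)%:E)%E) ->
  forall u, (0 <= u)%E ->
  (phi_ext psi x (L^-1%:E * u) <= phi_ext phi x u + (h x)%:E)%E.
Proof.
move=> L0 H [t||]//= t0.
  have := H (L^-1 * t); rewrite mulrA divff ?gt_eqF// mul1r; apply.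
  by rewrite mulr_ge0 ?invr_ge0// ltW.
by rewrite addye ?leey.
Qed.

Lemma HL_scale (f : E -> \bar R) (l : R) x : measurable_fun setT f -> 0 < l ->
  (HL_maximal_Rn f x <= l%:E * HL_maximal_Rn (fun x => f x * l^-1%:E) x)%E.
Proof.
move=> mf l0; apply: ge_ereal_sup => _ [B [BB Bx] <-].
apply: (@le_trans _ _ (l%:E * ((mu B)^-1 * \int[mu]_(y in B) `|f y * l^-1%:E|))%E); last first.
  apply: lee_wpmul2l; first by rewrite lee_fin ltW.
  by apply: ereal_sup_ubound; exists B.
have [c [r [r0 BE]]] := BB.
have -> : (\int[mu]_(y in B) `|f y * l^-1%:E| = l^-1%:E * \int[mu]_(y in B) `|f y|)%E.
  rewrite -ge0_integralZl_EFin.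
  - by apply: eq_integral => y _; rewrite abseM muleC gee0_abs ?lee_fin ?invr_ge0 ?(ltW l0).
  - by rewrite BE; exact: measurable_eball.
  - by move=> y _; exact: abse_ge0.
  - by apply: measurable_funTS; exact: measurableT_comp.
  - by rewrite invr_ge0 ltW.
by rewrite (muleCA (mu B)^-1%E) (muleA l%:E) -EFinM divff ?gt_eqF// mul1e.
Qed.

Lemma HL_ge0 (f : E -> \bar R) x : (0 <= HL_maximal_Rn f x)%E.
Proof.
apply: le_trans (ereal_sup_ubound _); last first.
  exists (eball x 1) => //; split; first exact: euclidean_ball_eball.
  exact: eball_center.
apply: mule_ge0; last by apply: integral_ge0.
by rewrite inve_ge0.
Qed.

Lemma qmax_scale (f : E -> \bar R) (g : E -> R) (l : R) x : measurable_fun setT f ->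
  measurable_fun setT g -> (forall y, 0 <= g y) -> 0 < l ->
  {ae mu, forall y, `|f y| = (l * g y)%:E}%E ->
  (qmax (fun y => `|f y|) x <= l%:E * qmax (EFin \o g) x)%E.
Proof.
move=> mf mg g0 l0 fg; apply: ge_ereal_sup => _ [k kx <-].
apply: (@le_trans _ _ (l%:E * avg (EFin \o g) k)%E); last first.
  apply: lee_wpmul2l; first by rewrite lee_fin ltW.
  by apply: ereal_sup_ubound; exists k.
rewrite !(avgE n0) muleCA; apply: lee_wpmul2l.
  by rewrite lee_fin invr_ge0 ltW// qvol_gt0.
rewrite -ge0_integralZl_EFin.
- rewrite (@ge0_ae_eq_integral _ _ _ _ _ (fun y => `|f y|)%E (fun y => l%:E * (EFin \o g) y)%E).
  + exact: lexx.
  + exact: measurable_qball.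
  + by apply: measurable_funTS; exact: measurableT_comp.
  + by apply: measurable_funTS; apply: measurable_funeM; exact/measurable_EFinP.
  + by move=> y _; exact: abse_ge0.
  + by move=> y _; rewrite /= -EFinM lee_fin mulr_ge0// ltW.
  + by apply: filterS fg => y -> _; rewrite /= EFinM.
- exact: measurable_qball.
- by move=> y _; rewrite lee_fin.
- by apply: measurable_funTS; exact/measurable_EFinP.
- exact: ltW.
Qed.

(** Since the maximal function is homogeneous, it suffices to consider functions
    of modular at most 1. *)
Lemma bounded_of_modular (phi : E -> R -> \bar R) (K : R) : weak_Phi phi -> 0 < K ->
  (forall f : E -> \bar R, measurable_fun setT f -> (modular phi f <= 1)%E ->
    (modular phi (fun x => HL_maximal_Rn f x * K^-1%:E) <= 1)%E) ->
  maximal_bounded phi.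
Proof.
move=> phiP K0 H; exists K => f [mf _].
rewrite -lee_pdivrMl//; apply: le_ereal_inf_tmp => _ [l [l0 fl] <-].
rewrite lee_pdivrMl//; apply: ereal_inf_lbound.
exists (K * l) => //; split; first by rewrite mulr_gt0.
apply: le_trans (H (fun x => f x * l^-1%:E)%E _ fl); last first.
  have -> : (fun x => f x * l^-1%:E)%E = (fun x => l^-1%:E * f x)%E.
    by apply/funext => x; rewrite muleC.
  exact: measurable_funeM.
apply: ge0_le_integralT => x; first by apply: (phi_ext_ge0 phiP); exact: abse_ge0.
apply: (phi_ext_le phiP); first exact: abse_ge0.
have K0' : (0 <= K^-1%:E)%E by rewrite lee_fin invr_ge0 ltW.
have Kl0' : (0 <= (K * l)^-1%:E)%E by rewrite lee_fin invr_ge0 ltW// mulr_gt0.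
rewrite !gee0_abs; last 2 first.
- by apply: mule_ge0 => //; exact: HL_ge0.
- by apply: mule_ge0 => //; exact: HL_ge0.
have -> : ((K * l)^-1%:E = l^-1%:E * K^-1%:E)%E by rewrite -EFinM invfM mulrC.
rewrite muleA; apply: lee_wpmul2r; first exact: K0'.
rewrite lee_pdivrMr// muleC.
exact: HL_scale.
Qed.

End phi_ext.

Section sufficiency.
Context {R : realType} {n : nat} (n0 : (0 < n)%N).
Local Notation E := (Rn R n).
Local Notation mu := (@lebesgue_Rn R n).

Lemma measure0_setU (A B : set E) : measurable A -> measurable B ->
  mu A = 0%E -> mu B = 0%E -> measurable (A `|` B) /\ mu (A `|` B) = 0%E.
Proof.
move=> mA mB A0 B0; have mAB := measurableU _ _ mA mB; split; first exact: mAB.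
by apply/(negligibleP mu mAB)/negligibleU; exact/negligibleP.
Qed.

Lemma modular_estimate (psi : E -> R -> \bar R) : weak_Phi psi ->
  A0 psi -> A1 psi -> A2 psi -> aInc psi ->
  exists c C : R, [/\ 0 < c, 0 <= C & forall f : E -> R, measurable_fun setT f ->
    (forall y, 0 <= f y) -> (\int[mu]_y psi y (f y) <= 1)%E ->
    (\int[mu]_x phi_ext psi x (c%:E * qmax (EFin \o f) x) <= C%:E)%E].
Proof.
move=> psiP psiA0 psiA1 psiA2 [p [D [p1 D1 /ae_exE[Ni [mNi Ni0 inc]]]]].
have [b0 [/andP[b0_gt0 b0_le1] /ae_exE[N0 [mN0 N00 H0]]]] := A0P psiP psiA0.
have [b1 [/andP[b10 b11] [N1 [mN1 N10 H1]]]] := A1P n0 psiP psiA1.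
have [phioo [h [b2 [s [phiooP [_ mh h0 ih] /andP[b20 b21] s0 /ae_exE[N2 [mN2 N20 H2]]]]]]] :=
  A2P psiP psiA2.
have [mNa Na0] := measure0_setU mNi mN0 Ni0 N00.
have [mNb Nb0] := measure0_setU mN1 mN2 N10 N20.
have [mN N0'] := measure0_setU mNa mNb Na0 Nb0.
set N := (_ `|` _) in mN N0'.
have NN x : ~ N x -> [/\ ~ Ni x, ~ N0 x, ~ N1 x & ~ N2 x].
  by move=> /not_orP[/not_orP[? ?] /not_orP[? ?]].
have [u u0 us] := @Phi_cvg0 _ _ _ phiooP point s s0.
pose T := 2 / b0; have T0 : 0 < T by rewrite divr_gt0.
pose t0 := b2 * u; have t00 : 0 < t0 by rewrite mulr_gt0.
have dil x : ~ N x -> dilates p D (psi x).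
  move=> /NN[Nix _ _ _]; apply/dilatesP => // [t tgt0|].
    by apply: Phi_ge0 => //; exact: ltW.
  exact: inc.
have psiT x : ~ N x -> (1 <= psi x T)%E.
  move=> /NN[_ N0x _ _]; have [_] := H0 x N0x; apply.
  by rewrite /T ltr_pMl ?invr_gt0// ltr1n.
have A1h (x y : E) : ~ N x -> ~ N y ->
    forall r tau s t : R, eucl_dist x y < r -> 1 <= tau -> tau * (4 * r) ^+ n <= 1 ->
    0 <= s -> s < b1 * t -> (tau%:E <= psi x s)%E -> (tau%:E <= psi y t)%E.
  by move=> /NN[_ _ N1x _] /NN[_ _ N1y _]; exact: H1.
have A2a x : ~ N x -> forall t : R, 0 <= t ->
    (phioo t <= s%:E)%E -> (psi x (b2 * t)%R <= phioo t + (h x)%:E)%E.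
  by move=> /NN[_ _ _ N2x] t t_ge0; have [] := H2 x N2x t t_ge0.
have A2b x : ~ N x -> forall t : R, 0 <= t ->
    (phioo (b2 * t)%R <= s%:E)%E -> (phioo (b2 * t)%R <= psi x t + (h x)%:E)%E.
  by move=> /NN[_ _ _ N2x] t t_ge0; have [] := H2 x N2x t t_ge0.
have pht0 : (phioo (t0 / b2)%R <= s%:E)%E by rewrite /t0 mulrC mulKf ?gt_eqF// ltW.
have [H Hh] : exists H, (\int[mu]_x (h x)%:E)%E = H%:E.
  exists (fine (\int[mu]_x (h x)%:E)%E); rewrite fineK// ge0_fin_numE//.
  by apply: integral_ge0 => x _; rewrite lee_fin.
have H_ge0 : 0 <= H.
  by rewrite -lee_fin -Hh; apply: integral_ge0 => x _; rewrite lee_fin.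
pose C := @pw_const R D s * @strong_constant R n p * (1 + H) + H.
exists (@pw_scale R n D T b1 b2 t0 / 2), (Num.max 0 C); split.
- by rewrite divr_gt0// (pw_scale_gt0 n0).
- by rewrite le_max lexx.
- move=> f mf f0 intf.
  have := modular_qmax n0 psiP phiooP mN N0'
    p1 D1 T0 b10 b20 b21 t00 mh h0 ih dil psiT A1h A2a A2b pht0 mf f0 intf.
  move=> /le_trans; apply; rewrite Hh; apply: (@le_trans _ _ C%:E).
    by rewrite /C EFinD [X in (_ <= X + _)%E]EFinM EFinD.
  by rewrite lee_fin le_max lexx orbT.
Qed.

(** The modular of f is contracted before and after the estimate for psi: the
    integrable error of the weak equivalence enters twice. *)
Lemma sufficiency (phi psi : E -> R -> \bar R) : weak_Phi phi -> weak_Phi psi ->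
  weakly_equivalent phi psi -> A0 psi -> A1 psi -> A2 psi -> aInc psi ->
  maximal_bounded phi.
Proof.
move=> phiP psiP [L [h [L1 h1 /ae_exE[N [mN N0 eqv]]]]] psiA0 psiA1 psiA2 psii.
have [c [C [c0 C0 main]]] := modular_estimate psiP psiA0 psiA1 psiA2 psii.
have L0 : 0 < L := lt_le_trans ltr01 L1.
have h1' : Num.norm \o h \in Lfun mu 1 by exact: Lfun_norm.
have /Lfun1_integrable/integrableP[mh ih] := h1'.
have [H Hh] : exists H, (\int[mu]_x `|h x|%:E)%E = H%:E.
  exists (fine (\int[mu]_x `|h x|%:E)%E); rewrite fineK// ge0_fin_numE//.
    apply: le_lt_trans ih; apply: ge0_le_integralT => x; first by rewrite lee_fin.
    by rewrite /= normr_id.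
  by apply: integral_ge0 => x _; rewrite lee_fin.
have H0 : 0 <= H.
  by rewrite -lee_fin -Hh; apply: integral_ge0 => x _; rewrite lee_fin.
have hh x : ((h x)%:E <= `|h x|%:E)%E by rewrite lee_fin ler_norm.
have eqv1 x : ~ N x -> forall t : R, 0 <= t -> (psi x t <= phi x (L * t)%R + `|h x|%:E)%E.
  by move=> Nx t t0; have [+ _] := eqv x Nx t t0; move=> /le_trans; apply; exact: leeD2l.
have eqv2 x : ~ N x -> forall t : R, 0 <= t -> (phi x t <= psi x (L * t)%R + `|h x|%:E)%E.
  by move=> Nx t t0; have [_ +] := eqv x Nx t t0; move=> /le_trans; apply; exact: leeD2l.
have [Dp Dp1 dphi] := Phi_dilates phiP.
have [Ds Ds1 dpsi] := Phi_dilates psiP.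
have Dp0 : 0 < Dp := lt_le_trans ltr01 Dp1.
have Ds0 : 0 < Ds := lt_le_trans ltr01 Ds1.
pose d1 := (Ds * (1 + H))^-1.
have H10 : 0 < 1 + H by rewrite ltr_wpDr.
have d10 : 0 < d1 by rewrite invr_gt0 mulr_gt0.
have d11 : d1 <= 1 by rewrite invf_le1 ?mulr_gt0// mulr_ege1// lerDl.
pose d2 := (Dp * (1 + (C + H)))^-1.
have CH0 : 0 < 1 + (C + H) by rewrite ltr_wpDr// addr_ge0.
have d20 : 0 < d2 by rewrite invr_gt0 mulr_gt0.
have d21 : d2 <= 1 by rewrite invf_le1 ?mulr_gt0// mulr_ege1// lerDl addr_ge0.
pose l := L / d1; have l0 : 0 < l by rewrite divr_gt0.
have M0 : 0 < @maximal_constant R n by exact: maximal_constant_gt0.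
pose K := @maximal_constant R n * l / (d2 * L^-1 * c).
have K0 : 0 < K.
  apply: divr_gt0; first exact: mulr_gt0.
  by apply: mulr_gt0 => //; apply: mulr_gt0 => //; rewrite invr_gt0.
apply: (bounded_of_modular phiP K0) => f mf fmod.
have ffin := modular_ae_fin phiP mf (le_lt_trans fmod (ltry 1)).
pose g x := l^-1 * `|fine (f x)|.
have mg : measurable_fun setT g by exact: measurable_scaled_fine.
have g0 y : 0 <= g y by rewrite mulr_ge0 ?invr_ge0 ?(ltW l0).
have mphif := measurable_phi_ext phiP mf.
have mhE : measurable_fun setT (fun x => `|h x|%:E) by exact: mh.
have intg : (\int[mu]_y psi y (g y) <= 1)%E.
  apply: (@le_trans _ _ (\int[mu]_y ((Ds * d1)%:E * (phi_ext phi y `|f y|%E + `|h y|%:E)))%E).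
    apply: ae_ge0_le_integralT.
    - exact: lebesgue_Rn_complete.
    - by apply: measurable_funeM; apply: emeasurable_funD; [exact: mphif|exact: mhE].
    - by move=> x; apply: Phi_ge0.
    - move=> x; apply: mule_ge0; first by rewrite lee_fin mulr_ge0 ?ltW.
      apply: adde_ge0; last by rewrite lee_fin.
      by apply: (phi_ext_ge0 phiP); exact: abse_ge0.
    - have [M [mM M0' fM]] := (ae_exE _).1 ffin.
      have [mMN MN0] := measure0_setU mM mN M0' N0.
      apply/ae_exE; exists (M `|` N); split; [exact: mMN|exact: MN0|].
      move=> x /not_orP[Mx Nx].
      have e1 := @phi_ext_equiv R n phi psi L (Num.norm \o h) x L0 (eqv1 x Nx) _ (abse_ge0 (f x)).
      have d1i : 0 < d1 <= 1 by rewrite d10.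
      have Lf0 : (0 <= L^-1%:E * `|f x|)%E.
        by apply: mule_ge0; [rewrite lee_fin invr_ge0 ltW|exact: abse_ge0].
      have e2 := phi_ext_contract psiP (dpsi x) Ds1 d1i Lf0.
      have -> : psi x (g x) = phi_ext psi x (d1%:E * (L^-1%:E * `|f x|))%E.
        rewrite -(fineK (fM x Mx))/= /g /l; congr (psi x _).
        by rewrite invfM invrK mulrA (mulrC d1).
      apply: (le_trans e2); apply: lee_wpmul2l; first by rewrite lee_fin mulr_ge0 ?ltW.
      exact: e1.
  rewrite ge0_integralZl_EFin; last 4 first.
  - by [].
  - move=> x _; apply: adde_ge0; last by rewrite lee_fin.
    by apply: (phi_ext_ge0 phiP); exact: abse_ge0.
  - by apply: emeasurable_funD; [exact: mphif|exact: mhE].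
  - by rewrite mulr_ge0 ?ltW.
  rewrite ge0_integralD; last 5 first.
  - by [].
  - by move=> x _; apply: (phi_ext_ge0 phiP); exact: abse_ge0.
  - exact: mphif.
  - by move=> x _; rewrite lee_fin.
  - exact: mhE.
  rewrite Hh; apply: (@le_trans _ _ ((Ds * d1)%:E * (1 + H)%:E)%E).
    apply: lee_wpmul2l; first by rewrite lee_fin mulr_ge0 ?ltW.
    by rewrite EFinD; apply: leeD2r.
  rewrite -EFinM lee_fin /d1 le_eqVlt; apply/orP/or_introl/eqP.
  by field; rewrite !gt_eqF.
have mainf := main g mg g0 intg.
have q0 x : (0 <= qmax (EFin \o g) x)%E.
  by apply: qmax_ge0 => // y; rewrite lee_fin.
have cq0 x : (0 <= c%:E * qmax (EFin \o g) x)%E.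
  by apply: mule_ge0; [rewrite lee_fin ltW|exact: q0].
have mcq : measurable_fun setT (fun x => phi_ext psi x (c%:E * qmax (EFin \o g) x)%E).
  have mq : measurable_fun setT (fun x => c%:E * qmax (EFin \o g) x)%E.
    by apply: measurable_funeM; exact: measurable_qmax.
  have := measurable_phi_ext psiP mq; congr (measurable_fun _ _).
  by apply/funext => x; rewrite gee0_abs.
apply: (@le_trans _ _ (\int[mu]_x ((Dp * d2)%:E *
    (phi_ext psi x (c%:E * qmax (EFin \o g) x) + `|h x|%:E)))%E).
  apply: ae_ge0_le_integralT.
  - exact: lebesgue_Rn_complete.
  - by apply: measurable_funeM; apply: emeasurable_funD; [exact: mcq|exact: mhE].
  - by move=> x; apply: (phi_ext_ge0 phiP); exact: abse_ge0.
  - move=> x; apply: mule_ge0; first by rewrite lee_fin mulr_ge0 ?ltW.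
    apply: adde_ge0; last by rewrite lee_fin.
    by apply: (phi_ext_ge0 psiP); exact: cq0.
  - apply/ae_exE; exists N; split; [exact: mN|exact: N0|move=> x Nx].
    have e1 := @phi_ext_equiv R n psi phi L (Num.norm \o h) x L0 (eqv2 x Nx) _ (cq0 x).
    have d2i : 0 < d2 <= 1 by rewrite d20.
    have Lq0 : (0 <= L^-1%:E * (c%:E * qmax (EFin \o g) x))%E.
      by apply: mule_ge0; [rewrite lee_fin invr_ge0 ltW|exact: cq0].
    have e2 := phi_ext_contract phiP (dphi x) Dp1 d2i Lq0.
    apply: (@le_trans _ _ (phi_ext phi x (d2%:E * (L^-1%:E * (c%:E * qmax (EFin \o g) x))))%E).
      have HL0 := HL_ge0 f x.
      have Ki0 : (0 <= K^-1%:E)%E by rewrite lee_fin invr_ge0 ltW.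
      rewrite gee0_abs; last by apply: mule_ge0; [exact: HL0|exact: Ki0].
      apply: (phi_ext_le phiP); first by apply: mule_ge0; [exact: HL0|exact: Ki0].
      rewrite muleC lee_pdivrMl//.
      apply: (le_trans (maximal_le_qmax n0 x mf)).
      have fg : {ae mu, forall y, `|f y| = (l * g y)%:E}%E.
        apply: filterS ffin => y yfin; rewrite /g mulrA divff ?gt_eqF// mul1r.
        by rewrite -{1}(fineK yfin).
      have M0' : (0 <= (@maximal_constant R n)%:E)%E by rewrite lee_fin ltW.
      apply: (@le_trans _ _ ((@maximal_constant R n)%:E * (l%:E * qmax (EFin \o g) x))%E).
        apply: lee_wpmul2l; first exact: M0'.
        exact: (qmax_scale n0 x mf mg g0 l0 fg).
      rewrite !muleA -!EFinM; apply: lee_wpmul2r; first exact: q0.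
      rewrite lee_fin /K le_eqVlt; apply/orP/or_introl/eqP.
      by field; rewrite !gt_eqF.
    apply: (le_trans e2); apply: lee_wpmul2l; first by rewrite lee_fin mulr_ge0 ?ltW.
    exact: e1.
rewrite ge0_integralZl_EFin; last 4 first.
- by [].
- move=> x _; apply: adde_ge0; last by rewrite lee_fin.
  by apply: (phi_ext_ge0 psiP); exact: cq0.
- by apply: emeasurable_funD; [exact: mcq|exact: mhE].
- by rewrite mulr_ge0 ?ltW.
rewrite ge0_integralD; last 5 first.
- by [].
- by move=> x _; apply: (phi_ext_ge0 psiP); exact: cq0.
- exact: mcq.
- by move=> x _; rewrite lee_fin.
- exact: mhE.
rewrite Hh; apply: (@le_trans _ _ ((Dp * d2)%:E * (1 + (C + H))%:E)%E).
  apply: lee_wpmul2l; first by rewrite lee_fin mulr_ge0 ?ltW.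
  apply: (@le_trans _ _ (C%:E + H%:E)%E); first exact: leeD2r.
  by rewrite -EFinD lee_fin lerDr.
rewrite -EFinM lee_fin /d2 le_eqVlt; apply/orP/or_introl/eqP.
by field; rewrite !gt_eqF.
Qed.

End sufficiency.

(** * From the boundedness of the maximal operator to (aInc) *)

Section step_functions.
Context d (T : measurableType d) (R : realType) (mu : {measure set T -> \bar R}).
Variables (A : nat -> set T) (J : nat).
Hypotheses (mA : forall j, measurable (A j)) (tA : trivIset setT A).

Definition step (m : nat -> R) (y : T) : R := \sum_(j < J) m j * \1_(A j) y.

Lemma measurable_step m : measurable_fun setT (step m).
Proof.
by apply: measurable_sum => j; apply: measurable_funM.
Qed.

Lemma stepE m i y : (i < J)%N -> A i y -> step m y = m i.
Proof.
move=> iJ Ay; rewrite /step (bigD1 (Ordinal iJ))//= indicE mem_set// mulr1.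
rewrite big1 ?addr0// => j ji; rewrite indicE memNset ?mulr0// => Aj.
have := tA I I (ex_intro _ y (conj Aj Ay)) => ij.
by move: ji; rewrite -val_eqE/= ij eqxx.
Qed.

Lemma step_ge0 m y : (forall j, 0 <= m j) -> 0 <= step m y.
Proof. by move=> m0; apply: sumr_ge0 => j _; rewrite mulr_ge0// indicE. Qed.

Lemma stepN m y : (forall j, (j < J)%N -> ~ A j y) -> step m y = 0.
Proof.
by move=> Ny; rewrite /step big1// => j _; rewrite indicE memNset ?mulr0//; exact: Ny.
Qed.

Lemma sum_measure_le (tau : nat -> R) (F : T -> \bar R) :
  (forall j, 0 <= tau j) -> (forall y, 0 <= F y)%E -> measurable_fun setT F ->
  {ae mu, forall y, forall j, (j < J)%N -> A j y -> ((tau j)%:E <= F y)%E} ->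
  (\sum_(j < J) (tau j)%:E * mu (A j) <= \int[mu]_y F y)%E.
Proof.
move=> tau0 F0 mF tauF.
have mst j : measurable_fun setT (fun y : T => (tau j * \1_(A j) y)%:E).
  by apply/measurable_EFinP; apply: measurable_funM => //; exact: measurable_indic.
have -> : (\sum_(j < J) (tau j)%:E * mu (A j) = \int[mu]_y (step tau y)%:E)%E.
  under [in RHS]eq_integral do rewrite /step -sumEFin.
  rewrite ge0_integral_sum//; last first.
    by move=> j y _; rewrite lee_fin mulr_ge0// indicE.
  apply: eq_bigr => j _; under eq_integral do rewrite EFinM.
  rewrite ge0_integralZl_EFin//.
  - by rewrite integral_indic// setIT.
  - by apply/measurable_EFinP; exact: measurable_indic.
apply: ae_ge0_le_integral => //.
- by move=> y _; rewrite lee_fin step_ge0.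
- by apply/measurable_EFinP; exact: measurable_step.
- apply: filterS tauF => y H _.
  have [[j jJ Aj]|N] := pselect (exists2 j, (j < J)%N & A j y).
    by rewrite (stepE _ jJ Aj); exact: H.
  by rewrite stepN// => j jJ Aj; apply: N; exists j.
Qed.

Lemma measurable_scaled_indic (u : R) (B : set T) : measurable B ->
  measurable_fun setT (fun y : T => (u * \1_B y)%:E).
Proof. by move=> mB; apply/measurable_EFinP; apply: measurable_funM. Qed.

End step_functions.

Section testing.
Context {R : realType} {n : nat} (n0 : (0 < n)%N).
Local Notation E := (Rn R n).
Local Notation mu := (@lebesgue_Rn R n).
Variables (phi : E -> R -> \bar R) (phiP : weak_Phi phi).

(** The norm of Mf is then less than K, so that dividing by some number below K
    already makes the modular at most 1. *)
Lemma modular_of_bounded : maximal_bounded phi ->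
  exists2 K : R, 0 < K & forall f : E -> \bar R, measurable_fun setT f ->
    (modular phi f <= 1)%E ->
    (modular phi (fun x => HL_maximal_Rn f x * K^-1%:E) <= 1)%E.
Proof.
move=> [K0 HK]; pose K1 := Num.max K0 1.
have K11 : 1 <= K1 by rewrite le_max lexx orbT.
have K10 : 0 < K1 := lt_le_trans ltr01 K11.
exists (2 * K1); first by rewrite mulr_gt0.
move=> f mf f1.
have norm0 : (0 <= Lphi_norm phi f)%E.
  by apply: le_ereal_inf_tmp => _ [l [l0 _] <-]; rewrite lee_fin ltW.
have norm1 : (Lphi_norm phi f <= 1)%E.
  apply: ereal_inf_lbound; exists 1 => //; split; first exact: ltr01.
  have -> : (fun x => f x * (1^-1)%:E)%E = f by apply/funext => x; rewrite invr1 mule1.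
  exact: f1.
have : (Lphi_norm phi (HL_maximal_Rn f) < (2 * K1)%:E)%E.
  apply: (@le_lt_trans _ _ (K1%:E)); last by rewrite lte_fin ltr_pMl// ltr1n.
  apply: le_trans (HK f _) _.
    split; first exact: mf.
    exists 1; first exact: ltr01.
    have -> : (fun x => 1%:E * f x)%E = f by apply/funext => x; rewrite mul1e.
    exact: le_lt_trans f1 (ltry 1).
  apply: (@le_trans _ _ (K1%:E * Lphi_norm phi f)%E).
    by apply: lee_wpmul2r; [exact: norm0|rewrite lee_fin le_max lexx].
  by rewrite -[leRHS]mule1; apply: lee_wpmul2l; [rewrite lee_fin ltW|exact: norm1].
move=> /ereal_inf_lt[_ [l [l0 fl] <-]]; rewrite lte_fin => lK.
apply: le_trans fl; apply: ge0_le_integralT => x.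
  by apply: (phi_ext_ge0 phiP); exact: abse_ge0.
apply: (phi_ext_le phiP); first exact: abse_ge0.
rewrite !abseM; apply: lee_wpmul2l; first exact: abse_ge0.
rewrite !gee0_abs ?lee_fin ?invr_ge0 ?(ltW l0) ?mulr_ge0 ?(ltW K10)//.
by rewrite lef_pV2 ?posrE ?(ltW lK)// mulr_gt0.
Qed.

(* The ratio rho is so large that an annulus has at least half of the lower bound
   for the volume of its outer ball. *)
Variables (K rho : R) (K0 : 0 < K) (rho1 : 1 <= rho).
Hypothesis rhoP : 2 * 2 ^+ n <= @ballc R n * rho ^+ n.
Hypothesis HK : forall f : E -> \bar R, measurable_fun setT f ->
  (modular phi f <= 1)%E ->
  (modular phi (fun x => HL_maximal_Rn f x * K^-1%:E) <= 1)%E.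

Definition annulus (c : E) (delta : R) (j : nat) : set E :=
  eball c (rho ^+ j.+1 * delta) `\` eball c (rho ^+ j * delta).

Let rho0 : 0 < rho. Proof. exact: lt_le_trans ltr01 rho1. Qed.

Lemma measurable_annulus c delta j : measurable (annulus c delta j).
Proof. by apply: measurableD; exact: measurable_eball. Qed.

Lemma trivIset_annulus c delta : 0 < delta -> trivIset setT (annulus c delta).
Proof.
move=> d0.
have H i j y : (i < j)%N -> annulus c delta i y -> annulus c delta j y -> False.
  move=> ij [yi _] [_]; apply; apply: (lt_le_trans yi).
  by rewrite ler_pM2r// ler_weXn2l.
move=> i j _ _ [y [yi yj]]; have [ij|ji|//] := ltngtP i j.
  by have := H i j y ij yi yj.
by have := H j i y ji yj yi.
Qed.

Lemma annulus_ge c delta j : 0 < delta ->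
  ((@ballc R n / 2 * (rho ^+ j.+1 * delta) ^+ n)%:E <= mu (annulus c delta j))%E.
Proof.
move=> d0; have r0 i : 0 < rho ^+ i * delta by rewrite mulr_gt0// exprn_gt0.
have sub : eball c (rho ^+ j * delta) `<=` eball c (rho ^+ j.+1 * delta).
  by move=> y /lt_le_trans; apply; rewrite ler_pM2r// ler_weXn2l.
have -> : mu (annulus c delta j) =
    (vol c (rho ^+ j.+1 * delta) - vol c (rho ^+ j * delta))%:E.
  rewrite EFinB -!volE// -(setIidr sub).
  apply: measureD; [exact: measurable_eball|exact: measurable_eball|].
  by rewrite -ge0_fin_numE//; exact: eball_fin.
rewrite lee_fin lerBrDr.
apply: (@le_trans _ _ (@ballc R n * (rho ^+ j.+1 * delta) ^+ n)); last exact: vol_ge.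
apply: (le_trans (lerD (lexx _) (vol_le c (r0 j)))).
rewrite -lerBrDl -mulrBl (_ : @ballc R n - @ballc R n / 2 = @ballc R n / 2); last by lra.
rewrite (exprS rho) -mulrA [leLHS]exprMn [(rho * _) ^+ n]exprMn [leRHS]mulrA.
apply: ler_wpM2r; first by rewrite exprn_ge0// ltW.
by rewrite mulrAC ler_pdivlMr// mulrC.
Qed.

Definition test_scale : R := @ballc R n / 2 ^+ n / K.

Lemma test_scale_gt0 : 0 < test_scale.
Proof. by rewrite divr_gt0// divr_gt0 ?ballc_gt0// exprn_gt0. Qed.

(** The maximal function of a multiple u of the indicator of a small ball is of
    order u / rho^(jn) on the j-th annulus around it. The annuli enter with
    their volumes: this is how a divergent sum will arise for functions of
    linear growth. *)
Lemma testing (c : E) (u delta : R) (J : nat) (tau : nat -> R) (h : E -> R) (N : set E) :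
  0 < u -> 0 < delta ->
  (modular phi (fun y => (u * \1_(eball c delta) y)%:E) <= 1)%E ->
  (forall j, 0 <= tau j) -> measurable_fun setT h -> (forall y, 0 <= h y) ->
  measurable N -> mu N = 0%E ->
  (forall y j, ~ N y -> (j < J)%N -> annulus c delta j y ->
    ((tau j)%:E <= phi y (test_scale * u / (rho ^+ n) ^+ j.+1)%R + (h y)%:E)%E) ->
  ((\sum_(j < J) tau j * (@ballc R n / 2 * (rho ^+ j.+1 * delta) ^+ n))%:E <=
     1 + \int[mu]_y (h y)%:E)%E.
Proof.
move=> u0 d0 fmod tau0 mh h0 mN N0 tauphi.
pose A := annulus c delta; pose m j := test_scale * u / (rho ^+ n) ^+ j.+1.
have tA : trivIset setT A := trivIset_annulus d0.
have mA j : measurable (A j) := measurable_annulus c delta j.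
have m0 j : 0 <= m j.
  apply: divr_ge0; first by rewrite mulr_ge0 ?(ltW test_scale_gt0) ?(ltW u0).
  by apply: exprn_ge0; apply: exprn_ge0; exact: ltW.
pose w := step A J m.
have mw : measurable_fun setT w by exact: measurable_step.
have w0 y : 0 <= w y by exact: step_ge0.
have mphiw : measurable_fun setT (fun y => phi y (w y)).
  have := measurable_Phi phiP mw; congr (measurable_fun _ _).
  by apply/funext => y; rewrite ger0_norm.
pose f (y : E) : \bar R := (u * \1_(eball c delta) y)%:E.
have mf : measurable_fun setT f.
  exact: measurable_scaled_indic (measurable_eball c delta).
have r0 i : 0 < rho ^+ i * delta by rewrite mulr_gt0// exprn_gt0.
have HLf y j : A j y -> ((m j)%:E <= HL_maximal_Rn f y * K^-1%:E)%E.
  move=> [yj _]; rewrite lee_pdivlMr//.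
  apply: (@le_trans _ _ ((mu (eball c (rho ^+ j.+1 * delta)))^-1 *
     \int[mu]_(z in eball c (rho ^+ j.+1 * delta)) `|f z|)%E); last first.
    apply: ereal_sup_ubound; exists (eball c (rho ^+ j.+1 * delta)) => //; split.
      exact: euclidean_ball_eball.
    exact: yj.
  have sub : eball c delta `<=` eball c (rho ^+ j.+1 * delta).
    move=> z /lt_le_trans; apply; rewrite ler_peMl ?(ltW d0)//; exact: exprn_ege1.
  have -> : (\int[mu]_(z in eball c (rho ^+ j.+1 * delta)) `|f z| =
      u%:E * (vol c delta)%:E)%E.
    rewrite (eq_integral (fun z => u%:E * (\1_(eball c delta) z)%:E)%E); last first.
      move=> z _; have z0 : 0 <= u * \1_(eball c delta) z.
        by apply: mulr_ge0; [exact: ltW|rewrite indicE].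
      by rewrite /f gee0_abs ?lee_fin// EFinM.
    rewrite ge0_integralZl_EFin; last 4 first.
    - exact: measurable_eball.
    - by move=> z _; rewrite lee_fin indicE.
    - by apply/measurable_EFinP; apply: measurable_indic; exact: measurable_eball.
    - exact: ltW.
    rewrite integral_indic; [|exact: measurable_eball|exact: measurable_eball].
    by rewrite setIidl// volE.
  have vr : 0 < vol c (rho ^+ j.+1 * delta) := vol_gt0 n0 c (r0 j.+1).
  rewrite volE// inver gt_eqF// -!EFinM lee_fin ler_pdivlMl//.
  apply: (@le_trans _ _ (((2 * (rho ^+ j.+1 * delta)) ^+ n) * (m j * K))).
    by apply: ler_wpM2r; [rewrite mulr_ge0// ltW|exact: vol_le].
  rewrite (_ : _ * _ = u * (@ballc R n * delta ^+ n)).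
    by rewrite ler_pM2l//; exact: vol_ge.
  rewrite /m /test_scale !exprMn -!exprM (mulnC j.+1 n); field.
  by rewrite !expf_neq0 ?gt_eqF.
have intw : (\int[mu]_y phi y (w y) <= 1)%E.
  apply: le_trans (HK mf fmod); apply: ge0_le_integralT => y; first exact: Phi_ge0.
  rewrite gee0_abs; last first.
    by apply: mule_ge0; [exact: HL_ge0|rewrite lee_fin invr_ge0 ltW].
  rewrite -[leLHS]/(phi_ext phi y (w y)%:E); apply: (phi_ext_le phiP).
    by rewrite lee_fin.
  have [[j jJ Aj]|NA] := pselect (exists2 j, (j < J)%N & A j y).
    by rewrite /w (stepE tA _ jJ Aj); exact: HLf.
  rewrite /w stepN//; last by move=> j jJ Aj; apply: NA; exists j.
  by apply: mule_ge0; [exact: HL_ge0|rewrite lee_fin invr_ge0 ltW].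
have mF : measurable_fun setT (fun y => phi y (w y) + (h y)%:E)%E.
  by apply: emeasurable_funD; [exact: mphiw|exact/measurable_EFinP].
have key : (\sum_(j < J) (tau j)%:E * mu (A j) <= \int[mu]_y (phi y (w y) + (h y)%:E))%E.
  apply: sum_measure_le => //.
  - by move=> y; apply: adde_ge0; [exact: Phi_ge0|rewrite lee_fin].
  - apply/ae_exE; exists N; split; [exact: mN|exact: N0|move=> y Ny j jJ Aj].
    by rewrite /w (stepE tA _ jJ Aj); exact: tauphi.
apply: (@le_trans _ _ (\sum_(j < J) (tau j)%:E * mu (A j))%E).
  rewrite -sumEFin; apply: lee_sum => j _; rewrite EFinM; apply: lee_wpmul2l.
    by rewrite lee_fin.
  exact: annulus_ge.
apply: (le_trans key); rewrite ge0_integralD; last 5 first.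
- by [].
- by move=> y _; exact: Phi_ge0.
- exact: mphiw.
- by move=> y _; rewrite lee_fin.
- exact/measurable_EFinP.
exact: leeD2r.
Qed.

End testing.

Section growth.
Context {R : realType} {n : nat} (n0 : (0 < n)%N).
Local Notation E := (Rn R n).
Local Notation mu := (@lebesgue_Rn R n).

Lemma exists_radius (V : R) : 0 < V -> exists2 d : R, 0 < d & (4 * d) ^+ n = V^-1.
Proof.
move=> V0; have Vi : 0 < V^-1 by rewrite invr_gt0.
exists (V^-1 `^ n%:R^-1 / 4); first by rewrite divr_gt0// powR_gt0.
rewrite mulrC divfK//.
rewrite -powR_mulrn ?powR_ge0// -powRrM mulVf ?powRr1 ?(ltW Vi)//.
by rewrite pnatr_eq0 -lt0n.
Qed.

Section one_function.
Variables (phi : E -> R -> \bar R) (phiP : weak_Phi phi).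

Lemma modular_indic_le (B N : set E) (u : R) (g : E -> \bar R) :
  measurable B -> measurable N -> mu N = 0%E -> 0 <= u ->
  measurable_fun setT g -> (forall y, 0 <= g y)%E ->
  (forall y, ~ N y -> B y -> (phi y u <= g y)%E) ->
  (modular phi (fun y => (u * \1_B y)%:E) <= \int[mu]_(y in B) g y)%E.
Proof.
move=> mB mN N0 u0 mg g0 H; rewrite [leRHS]integral_mkcond.
apply: ae_ge0_le_integralT.
- exact: lebesgue_Rn_complete.
- by apply/(measurable_restrictT _ mB).1; exact: measurable_funTS.
- by move=> y; apply: (phi_ext_ge0 phiP); exact: abse_ge0.
- by move=> y; rewrite patchE; case: ifP => // _.
- apply/ae_exE; exists N; split; [exact: mN|exact: N0|move=> y Ny].
  rewrite /= patchE indicE; case: ifPn => [yB|yB].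
    by rewrite mulr1 ger0_norm//; apply: H => //; exact/set_mem.
  by rewrite mulr0 normr0 (Phi_0 phiP).
Qed.

Variables (K rho L : R) (K0 : 0 < K) (rho1 : 1 <= rho) (L1 : 1 <= L).
Hypothesis rhoP : 2 * 2 ^+ n <= @ballc R n * rho ^+ n.
Hypothesis HK : forall f : E -> \bar R, measurable_fun setT f ->
  (modular phi f <= 1)%E ->
  (modular phi (fun x => HL_maximal_Rn f x * K^-1%:E) <= 1)%E.
Hypothesis dilphi : forall x, dilates 1 L (phi x).

Let rho0 : 0 < rho. Proof. exact: lt_le_trans ltr01 rho1. Qed.
Let L0 : 0 < L. Proof. exact: lt_le_trans ltr01 L1. Qed.

(** All the annuli contribute equally: the volumes compensate the decay of the
    values. *)
Lemma annuli_sum (J : nat) (P c1 k V delta : R) : 0 < V ->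
  (4 * delta) ^+ n = (2 * V)^-1 ->
  \sum_(j < J) P * (c1 * k / (rho ^+ n) ^+ j.+1) / L *
     (@ballc R n / 2 * (rho ^+ j.+1 * delta) ^+ n) =
  J%:R * (@ballc R n * c1 / (4 ^+ n.+1 * L)) * (k * P / V).
Proof.
move=> V0 dE.
have dE' : delta ^+ n = (2 * V * 4 ^+ n)^-1.
  by rewrite invfM -dE exprMn mulrC mulKf// expf_neq0// pnatr_eq0.
rewrite (eq_bigr (fun=> @ballc R n * c1 / (4 ^+ n.+1 * L) * (k * P / V))).
  by rewrite sumr_const card_ord -[LHS]mulr_natl mulrA.
move=> j _; rewrite exprMn -(exprM rho j.+1) (mulnC j.+1) exprM dE' (exprS 4).
by field; rewrite ?expf_neq0 ?gt_eqF ?pnatr_eq0.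
Qed.

(** Test with a multiple of k t on the ball around x of volume about
    1 / phi(x, k t): by (A1) the density there is at most comparable to phi(x, k t).
    Between t and k t there is room for J annuli if k is large, and each contributes
    a fixed multiple of k phi(x, t) / phi(x, k t). The requirement phi(x, t) >= L
    keeps all the values in the range of (A1). *)
Lemma growth_large (b : R) (N : set E) : 0 < b -> b < 1 ->
  measurable N -> mu N = 0%E ->
  (forall x y : E, ~ N x -> ~ N y ->
    forall r tau s t : R, eucl_dist x y < r -> 1 <= tau -> tau * (4 * r) ^+ n <= 1 ->
    0 <= s -> s < b * t -> (tau%:E <= phi x s)%E -> (tau%:E <= phi y t)%E) ->
  exists2 k0 : R, 1 <= k0 & forall k x t, k0 <= k -> ~ N x -> 0 < t ->
    (L%:E <= phi x t)%E -> ((2 * k)%:E * phi x t <= phi x (k * t)%R)%E.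
Proof.
move=> b0 b1 mN N0 A1h.
pose c0 := @test_scale R n K; have c00 : 0 < c0 := test_scale_gt0 n0 K0.
pose c1 := Num.min 1 (b ^+ 2 * c0 / 4).
have c10 : 0 < c1 by rewrite lt_min ltr01/= divr_gt0// mulr_gt0// exprn_gt0.
have c11 : c1 <= 1 by rewrite ge_min lexx.
have c1b : c1 <= b ^+ 2 * c0 / 4 by rewrite ge_min lexx orbT.
pose c2 := @ballc R n * c1 / (4 ^+ n.+1 * L).
have B0 : 0 < @ballc R n := ballc_gt0 n0.
have c20 : 0 < c2 by rewrite divr_gt0 ?mulr_gt0// exprn_gt0.
pose J := (Num.truncn (2 / c2)).+1.
have JP : 2 < J%:R * c2 by rewrite -ltr_pdivrMr// truncnS_gt.
have rn1 : 1 <= rho ^+ n by exact: exprn_ege1.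
have rn0 : 0 < rho ^+ n := lt_le_trans ltr01 rn1.
exists (Num.max 1 ((rho ^+ n) ^+ J / c1)); first by rewrite le_max lexx.
move=> k x t; rewrite ge_max => /andP[k1 kJ] Nx t0 Lphi.
have k0 : 0 < k := lt_le_trans ltr01 k1.
have kt0 : 0 < k * t by rewrite mulr_gt0.
have tkt : t <= k * t by rewrite ler_peMl// ltW.
have phi_le := Phi_le phiP x (ltW t0) tkt.
case VE : (phi x (k * t)) phi_le => [V||] phi_le; last 2 first.
- by rewrite leey.
- by have := Phi_ge0 phiP x (ltW kt0); rewrite VE.
case PE : (phi x t) Lphi phi_le => [P||]//.
rewrite lee_fin lee_fin => LP PV.
have P0 : 0 < P := lt_le_trans L0 LP.
have V0 : 0 < V := lt_le_trans P0 PV.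
have kPV : k * P <= L * V.
  have := dilphi x k1 t0; rewrite powRr1 ?(ltW k0)// PE VE -!EFinM lee_fin.
  exact.
have V1 : 1 <= V := le_trans L1 (le_trans LP PV).
have V20 : 0 < 2 * V by rewrite mulr_gt0.
have [d d0 dE] := exists_radius V20.
pose u := b / 2 * (k * t); have u0 : 0 < u by rewrite mulr_gt0// divr_gt0.
have fmod : (modular phi (fun y => (u * \1_(eball x d) y)%:E) <= 1)%E.
  apply: (le_trans (@modular_indic_le _ N u (fun=> (2 * V)%:E) _ _ _ _ _ _ _)).
  - exact: measurable_eball.
  - exact: mN.
  - exact: N0.
  - exact: ltW.
  - exact: measurable_cst.
  - by move=> y; rewrite lee_fin ltW.
  - move=> y Ny yd; rewrite leNgt; apply/negP => /ltW Vy.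
    have : ((2 * V)%:E <= phi x (k * t)%R)%E.
      apply: (A1h y x Ny Nx d _ u) => //.
      + by rewrite eucl_dist_sym.
      + by rewrite (le_trans V1)// ler_peMl ?ler1n// ltW.
      + by rewrite dE divff// gt_eqF.
      + exact: ltW.
      + by rewrite /u ltr_pM2r// ltr_pdivrMr// ltr_pMr// ltr1n.
    by rewrite VE lee_fin leNgt ltr_pMl// ltr1n.
  - rewrite integral_cst; last exact: measurable_eball.
    rewrite volE// -EFinM lee_fin.
    apply: (@le_trans _ _ (2 * V * (4 * d) ^+ n)); last by rewrite dE divff ?gt_eqF.
    rewrite ler_pM2l//; apply: (le_trans (vol_le x d0)).
    by rewrite ler_pXn2r// ?nnegrE ?mulr_ge0 ?(ltW d0)// ler_pM2r// ler_nat.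
pose q j := c1 * k / (rho ^+ n) ^+ j.+1.
have q1 j : (j < J)%N -> 1 <= q j.
  move=> jJ; rewrite ler_pdivlMr ?exprn_gt0// mul1r.
  apply: (@le_trans _ _ ((rho ^+ n) ^+ J)); first by rewrite ler_weXn2l.
  by rewrite mulrC -ler_pdivrMr.
have q0 j : 0 < q j by rewrite divr_gt0 ?mulr_gt0 ?exprn_gt0.
pose tau j := P * q j / L.
have tau0 j : 0 <= tau j by apply: divr_ge0; [apply: mulr_ge0; exact: ltW|exact: ltW].
have taux j : (j < J)%N -> ((tau j)%:E <= phi x (q j * t)%R)%E.
  move=> jJ; have := dilphi x (q1 j jJ) t0.
  rewrite powRr1 ?(ltW (q0 j))// PE -EFinM /tau => H.
  rewrite -(@lee_pmul2l _ L%:E)// ?lte_fin//; apply: le_trans H.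
  by rewrite -EFinM lee_fin mulrC divfK ?gt_eqF// mulrC.
have := @testing R n n0 phi phiP K rho K0 rho1 rhoP HK x u d J tau (cst 0) N u0 d0 fmod
  tau0 (measurable_cst _) (fun=> lexx _) mN N0.
have -> : (1 + \int[mu]_y (cst 0 y)%:E = 1%:E)%E by rewrite integral0 adde0.
move=> H; have {}H : \sum_(j < J) tau j * (@ballc R n / 2 * (rho ^+ j.+1 * d) ^+ n) <= 1.
  rewrite -lee_fin; apply: H => y j Ny jJ [yj _]; rewrite adde0.
  apply: (A1h x y Nx Ny (rho ^+ j.+1 * d) _ (q j * t)).
  - exact: yj.
  - rewrite /tau ler_pdivlMr// mul1r (le_trans LP)// ler_peMr ?(ltW P0)//.
    exact: q1.
  - have -> : tau j * (4 * (rho ^+ j.+1 * d)) ^+ n = c1 * (k * P / (2 * (L * V))).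
      rewrite mulrCA exprMn dE -exprM mulnC exprM /tau /q; field.
      by rewrite !gt_eqF ?exprn_gt0.
    have LV0 : 0 < L * V by rewrite mulr_gt0.
    apply: mulr_ile1; [exact: ltW| |exact: c11|].
      by rewrite divr_ge0 ?mulr_ge0 ?(ltW k0) ?(ltW P0) ?(ltW L0) ?(ltW V0).
    by rewrite ler_pdivrMr ?mulr_gt0// mul1r (le_trans kPV)// ler_peMl ?ler1n// ltW.
  - by rewrite mulr_ge0 ?ltW.
  - rewrite -/c0.
    have -> : b * (c0 * u / (rho ^+ n) ^+ j.+1) = 2 * (b ^+ 2 * c0 / 4) * k / (rho ^+ n) ^+ j.+1 * t.
      by rewrite /u; field; rewrite gt_eqF// exprn_gt0.
    rewrite ltr_pM2r// /q ltr_pM2r ?invr_gt0 ?exprn_gt0// ltr_pM2r//.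
    apply: (le_lt_trans c1b); rewrite ltr_pMl ?ltr1n//.
    exact: lt_le_trans c1b.
  - exact: taux.
rewrite (@annuli_sum J P c1 k V d V0 dE) in H.
rewrite -EFinM lee_fin leNgt; apply/negP => VkP.
move: H; rewrite leNgt => /negP; apply.
have kP0 : 0 < k * P by rewrite mulr_gt0.
rewrite -/c2 mulrA ltr_pdivlMr// mul1r; apply: (lt_trans VkP).
by rewrite -(mulrA 2) ltr_pM2r.
Qed.

(** The same argument with a ball of volume about 1 / phioo(k t), anywhere in the
    space. The error h of (A2) adds its integral to both modulars, so the test
    function is shrunk and more annuli are used. *)
Lemma growth_small (phioo : R -> \bar R) (h : E -> R) (b s : R) (N : set E) :
  weak_Phi (fun _ : E => phioo) -> 0 < b -> dilates 1 L phioo ->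
  measurable_fun setT h -> (forall x, 0 <= h x) -> (\int[mu]_x (h x)%:E < +oo)%E ->
  measurable N -> mu N = 0%E ->
  (forall x, ~ N x -> forall t : R, 0 <= t ->
     (phioo t <= s%:E)%E -> (phi x (b * t)%R <= phioo t + (h x)%:E)%E) ->
  (forall x, ~ N x -> forall t : R, 0 <= t ->
     (phioo (b * t)%R <= s%:E)%E -> (phioo (b * t)%R <= phi x t + (h x)%:E)%E) ->
  exists2 k0 : R, 1 <= k0 & forall k t, k0 <= k -> 0 < t ->
    (phioo (k * t)%R <= s%:E)%E -> ((2 * k)%:E * phioo t <= phioo (k * t)%R)%E.
Proof.
move=> phiooP b0 diloo mh h0 ih mN N0 A2a A2b.
have oo_ge0 t : 0 <= t -> (0 <= phioo t)%E by exact: (@Phi_ge0 _ _ _ phiooP point).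
have oo_le v w : 0 <= v -> v <= w -> (phioo v <= phioo w)%E.
  exact: (@Phi_le _ _ _ phiooP point).
have [H Hh] : exists H, (\int[mu]_x (h x)%:E)%E = H%:E.
  exists (fine (\int[mu]_x (h x)%:E)%E); rewrite fineK// ge0_fin_numE//.
  by apply: integral_ge0 => x _; rewrite lee_fin.
have H_ge0 : 0 <= H.
  by rewrite -lee_fin -Hh; apply: integral_ge0 => x _; rewrite lee_fin.
have H10 : 0 < 1 + H by rewrite ltr_wpDr.
pose e := (L * (1 + H))^-1.
have e0 : 0 < e by rewrite invr_gt0 mulr_gt0.
have e1 : e <= 1 by rewrite invf_le1 ?mulr_gt0// mulr_ege1// lerDl.
pose c0 := @test_scale R n K; have c00 : 0 < c0 := test_scale_gt0 n0 K0.
pose c1 := Num.min 1 (b ^+ 2 * e * c0).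
have c10 : 0 < c1 by rewrite lt_min ltr01/= mulr_gt0// mulr_gt0// exprn_gt0.
have c11 : c1 <= 1 by rewrite ge_min lexx.
have c1b : c1 <= b ^+ 2 * e * c0 by rewrite ge_min lexx orbT.
pose c2 := @ballc R n * c1 / (4 ^+ n.+1 * L).
have B0 : 0 < @ballc R n := ballc_gt0 n0.
have c20 : 0 < c2 by rewrite divr_gt0 ?mulr_gt0// exprn_gt0.
pose J := (Num.truncn (2 * (1 + H) / c2)).+1.
have JP : 2 * (1 + H) < J%:R * c2 by rewrite -ltr_pdivrMr// truncnS_gt.
have rn1 : 1 <= rho ^+ n by exact: exprn_ege1.
have rn0 : 0 < rho ^+ n := lt_le_trans ltr01 rn1.
exists (Num.max 1 ((rho ^+ n) ^+ J / c1)); first by rewrite le_max lexx.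
move=> k t; rewrite ge_max => /andP[k1 kJ] t0 phks.
have k0 : 0 < k := lt_le_trans ltr01 k1.
have kt0 : 0 < k * t by rewrite mulr_gt0.
have tkt : t <= k * t by rewrite ler_peMl// ltW.
have phi_le := oo_le _ _ (ltW t0) tkt.
have [V VE] : exists V, phioo (k * t) = V%:E.
  exists (fine (phioo (k * t))); rewrite fineK// ge0_fin_numE ?(oo_ge0 _ (ltW kt0))//.
  by rewrite (le_lt_trans phks)// ltry.
have [P PE] : exists P, phioo t = P%:E.
  exists (fine (phioo t)); rewrite fineK// ge0_fin_numE ?(oo_ge0 _ (ltW t0))//.
  by rewrite (le_lt_trans phi_le)// VE ltry.
have P_ge0 : 0 <= P by rewrite -lee_fin -PE oo_ge0// ltW.
rewrite VE PE lee_fin in phi_le *; rename phi_le into PV.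
move: P_ge0; rewrite le_eqVlt => /predU1P[P0|P0].
  by rewrite -P0 mule0 lee_fin (le_trans _ PV)// -P0.
have V0 : 0 < V := lt_le_trans P0 PV.
have V20 : 0 < 2 * V by rewrite mulr_gt0.
have [d d0 dE] := exists_radius V20.
pose x : E := point.
pose u := e * (b * (k * t)); have u0 : 0 < u by rewrite !mulr_gt0.
have fmod : (modular phi (fun y => (u * \1_(eball x d) y)%:E) <= 1)%E.
  have mg : measurable_fun setT (fun y => V%:E + (h y)%:E)%E.
    by apply: emeasurable_funD; [exact: measurable_cst|exact/measurable_EFinP].
  have g0 y : (0 <= V%:E + (h y)%:E)%E by rewrite -EFinD lee_fin addr_ge0 ?(ltW V0).
  apply: (le_trans (@modular_indic_le _ N u (fun y => (L * e)%:E * (V%:E + (h y)%:E))%E _ _ _ _ _ _ _)).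
  - exact: measurable_eball.
  - exact: mN.
  - exact: N0.
  - exact: ltW.
  - exact: measurable_funeM.
  - by move=> y; apply: mule_ge0; [rewrite lee_fin mulr_ge0 ?ltW|exact: g0].
  - move=> y Ny yd.
    have ei : 0 < e <= 1 by rewrite e0.
    have bkt0 : 0 < b * (k * t) by rewrite mulr_gt0.
    have := dilates_contract (dilphi y) ei bkt0; rewrite powRr1 ?(ltW e0)// => /le_trans; apply.
    apply: lee_wpmul2l; first by rewrite lee_fin mulr_ge0 ?ltW.
    by rewrite -VE; apply: A2a => //; rewrite ?(ltW kt0)// VE.
  - rewrite ge0_integralZl_EFin; last 4 first.
    + exact: measurable_eball.
    + by move=> y _; exact: g0.
    + exact: measurable_funTS.
    + by rewrite mulr_ge0 ?ltW.
    apply: (@le_trans _ _ ((L * e)%:E * (1 + H)%:E)%E); last first.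
      rewrite -EFinM lee_fin /e le_eqVlt; apply/orP/or_introl/eqP.
      by field; rewrite !gt_eqF.
    apply: lee_wpmul2l; first by rewrite lee_fin mulr_ge0 ?ltW.
    rewrite ge0_integralD; last 5 first.
    + exact: measurable_eball.
    + by move=> y _; rewrite lee_fin ltW.
    + exact: measurable_cst.
    + by move=> y _; rewrite lee_fin.
    + by apply: measurable_funTS; exact/measurable_EFinP.
    rewrite EFinD; apply: leeD.
      rewrite integral_cst; last exact: measurable_eball.
      rewrite volE// -EFinM lee_fin.
      apply: (@le_trans _ _ (2 * V * (4 * d) ^+ n)); last by rewrite dE divff ?gt_eqF.
      apply: ler_pM; rewrite ?(ltW V0) ?(ltW (vol_gt0 n0 x d0))//.
        by rewrite ler_peMl ?ler1n// ltW.
      apply: (le_trans (vol_le x d0)).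
      by rewrite ler_pXn2r// ?nnegrE ?mulr_ge0 ?(ltW d0)// ler_pM2r// ler_nat.
    rewrite -Hh; apply: ge0_subset_integral.
    + exact: measurable_eball.
    + by [].
    + exact/measurable_EFinP.
    + by move=> y _; rewrite lee_fin.
    + by [].
pose q j := c1 * k / (rho ^+ n) ^+ j.+1.
have q1 j : (j < J)%N -> 1 <= q j.
  move=> jJ; rewrite ler_pdivlMr ?exprn_gt0// mul1r.
  apply: (@le_trans _ _ ((rho ^+ n) ^+ J)); first by rewrite ler_weXn2l.
  by rewrite mulrC -ler_pdivrMr.
have q0 j : 0 < q j by rewrite divr_gt0 ?mulr_gt0 ?exprn_gt0.
pose tau j := P * q j / L.
have tau0 j : 0 <= tau j by apply: divr_ge0; [apply: mulr_ge0; exact: ltW|exact: ltW].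
have tauoo j : (j < J)%N -> ((tau j)%:E <= phioo (q j * t)%R)%E.
  move=> jJ; have := diloo _ _ (q1 j jJ) t0.
  rewrite powRr1 ?(ltW (q0 j))// PE -EFinM /tau => H1.
  rewrite -(@lee_pmul2l _ L%:E)// ?lte_fin//; apply: le_trans H1.
  by rewrite -EFinM lee_fin mulrC divfK ?gt_eqF// mulrC.
have := @testing R n n0 phi phiP K rho K0 rho1 rhoP HK x u d J tau h N u0 d0 fmod
  tau0 mh h0 mN N0.
rewrite Hh -EFinD.
move=> H1; have {}H1 : \sum_(j < J) tau j * (@ballc R n / 2 * (rho ^+ j.+1 * d) ^+ n) <= 1 + H.
  rewrite -lee_fin; apply: H1 => y j Ny jJ [yj _].
  apply: (le_trans (tauoo j jJ)).
  have qtb : 0 <= q j * t / b 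
    by apply: divr_ge0; [apply: mulr_ge0|]; exact: ltW.
  have bqt : b * (q j * t / b) = q j * t by rewrite mulrC divfK// gt_eqF.
  have qk : q j * t <= k * t.
    rewrite ler_pM2r// /q ler_pdivrMr ?exprn_gt0//.
    rewrite (le_trans (ler_wpM2r (ltW k0) c11))// mul1r ler_peMr ?(ltW k0)//.
    exact: exprn_ege1.
  have qs : (phioo (b * (q j * t / b))%R <= s%:E)%E.
    by rewrite bqt; apply: le_trans phks; apply: oo_le => //; apply: mulr_ge0; exact: ltW.
  have := A2b y Ny _ qtb qs; rewrite bqt => /le_trans; apply; apply: leeD2r.
  apply: (Phi_le phiP) => //; rewrite -/c0.
  have -> : c0 * u / (rho ^+ n) ^+ j.+1 = (b ^+ 2 * e * c0) * k / (rho ^+ n) ^+ j.+1 * t / b.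
    by rewrite /u; field; rewrite !gt_eqF ?exprn_gt0.
  rewrite ler_pM2r ?invr_gt0// ler_pM2r// /q ler_pM2r ?invr_gt0 ?exprn_gt0//.
  by rewrite ler_pM2r.
rewrite (@annuli_sum J P c1 k V d V0 dE) in H1.
rewrite -EFinM lee_fin leNgt; apply/negP => VkP.
move: H1; rewrite leNgt => /negP; apply.
have kP0 : 0 < k * P by rewrite mulr_gt0.
rewrite -/c2 mulrA ltr_pdivlMr//.
apply: (lt_trans (_ : _ < (1 + H) * (2 * k * P))); first by rewrite ltr_pM2l.
have -> : (1 + H) * (2 * k * P) = 2 * (1 + H) * (k * P) by ring.
by rewrite ltr_pM2r.
Qed.

End one_function.

End growth.

Section power_growth.
Context {R : realType}.

(** The exponent with k ^ p = 2 k. *)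
Definition gain_exponent (k : R) : R := ln (2 * k) / ln k.

Lemma powR_gain k : 1 < k -> k `^ gain_exponent k = 2 * k.
Proof.
move=> k1; have k0 : 0 < k := lt_trans ltr01 k1.
rewrite /powR gt_eqF// /gain_exponent divfK; last by rewrite gt_eqF// ln_gt0.
by rewrite lnK// posrE mulr_gt0.
Qed.

Lemma gain_exponent_gt1 k : 1 < k -> 1 < gain_exponent k.
Proof.
move=> k1; have k0 : 0 < k := lt_trans ltr01 k1.
by rewrite /gain_exponent ltr_pdivlMr ?ln_gt0// mul1r ltr_ln ?posrE ?mulr_gt0// ltr_pMl// ltr1n.
Qed.

(** A gain by the factor 2 over linear growth at one scale k iterates to a power
    larger than 1. *)
Lemma power_growth (g : R -> \bar R) (k t u : R) : 2 <= k -> 0 < t -> t <= u ->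
  (forall v w, t <= v -> v <= w -> w <= u -> (0 <= g v <= g w)%E) ->
  (forall v, t <= v -> k * v <= u -> ((2 * k)%:E * g v <= g (k * v)%R)%E) ->
  (((u / t) `^ gain_exponent k)%:E * g t <= (2 * k)%:E * g u)%E.
Proof.
move=> k2 t0 tu; have k1 : 1 < k by rewrite (lt_le_trans _ k2)// ltr1n.
have k0 : 0 < k := lt_trans ltr01 k1.
set p := gain_exponent k; have p1 : 1 < p := gain_exponent_gt1 k1.
have p0 : 0 <= p by rewrite ltW// (lt_trans ltr01).
have [j] : exists j : nat, u < k ^+ j * t.
  exists (Num.truncn (u / t)).+1; rewrite -ltr_pdivrMr//.
  apply: (lt_le_trans (truncnS_gt (u / t))); apply: (@le_trans _ _ (2 ^+ (Num.truncn (u / t)).+1)).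
    by rewrite -natrX ler_nat ltnW// ltn_expl.
  by apply: lerXn2r; rewrite ?nnegrE// ltW.
elim: j t t0 tu => [|j IH] t t0 tu ukt gmono ggain.
  by move: ukt; rewrite expr0 mul1r ltNge tu.
have [ukt1|ktu] := ltP u (k * t).
  have /andP[gt0 gtu] := gmono t u (lexx _) tu (lexx _).
  apply: lee_pmul => //; first by rewrite lee_fin powR_ge0.
  rewrite lee_fin -powR_gain// le_powR//; first by rewrite divr_ge0// ltW// (lt_le_trans t0).
  by rewrite ler_pdivrMr// ltW.
have kt0 : 0 < k * t by rewrite mulr_gt0.
have tkt : t <= k * t by rewrite ler_peMl// ltW.
have := IH (k * t) kt0 ktu; rewrite mulrA -exprSr => /(_ ukt) IH'.
apply: le_trans (IH' _ _); last 2 first.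
- by move=> v w ktv; apply: gmono; exact: le_trans ktv.
- by move=> v ktv; apply: ggain; exact: le_trans ktv.
have -> : u / t = u / (k * t) * k by field; rewrite !gt_eqF.
have ukt0 : 0 <= u / (k * t) by rewrite divr_ge0 ?(ltW kt0)// (le_trans _ tu)// ltW.
rewrite powRM ?(ltW k0)// powR_gain// EFinM -muleA; apply: lee_wpmul2l.
  by rewrite lee_fin powR_ge0.
exact: ggain.
Qed.

End power_growth.

Section piecewise.
Context d (T : measurableType d) (R : realType).

Lemma measurable_piecewise (g : T -> R) (r1 r2 : R) (N : set T) (a b c c' : T -> \bar R) :
  measurable N -> measurable_fun setT g -> measurable_fun setT a ->
  measurable_fun setT b -> measurable_fun setT c -> measurable_fun setT c' ->
  measurable_fun setT (fun x => if g x <= r1 then a x else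
    if g x <= r2 then b x else if x \in N then c x else c' x).
Proof.
move=> mN mg ma mb mc mc'.
have mle r : measurable_fun setT (fun x => g x <= r).
  by apply: measurable_fun_ler.
apply: measurable_fun_ifT => //; apply: measurable_fun_ifT => //.
apply: measurable_fun_ifT => //; apply: (measurable_fun_bool true).
rewrite setTI (_ : _ @^-1` _ = N)//.
by apply/seteqP; split => x /=; [move=> /set_mem|move=> Nx; exact/mem_set].
Qed.

Lemma measurable_scaled_powR (g : T -> R) (a p : R) : measurable_fun setT g ->
  measurable_fun setT (fun x => (a * g x `^ p)%:E).
Proof.
move=> mg; apply/measurable_EFinP; apply: measurable_funM => //.
exact: (measurableT_comp (measurable_powR p) mg).
Qed.

Lemma measurable_scaled_norm (f : T -> R) (a : R) : measurable_fun setT f ->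
  measurable_fun setT (fun x => `|f x| * a).
Proof. by move=> mf; apply: measurable_funM => //; exact: measurableT_comp. Qed.

End piecewise.

Lemma Lfun_zero d (T : measurableType d) (R : realType) (m : {measure set T -> \bar R})
  (q : \bar R) : (1 <= q)%E -> (cst 0 : T -> R) \in Lfun m q.
Proof. by move=> q1; have [] := Lfun_submod_closed m q1. Qed.

Section gluing.
Context {R : realType} {n : nat}.
Local Notation E := (Rn R n).
Local Notation mu := (@lebesgue_Rn R n).
Variables (phi : E -> R -> \bar R) (phioo : R -> \bar R) (N : set E) (p D t0 T s : R).
Hypotheses (phiP : weak_Phi phi) (phiooP : weak_Phi (fun _ : E => phioo)).
Hypotheses (mN : measurable N) (N0 : mu N = 0%E).
Hypotheses (p1 : 1 < p) (D1 : 1 <= D) (t00 : 0 < t0) (t0T : t0 <= T).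
Hypotheses (s0 : 0 < s) (s1 : s < 1) (oot0 : (phioo t0 <= s%:E)%E).
Hypothesis dil_oo : forall t u, 0 < t -> t <= u -> u <= t0 ->
  (((u / t) `^ p)%:E * phioo t <= D%:E * phioo u)%E.
Hypothesis phiT : forall x, ~ N x -> (1 <= phi x T)%E.
Hypothesis dil_phi : forall x, ~ N x -> forall t u, T <= t -> t <= u ->
  (((u / t) `^ p)%:E * phi x t <= D%:E * phi x u)%E.

Let T0 : 0 < T. Proof. exact: lt_le_trans t00 t0T. Qed.
Let p0 : 0 < p. Proof. exact: lt_trans ltr01 p1. Qed.
Let D0 : 0 < D. Proof. exact: lt_le_trans ltr01 D1. Qed.

(** Where phi grows fast enough, it is kept up to a factor; small values are
    replaced by the limit function, so that no error term is left, and a power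
    bridges the gap. On the exceptional null set N a power replaces phi, so that
    the conditions of weak Phi-functions hold at every point. *)
Definition glue_const : R := s / t0 `^ p.
Definition tail_const : R := Num.max 1 (glue_const * T `^ p).
Definition tail (x : E) (t : R) : \bar R :=
  if x \in N then ((t / T) `^ p)%:E else phi x t.
Definition glued (x : E) (t : R) : \bar R :=
  if t <= t0 then phioo t else
  if t <= T then (glue_const * t `^ p)%:E else (tail_const%:E * tail x t)%E.

Let C0 : 0 < glue_const. Proof. by rewrite divr_gt0// powR_gt0. Qed.
Let C'1 : 1 <= tail_const. Proof. by rewrite le_max lexx. Qed.
Let C'0 : 0 < tail_const. Proof. exact: lt_le_trans ltr01 C'1. Qed.

Let oo_ge0 t : 0 <= t -> (0 <= phioo t)%E.
Proof. by move=> t_ge0; exact: (@Phi_ge0 _ _ _ phiooP point). Qed.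

Let oo_le u t : 0 <= u -> u <= t -> (phioo u <= phioo t)%E.
Proof. by move=> u_ge0 ut; exact: (@Phi_le _ _ _ phiooP point). Qed.

Let tail_ge0 x t : 0 <= t -> (0 <= tail x t)%E.
Proof.
by move=> t_ge0; rewrite /tail; case: ifP => _; [rewrite lee_fin powR_ge0|exact: Phi_ge0].
Qed.

Let tail_le x t u : 0 <= t -> t <= u -> (tail x t <= tail x u)%E.
Proof.
move=> t_ge0 tu; rewrite /tail; case: ifP => _; last exact: Phi_le.
rewrite lee_fin le_powR ?(ltW p0)//; first by rewrite divr_ge0// ltW.
by rewrite ler_pM2r ?invr_gt0.
Qed.

Let tail_ge1 x t : T <= t -> (1 <= tail x t)%E.
Proof.
move=> Tt; apply: le_trans (tail_le x (ltW T0) Tt); rewrite /tail.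
case: ifPn => [_|/negP xN]; first by rewrite divff ?gt_eqF// powR1.
by apply: phiT => Nx; apply: xN; exact/mem_set.
Qed.

Let tail_dil x t u : T <= t -> t <= u ->
  (((u / t) `^ p)%:E * tail x t <= D%:E * tail x u)%E.
Proof.
move=> Tt tu; rewrite /tail; case: ifPn => [_|/negP xN]; last first.
  by apply: dil_phi => // Nx; apply: xN; exact/mem_set.
have t_gt0 : 0 < t := lt_le_trans T0 Tt.
rewrite -!EFinM lee_fin -powRM ?divr_ge0 ?(ltW T0) ?(ltW t_gt0)//; last first.
  by rewrite (le_trans (ltW t_gt0)).
rewrite mulrA divfK ?gt_eqF// ler_peMl// powR_ge0//.
Qed.

Let ge_t0 t : t0 <= t -> s <= glue_const * t `^ p.
Proof.
move=> tt0; rewrite /glue_const mulrAC ler_pdivlMr ?powR_gt0//.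
by rewrite ler_pM2l// le_powR ?(ltW p0)// ltW.
Qed.

Let le_T t : 0 <= t -> t <= T -> glue_const * t `^ p <= tail_const.
Proof.
move=> t_ge0 tT; rewrite /tail_const le_max; apply/orP; right.
by rewrite ler_pM2l// le_powR// ltW.
Qed.

Lemma glued_small x t : t <= t0 -> glued x t = phioo t.
Proof. by rewrite /glued => ->. Qed.

Lemma glued_mid x t : t0 < t -> t <= T -> glued x t = (glue_const * t `^ p)%:E.
Proof. by rewrite /glued ltNge => /negbTE -> ->. Qed.

Lemma glued_large x t : T < t -> glued x t = (tail_const%:E * tail x t)%E.
Proof.
move=> Tt; rewrite /glued ifF; last by rewrite leNgt (le_lt_trans t0T Tt).
by rewrite ifF// leNgt Tt.
Qed.

Variant range_spec (t : R) : Prop :=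
  | RangeSmall of t <= t0
  | RangeMid of t0 < t & t <= T
  | RangeLarge of T < t.

Lemma rangeP t : range_spec t.
Proof.
have [tt0|tt0] := leP t t0; first exact: RangeSmall.
by have [tT|tT] := leP t T; [exact: RangeMid|exact: RangeLarge].
Qed.

Lemma glued_ge0 x t : 0 <= t -> (0 <= glued x t)%E.
Proof.
move=> t_ge0; case: (rangeP t) => [h|h1 h2|h].
- by rewrite glued_small// oo_ge0.
- by rewrite glued_mid// lee_fin mulr_ge0 ?(ltW C0)// powR_ge0.
- by rewrite glued_large//; apply: mule_ge0; [rewrite lee_fin ltW|exact: tail_ge0].
Qed.

Lemma glued_large_ge x t : T < t -> (tail_const%:E <= glued x t)%E.
Proof.
move=> Tt; rewrite glued_large// -[leLHS]mule1; apply: lee_wpmul2l.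
  by rewrite lee_fin ltW.
by apply: tail_ge1; exact: ltW.
Qed.

Lemma glued_le x t u : 0 <= t -> t <= u -> (glued x t <= glued x u)%E.
Proof.
move=> t_ge0 tu; case: (rangeP t) => [ht|ht1 ht2|ht].
- rewrite glued_small//; case: (rangeP u) => [hu|hu1 hu2|hu].
  + by rewrite glued_small//; exact: oo_le.
  + rewrite glued_mid//; apply: (le_trans (oo_le t_ge0 ht)); apply: (le_trans oot0).
    by rewrite lee_fin ge_t0// ltW.
  + apply: le_trans (glued_large_ge x hu); apply: (le_trans (oo_le t_ge0 ht)).
    by apply: (le_trans oot0); rewrite lee_fin (le_trans _ C'1)// ltW.
- rewrite (glued_mid x ht1 ht2); case: (rangeP u) => [hu|hu1 hu2|hu].
  + by have := lt_le_trans ht1 (le_trans tu hu); rewrite ltxx.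
  + by rewrite glued_mid// lee_fin ler_pM2l// le_powR// ltW.
  + by apply: le_trans (glued_large_ge x hu); rewrite lee_fin le_T.
- rewrite !glued_large//; last exact: lt_le_trans tu.
  by apply: lee_wpmul2l; [rewrite lee_fin ltW|exact: tail_le].
Qed.

Lemma glued_dil x t u : 0 < t -> t <= u ->
  (((u / t) `^ p)%:E * glued x t <= (D ^+ 2)%:E * glued x u)%E.
Proof.
move=> t_gt0 tu; have u0 : 0 < u := lt_le_trans t_gt0 tu.
have DD : D <= D ^+ 2 by rewrite expr2 ler_peMl// ltW.
have D21 : 1 <= D ^+ 2 := le_trans D1 DD.
have glue_weaken v : (0 <= v)%E -> (D%:E * v <= (D ^+ 2)%:E * v)%E.
  by move=> v0; apply: lee_wpmul2r; rewrite ?lee_fin.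
have large_dom : T < u -> ((glue_const * u `^ p)%:E <= D%:E * glued x u)%E.
  move=> Tu; rewrite glued_large//.
  have tT : (((u / T) `^ p)%:E <= D%:E * tail x u)%E.
    apply: le_trans (tail_dil x (lexx T) (ltW Tu)).
    by rewrite -[leLHS]mule1; apply: lee_wpmul2l; [rewrite lee_fin powR_ge0|exact: tail_ge1].
  apply: (@le_trans _ _ (tail_const%:E * ((u / T) `^ p)%:E)%E); last first.
    by rewrite muleCA; apply: lee_wpmul2l; rewrite ?lee_fin ?(ltW C'0).
  rewrite -EFinM lee_fin.
  have -> : glue_const * u `^ p = glue_const * T `^ p * (u / T) `^ p.
    by rewrite -mulrA -powRM ?divr_ge0 ?(ltW T0) ?(ltW u0)// (mulrC T) divfK ?gt_eqF.
  by apply: ler_wpM2r; [exact: powR_ge0|rewrite le_max lexx orbT].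
have small_dom : t <= t0 -> t0 <= u ->
    (((u / t) `^ p)%:E * phioo t <= D%:E * (glue_const * u `^ p)%:E)%E.
  move=> tt0 t0u.
  have -> : (u / t) `^ p = (u / t0) `^ p * (t0 / t) `^ p.
    rewrite -powRM ?divr_ge0 ?(ltW u0) ?(ltW t00) ?(ltW t_gt0)//.
    by rewrite mulrA divfK// gt_eqF.
  have -> : (D%:E * (glue_const * u `^ p)%:E = ((u / t0) `^ p)%:E * (D%:E * s%:E))%E.
    rewrite -!EFinM; congr EFin; rewrite /glue_const.
    rewrite (powRM p (ltW u0) (_ : 0 <= t0^-1)) ?invr_ge0 ?(ltW t00)// powRV ?(ltW t00)//.
    by field; rewrite gt_eqF// powR_gt0.
  rewrite EFinM -muleA; apply: lee_wpmul2l; first by rewrite lee_fin powR_ge0.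
  apply: (le_trans (dil_oo t_gt0 tt0 (lexx _))).
  by apply: lee_wpmul2l; [rewrite lee_fin ltW|exact: oot0].
have midE : (((u / t) `^ p)%:E * (glue_const * t `^ p)%:E = (glue_const * u `^ p)%:E)%E.
  rewrite -EFinM mulrCA -powRM ?divr_ge0 ?(ltW u0) ?(ltW t_gt0)//.
  by rewrite divfK// gt_eqF.
have mid0 : (0 <= (glue_const * u `^ p)%:E)%E.
  by rewrite lee_fin mulr_ge0 ?powR_ge0 ?(ltW C0).
have gu0 : (0 <= glued x u)%E by apply: glued_ge0; exact: ltW.
case: (rangeP t) => [ht|ht1 ht2|ht].
- rewrite (glued_small x ht); case: (rangeP u) => [hu|hu1 hu2|hu].
  + rewrite (glued_small x hu) in gu0 *.
    by apply: le_trans (glue_weaken _ gu0); exact: dil_oo.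
  + rewrite (glued_mid x hu1 hu2); apply: le_trans (glue_weaken _ mid0).
    by apply: small_dom => //; exact: ltW.
  + apply: (le_trans (small_dom ht _)); first by rewrite (le_trans t0T)// ltW.
    rewrite expr2 (EFinM D D) -muleA; apply: lee_wpmul2l; first by rewrite lee_fin ltW.
    exact: large_dom.
- rewrite (glued_mid x ht1 ht2) midE; case: (rangeP u) => [hu|hu1 hu2|hu].
  + by have := lt_le_trans ht1 (le_trans tu hu); rewrite ltxx.
  + rewrite (glued_mid x hu1 hu2) -[leLHS]mul1e; apply: lee_wpmul2r => //.
  + by apply: le_trans (glue_weaken _ gu0); exact: large_dom.
- have Tu := lt_le_trans ht tu.
  apply: le_trans (glue_weaken _ gu0).
  rewrite (glued_large x ht) (glued_large x Tu) muleCA [leRHS]muleCA.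
  apply: lee_wpmul2l; first by rewrite lee_fin ltW.
  by apply: tail_dil => //; exact: ltW.
Qed.

Lemma glued_dilates x : dilates p (D ^+ 2) (glued x).
Proof.
move=> k t k1 t_gt0; have tkt : t <= k * t by rewrite ler_peMl// ltW.
by have := glued_dil x t_gt0 tkt; rewrite mulfK// gt_eqF.
Qed.

Lemma tail_unbounded x (A : R) : exists2 t : R, T < t & (A%:E <= tail x t)%E.
Proof.
have [u u0 Au] : exists2 u : R, 0 < u & (A%:E <= tail x u)%E.
  have [xN|xN] := boolP (x \in N); last first.
    by have [u u0 Au] := Phi_cvgoo phiP x A; exists u => //; rewrite /tail (negbTE xN).
  have A10 : 0 < Num.max 1 A by rewrite lt_max ltr01.
  exists (Num.max 1 A * T); first by rewrite mulr_gt0.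
  rewrite /tail xN lee_fin mulfK ?gt_eqF// (@le_trans _ _ (Num.max 1 A))//.
    by rewrite le_max lexx orbT.
  by rewrite le1r_powR ?(ltW p1)// le_max lexx.
exists (Num.max u (T + 1)); first by rewrite lt_max ltrDl ltr01 orbT.
by apply: (le_trans Au); apply: tail_le; rewrite ?(ltW u0)// le_max lexx.
Qed.

Lemma glued_weak_Phi : weak_Phi glued.
Proof.
split.
- exact: glued_ge0.
- move=> f mf.
  have mf1 a : measurable_fun setT (fun x => `|f x| * a) by exact: measurable_scaled_norm.
  have -> : (fun x => glued x `|f x|) = (fun x =>
      if `|f x| * 1 <= t0 then phioo `|f x| else
      if `|f x| * 1 <= T then (glue_const * (`|f x| * 1) `^ p)%:E else
      if x \in N then (tail_const * (`|f x| * T^-1) `^ p)%:E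
      else (tail_const%:E * phi x `|f x|)%E).
    apply/funext => x; rewrite mulr1 /glued /tail.
    by case: ifP => // _; case: ifP => // _; case: ifP => // _; rewrite EFinM.
  apply: measurable_piecewise.
  + exact: mN.
  + exact: mf1.
  + exact: (measurable_Phi phiooP mf).
  + exact: measurable_scaled_powR.
  + exact: measurable_scaled_powR.
  + by apply: measurable_funeM; exact: (measurable_Phi phiP mf).
- exact: glued_le.
- move=> x; split.
  + by rewrite glued_small ?(ltW t00)//; exact: (@Phi_0 _ _ _ phiooP point).
  + have [_ _ _ /(_ point)[_ cvg0 _] _] := phiooP.
    apply: cvg_trans cvg0; apply: near_eq_cvg; near=> t.
    by rewrite glued_small//; near: t; exact: nbhs_right_le.
  + apply/cvgeyPge => A; have [t Tt At] := tail_unbounded x A.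
    near=> u; apply: (@le_trans _ _ (glued x t)).
      rewrite glued_large//; apply: (le_trans At); rewrite -[leLHS]mul1e.
      by apply: lee_wpmul2r; [apply: tail_ge0; rewrite ltW// (lt_trans T0)|rewrite lee_fin].
    apply: glued_le; first by rewrite ltW// (lt_trans T0).
    by near: u; apply: nbhs_pinfty_ge; exact: num_real.
- exists (D ^+ 2); first by rewrite expr2 (le_trans D1)// ler_peMl// ltW.
  move=> x t u t_gt0 tu; have u0 := lt_trans t_gt0 tu.
  have D21 : 1 <= D ^+ 2 by rewrite exprn_ege1.
  have gx0 v : 0 < v -> (0 <= glued x v)%E by move=> v0; apply: glued_ge0; exact: ltW.
  have := (dilatesP _ D21 gx0).2 (dilates_le (ltW p1) gx0 (glued_dilates x)) t u t_gt0 tu.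
  by rewrite !powRr1 ?(ltW u0) ?(ltW t_gt0).
Unshelve. all: by end_near. Qed.

Lemma glued_aInc : aInc glued.
Proof.
exists p, (D ^+ 2); have D21 : 1 <= D ^+ 2 by rewrite exprn_ege1.
split; [exact: p1|exact: D21|].
apply/ae_exE; exists N; split; [exact: mN|exact: N0|move=> x _].
have gx0 v : 0 < v -> (0 <= glued x v)%E by move=> v0; apply: glued_ge0; exact: ltW.
exact: (dilatesP _ D21 gx0).2 (glued_dilates x).
Qed.

(** With the limit function itself as a witness: the two functions agree near
    zero. *)
Lemma glued_A2 : A2 glued.
Proof.
have [T1 T10 sT1] := @Phi_cvgoo _ _ _ phiooP point 1.
pose b := Num.min 1 (t0 / T1).
have b0 : 0 < b by rewrite lt_min ltr01 divr_gt0.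
have b1 : b <= 1 by rewrite ge_min lexx.
have bt t : 0 <= t -> b * t <= t by move=> t_ge0; rewrite ler_piMl.
have phioo_lt t : 0 <= t -> (phioo t <= s%:E)%E -> t < T1.
  move=> t_ge0 ts; rewrite ltNge; apply/negP => T1t.
  have := le_trans (le_trans sT1 (oo_le (ltW T10) T1t)) ts.
  by rewrite lee_fin leNgt s1.
exists phioo, (cst 0), b, s; split.
- exact: phiooP.
- by split; [exact: Lfun_zero|apply: Lfun_zero; exact: leey].
- by rewrite b0.
- exact: s0.
- apply: aeW => x t t_ge0; rewrite !adde0; split=> [ts|gs].
    have btt0 : b * t <= t0.
      have tT1 := phioo_lt t t_ge0 ts.
      rewrite (le_trans (ler_wpM2r t_ge0 (_ : b <= t0 / T1)))//.
        by rewrite ge_min lexx orbT.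
      by rewrite mulrAC ler_pdivrMr// ler_pM2l// ltW.
    rewrite glued_small//; apply: oo_le; last exact: bt.
    by rewrite mulr_ge0// ltW.
  have tt0 : t <= t0.
    rewrite leNgt; apply/negP => t0t; move: gs; case: (rangeP t) => [h|h1 h2|h].
    + by rewrite leNgt t0t in h.
    + rewrite glued_mid// lee_fin leNgt => /negP; apply.
      rewrite /glue_const mulrAC ltr_pdivlMr ?powR_gt0// ltr_pM2l//.
      by rewrite lt_powR// ltW.
    + move=> /(le_trans (glued_large_ge x h)); rewrite lee_fin leNgt => /negP; apply.
      exact: lt_le_trans C'1.
  rewrite glued_small//; apply: oo_le; last exact: bt.
  by rewrite mulr_ge0// ltW.
Qed.

Lemma glued_gt_t0 x t (tau : R) : 1 <= tau -> (tau%:E <= glued x t)%E -> 0 <= t -> t0 < t.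
Proof.
move=> tau1 taut t_ge0; rewrite ltNge; apply/negP => tt0; move: taut.
rewrite glued_small// => /le_trans/(_ (oo_le t_ge0 tt0))/le_trans/(_ oot0).
by rewrite lee_fin leNgt (lt_le_trans s1).
Qed.

Lemma glued_A0 : A0 glued.
Proof.
pose b := Num.min 1 (Num.min t0 (2 * T)^-1).
have b0 : 0 < b by rewrite !lt_min ltr01 t00 invr_gt0 mulr_gt0.
exists b; split; [exact: b0|by rewrite ge_min lexx|].
apply: aeW => x; apply/andP; split.
- rewrite (@le_trans _ _ t0)//; first by rewrite !ge_min lexx orbT.
  apply: lb_le_inf.
    have [t tgt0 t1] := Phi_cvgoo glued_weak_Phi x 1.
    by exists t; split => //; exact: ltW.
  by move=> t [t_ge0 t1]; apply: ltW; exact: glued_gt_t0 t1 t_ge0.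
- apply: (@le_trans _ _ (2 * T)).
    apply: ginv_le; first by rewrite mulr_ge0// ltW.
    apply: le_trans (glued_large_ge x _); first by rewrite lee_fin.
    by rewrite ltr_pMl// ltr1n.
  rewrite -[leLHS]invrK lef_pV2 ?posrE ?invr_gt0 ?mulr_gt0//.
  by rewrite !ge_min lexx !orbT.
Qed.

Section comparison.
Variables (L b0 : R).
Hypotheses (L1 : 1 <= L) (b00 : 0 < b0).
Hypothesis dilL : forall x, dilates 1 L (phi x).
Hypothesis phi_lt1 : forall x, ~ N x -> forall t : R, 0 <= t -> t < b0 -> (phi x t < 1)%E.

Let L0 : 0 < L. Proof. exact: lt_le_trans ltr01 L1. Qed.

Definition large_ratio : R := Num.max (2 * T / b0) (L * tail_const * (T / t0)).

Let ratio0 : 0 < large_ratio.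
Proof. by rewrite lt_max divr_gt0// mulr_gt0. Qed.

Let ratio_gt1 : 1 <= L * tail_const * (T / t0).
Proof.
rewrite -[leLHS](mulr1 1); apply: ler_pM => //.
  by rewrite -[leLHS](mulr1 1); apply: ler_pM.
by rewrite ler_pdivlMr// mul1r.
Qed.

Let ratio1 : 1 <= large_ratio.
Proof. by rewrite (le_trans ratio_gt1)// le_max lexx orbT. Qed.

Lemma phi_le_glued x t : ~ N x -> T < t -> (phi x t <= glued x t)%E.
Proof.
move=> Nx Tt; rewrite glued_large// /tail memNset// -[leLHS]mul1e.
apply: lee_wpmul2r; last by rewrite lee_fin.
by apply: Phi_ge0 => //; rewrite ltW// (lt_trans T0).
Qed.

(** Together with its converse below, this is all that (A1) depends on: only the
    points where the values reach a level tau >= 1 matter. *)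
Lemma phi_to_glued x t (tau : R) : ~ N x -> 0 <= t -> 1 <= tau ->
  (tau%:E <= phi x t)%E -> (tau%:E <= glued x (large_ratio * t)%R)%E.
Proof.
move=> Nx t_ge0 tau1 taut.
have bt : b0 <= t.
  rewrite leNgt; apply/negP => /(phi_lt1 Nx t_ge0).
  by rewrite ltNge (le_trans _ taut)// lee_fin.
have t_gt0 : 0 < t := lt_le_trans b00 bt.
have Tt : T < large_ratio * t.
  apply: (@lt_le_trans _ _ (2 * T / b0 * b0)).
    by rewrite divfK ?gt_eqF// ltr_pMl// ltr1n.
  apply: ler_pM => //; first by rewrite divr_ge0 ?mulr_ge0 ?(ltW T0) ?(ltW b00).
    exact: ltW.
  by rewrite le_max lexx.
apply: le_trans (phi_le_glued Nx Tt); apply: (le_trans taut); apply: Phi_le => //.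
by rewrite ler_peMl.
Qed.

Lemma glued_le_phi x t : ~ N x -> t0 < t -> (glued x t <= phi x (large_ratio * t)%R)%E.
Proof.
move=> Nx t0t; have t_gt0 := lt_trans t00 t0t.
pose w := t * (T / t0).
have Tw : T <= w by rewrite /w mulrCA ler_peMr ?(ltW T0)// ler_pdivlMr// mul1r ltW.
have tw : t <= w by rewrite /w ler_peMr ?(ltW t_gt0)// ler_pdivlMr// mul1r.
have w0 : 0 < w := lt_le_trans T0 Tw.
have gw : (glued x t <= tail_const%:E * phi x w)%E.
  case: (rangeP t) => [h|h1 h2|h].
  - by have := lt_le_trans t0t h; rewrite ltxx.
  - rewrite glued_mid//; apply: (@le_trans _ _ tail_const%:E).
      by rewrite lee_fin le_T// ltW.
    rewrite -[leLHS]mule1; apply: lee_wpmul2l; first by rewrite lee_fin ltW.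
    by apply: (le_trans (phiT Nx)); apply: Phi_le => //; exact: ltW.
  - rewrite glued_large// /tail memNset//; apply: lee_wpmul2l.
      by rewrite lee_fin ltW.
    by apply: Phi_le => //; exact: ltW.
have LC1 : 1 <= L * tail_const by rewrite -[leLHS](mulr1 1); apply: ler_pM.
have LC0 : 0 < L * tail_const := lt_le_trans ltr01 LC1.
have := dilL x LC1 w0; rewrite powRr1 ?(ltW LC0)// EFinM -muleA lee_pmul2l// ?lte_fin//.
move=> gL; apply: (le_trans gw); apply: (le_trans gL); apply: Phi_le => //.
  by rewrite mulr_ge0 ?ltW.
by rewrite /w (mulrC t) mulrA ler_pM2r// le_max lexx orbT.
Qed.

Lemma glued_to_phi x t (tau : R) : ~ N x -> 0 <= t -> 1 <= tau ->
  (tau%:E <= glued x t)%E -> (tau%:E <= phi x (large_ratio * t)%R)%E.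
Proof.
move=> Nx t_ge0 tau1 taut; apply: (le_trans taut).
by apply: glued_le_phi => //; exact: glued_gt_t0 tau1 taut t_ge0.
Qed.

Lemma ginv_transfer (f g : E -> R -> \bar R) x (lam tau : R) : weak_Phi f -> 0 < lam ->
  (forall t, 0 <= t -> (tau%:E <= f x t)%E -> (tau%:E <= g x (lam * t)%R)%E) ->
  ginv g x tau <= lam * ginv f x tau.
Proof.
move=> fP lam0 H; rewrite -ler_pdivrMl//; apply: lb_le_inf.
  by have [t tgt0 tt] := Phi_cvgoo fP x tau; exists t; split => //; exact: ltW.
move=> t [t_ge0 tt]; rewrite ler_pdivrMl//; apply: ginv_le.
  by rewrite mulr_ge0// ltW.
exact: H.
Qed.

Lemma glued_A1 : A1 phi -> A1 glued.
Proof.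
move=> [b [bgt0 blt1 H]].
have r2 : 1 <= large_ratio ^+ 2 by exact: exprn_ege1.
have r20 : 0 < large_ratio ^+ 2 := lt_le_trans ltr01 r2.
exists (b / large_ratio ^+ 2); split.
- by rewrite divr_gt0.
- by rewrite ltr_pdivrMr// mul1r (lt_le_trans blt1).
move=> B BB B1; have [M MN HM] := H B BB B1.
exists (M `|` N); first by apply: negligibleU; [exact: MN|exact/negligibleP].
move=> x y [Bx /not_orP[Mx Nx]] [By /not_orP[My Ny]] tau tau1 tauB.
have e1 : ginv glued x tau <= large_ratio * ginv phi x tau.
  by apply: (ginv_transfer phiP ratio0) => t t_ge0; exact: phi_to_glued.
have e2 : ginv phi y tau <= large_ratio * ginv glued y tau.
  by apply: (ginv_transfer glued_weak_Phi ratio0) => t t_ge0; exact: glued_to_phi.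
have e3 := HM x y (conj Bx Mx) (conj By My) tau tau1 tauB.
rewrite mulrAC ler_pdivrMr//.
apply: (le_trans (ler_wpM2l (ltW bgt0) e1)); rewrite mulrCA.
apply: (le_trans (ler_wpM2l (ltW ratio0) e3)).
apply: (le_trans (ler_wpM2l (ltW ratio0) e2)).
by rewrite mulrA -expr2 mulrC.
Qed.

(** For large t the functions are comparable; for small t the error of (A2) is
    exactly the one allowed by weak equivalence. *)
Lemma glued_equivalent (b : R) (h : E -> R) : 0 < b -> b <= 1 -> h \in Lfun mu 1 ->
  (forall x, 0 <= h x) ->
  (forall x, ~ N x -> forall t : R, 0 <= t ->
     (phioo t <= s%:E)%E -> (phi x (b * t)%R <= phioo t + (h x)%:E)%E) ->
  (forall x, ~ N x -> forall t : R, 0 <= t ->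
     (phioo (b * t)%R <= s%:E)%E -> (phioo (b * t)%R <= phi x t + (h x)%:E)%E) ->
  weakly_equivalent phi glued.
Proof.
move=> bgt0 b1 h1 h0 A2a A2b.
pose lam := Num.max large_ratio (Num.max b^-1 (T / (b * t0))).
have lam_r : large_ratio <= lam by rewrite le_max lexx.
have lam_b : b^-1 <= lam by rewrite !le_max lexx !orbT.
have lam_T : T / (b * t0) <= lam by rewrite !le_max lexx !orbT.
have lam1 : 1 <= lam := le_trans ratio1 lam_r.
have lam0 : 0 < lam := lt_le_trans ltr01 lam1.
exists lam, h; split; [exact: lam1|exact: h1|].
apply/ae_exE; exists N; split; [exact: mN|exact: N0|move=> x Nx t t_ge0].
have hx : (0 <= (h x)%:E)%E by rewrite lee_fin.
have tb0 : 0 <= t / b by rewrite divr_ge0 ?(ltW bgt0).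
have btb : b * (t / b) = t by rewrite mulrC divfK// gt_eqF.
have tlam : t / b <= lam * t by rewrite mulrC ler_wpM2r.
split.
- case: (leP t t0) => [tt0|t0t].
    rewrite glued_small//.
    have ts : (phioo (b * (t / b))%R <= s%:E)%E.
      by rewrite btb; apply: le_trans oot0; exact: oo_le.
    have := A2b x Nx (t / b) tb0 ts; rewrite btb => /le_trans; apply.
    by apply: leeD2r; exact: Phi_le.
  apply: (le_trans (glued_le_phi Nx t0t)); apply: (@le_trans _ _ (phi x (lam * t)%R)).
    by apply: Phi_le => //; rewrite ?ler_wpM2r// mulr_ge0// ltW.
  exact: leeDl.
- case: (ltP T (lam * t)) => [Tt|tT].
    apply: (@le_trans _ _ (phi x (lam * t)%R)); first by apply: Phi_le => //; rewrite ler_peMl.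
    by apply: (le_trans (phi_le_glued Nx Tt)); exact: leeDl.
  have tbt0 : t / b <= t0.
    have := le_trans (ler_wpM2r t_ge0 lam_T) tT.
    rewrite mulrAC ler_pdivrMr ?mulr_gt0// ler_pM2l// => tbt.
    by rewrite ler_pdivrMr// mulrC.
  have ts : (phioo (t / b)%R <= s%:E)%E by apply: le_trans oot0; exact: oo_le.
  have := A2a x Nx (t / b) tb0 ts; rewrite btb => /le_trans; apply; apply: leeD2r.
  rewrite -(glued_small x tbt0); exact: glued_le.
Qed.

End comparison.

End gluing.

Section necessity.
Context {R : realType} {n : nat} (n0 : (0 < n)%N).
Local Notation E := (Rn R n).
Local Notation mu := (@lebesgue_Rn R n).

Lemma necessity (phi : E -> R -> \bar R) : weak_Phi phi -> A0 phi -> A1 phi ->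
  A2 phi -> maximal_bounded phi ->
  exists psi : E -> R -> \bar R, weak_Phi psi /\ weakly_equivalent phi psi /\
    [/\ A0 psi, A1 psi, A2 psi & aInc psi].
Proof.
move=> phiP phiA0 phiA1 phiA2 /(modular_of_bounded phiP)[K K0 HK].
have [b0 [/andP[b0_gt0 b0_le1] /ae_exE[N0 [mN0 N00 H0]]]] := A0P phiP phiA0.
have [b1 [/andP[b10 b11] [N1 [mN1 N10 H1]]]] := A1P n0 phiP phiA1.
have [phioo [h [b2 [s' [phiooP [h1 mh h0 ih] /andP[b20 b21] s'0 /ae_exE[N2 [mN2 N20 H2]]]]]]] :=
  A2P phiP phiA2.
have [mNa Na0] := measure0_setU mN1 mN2 N10 N20.
have [mN N0'] := measure0_setU mN0 mNa N00 Na0.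
set N := (_ `|` _) in mN N0'.
have NN x : ~ N x -> [/\ ~ N0 x, ~ N1 x & ~ N2 x].
  by move=> /not_orP[? /not_orP[? ?]].
have [L [L1 dilphi diloo]] : exists L, [/\ 1 <= L, forall x, dilates 1 L (phi x) &
    dilates 1 L phioo].
  have [L1 L11 d1] := Phi_dilates phiP; have [L2 L21 d2] := Phi_dilates phiooP.
  exists (Num.max L1 L2); split; first by rewrite le_max L11.
    move=> x k t k1 t0; apply: (le_trans (d1 x k t k1 t0)); apply: lee_wpmul2r.
      by apply: Phi_ge0 => //; rewrite mulr_ge0 ?(ltW t0)// (le_trans ler01).
    by rewrite lee_fin le_max lexx.
  move=> k t k1 t0; apply: (le_trans (d2 point k t k1 t0)); apply: lee_wpmul2r.
    apply: (@Phi_ge0 _ _ _ phiooP point).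
    by rewrite mulr_ge0 ?(ltW t0)// (le_trans ler01).
  by rewrite lee_fin le_max lexx orbT.
have L0 : 0 < L := lt_le_trans ltr01 L1.
have B0 : 0 < @ballc R n := ballc_gt0 n0.
pose rho := Num.max 1 (2 * 2 ^+ n / @ballc R n).
have rho1 : 1 <= rho by rewrite le_max lexx.
have rhoP : 2 * 2 ^+ n <= @ballc R n * rho ^+ n.
  rewrite [leRHS]mulrC -ler_pdivrMr//; apply: (@le_trans _ _ rho).
    by rewrite le_max lexx orbT.
  by rewrite ler_eXnr.
have A2a x : ~ N x -> forall t : R, 0 <= t ->
    (phioo t <= s'%:E)%E -> (phi x (b2 * t)%R <= phioo t + (h x)%:E)%E.
  by move=> /NN[_ _ N2x] t t_ge0; have [] := H2 x N2x t t_ge0.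
have A2b x : ~ N x -> forall t : R, 0 <= t ->
    (phioo (b2 * t)%R <= s'%:E)%E -> (phioo (b2 * t)%R <= phi x t + (h x)%:E)%E.
  by move=> /NN[_ _ N2x] t t_ge0; have [] := H2 x N2x t t_ge0.
have A1h (x y : E) : ~ N x -> ~ N y ->
    forall r tau s t : R, eucl_dist x y < r -> 1 <= tau -> tau * (4 * r) ^+ n <= 1 ->
    0 <= s -> s < b1 * t -> (tau%:E <= phi x s)%E -> (tau%:E <= phi y t)%E.
  by move=> /NN[_ N1x _] /NN[_ N1y _]; exact: H1.
have [k1 k11 large] := growth_large n0 phiP K0 rho1 L1 rhoP HK dilphi b10 b11 mN N0' A1h.
have [k2 k21 small] := growth_small n0 phiP K0 rho1 L1 rhoP HK dilphi phiooP b20 diloo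
  mh h0 ih mN N0' A2a A2b.
pose k := Num.max 2 (Num.max k1 k2).
have k_ge2 : 2 <= k by rewrite le_max lexx.
have k_ge1 : k1 <= k by rewrite !le_max lexx !orbT.
have k_ge2' : k2 <= k by rewrite !le_max lexx !orbT.
have kgt1 : 1 < k by rewrite (lt_le_trans _ k_ge2)// ltr1n.
have kgt0 : 0 < k := lt_trans ltr01 kgt1.
pose s := Num.min s' 2^-1.
have s0 : 0 < s by rewrite lt_min s'0/= invr_gt0.
have ss' : s <= s' by rewrite ge_min lexx.
have s1 : s < 1 by rewrite gt_min invf_lt1 ?ltr1n ?orbT.
have [t0 t00 oot0] := @Phi_cvg0 _ _ _ phiooP point s s0.
pose T := Num.max t0 (L ^+ 2 * (2 / b0)).
have b0i0 : 0 < 2 / b0 by rewrite divr_gt0.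
have t0T : t0 <= T by rewrite le_max lexx.
have T0 : 0 < T := lt_le_trans t00 t0T.
have phiTL x : ~ N x -> (L%:E <= phi x T)%E.
  move=> /NN[N0x _ _].
  have one : (1 <= phi x (2 / b0)%R)%E.
    by have [_] := H0 x N0x; apply; rewrite ltr_pMl ?invr_gt0// ltr1n.
  have L2 : 1 <= L ^+ 2 by exact: exprn_ege1.
  apply: (@le_trans _ _ (phi x (L ^+ 2 * (2 / b0))%R)); last first.
    apply: Phi_le => //; last by rewrite le_max lexx orbT.
    by rewrite mulr_ge0 ?(ltW b0i0)// (le_trans ler01).
  rewrite -(@lee_pmul2l _ L%:E)// ?lte_fin//.
  apply: le_trans (dilphi x _ _ L2 b0i0).
  rewrite powRr1 ?(le_trans ler01 L2)// -EFinM -expr2 -[leLHS]mule1.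
  by apply: lee_wpmul2l => //; rewrite lee_fin (le_trans ler01 L2).
have phiT x : ~ N x -> (1 <= phi x T)%E.
  by move=> /phiTL; apply: le_trans; rewrite lee_fin.
pose p := gain_exponent k; pose D := 2 * k.
have D1 : 1 <= D by rewrite /D (le_trans (ltW kgt1))// ler_peMl ?ler1n// ltW.
have oo_ge0 t : 0 <= t -> (0 <= phioo t)%E by exact: (@Phi_ge0 _ _ _ phiooP point).
have oo_le v w : 0 <= v -> v <= w -> (phioo v <= phioo w)%E.
  exact: (@Phi_le _ _ _ phiooP point).
have dil_oo t u : 0 < t -> t <= u -> u <= t0 ->
    (((u / t) `^ p)%:E * phioo t <= D%:E * phioo u)%E.
  move=> tgt0 tu ut0; apply: power_growth => //.
    move=> v w tv vw _; have v_ge0 : 0 <= v by rewrite (le_trans _ tv)// ltW.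
    by rewrite oo_ge0// oo_le.
  move=> v tv kvu; have v0 : 0 < v := lt_le_trans tgt0 tv.
  apply: small => //; apply: (@le_trans _ _ (phioo t0)).
    by apply: oo_le; [rewrite mulr_ge0 ?ltW|exact: le_trans ut0].
  by apply: (le_trans (ltW oot0)); rewrite lee_fin.
have dil_phi x : ~ N x -> forall t u, T <= t -> t <= u ->
    (((u / t) `^ p)%:E * phi x t <= D%:E * phi x u)%E.
  move=> Nx t u Tt tu; have tgt0 : 0 < t := lt_le_trans T0 Tt.
  apply: power_growth => //.
    move=> v w tv vw _; have v_ge0 : 0 <= v by rewrite (le_trans _ tv)// ltW.
    by rewrite (Phi_ge0 phiP)// (Phi_le phiP).
  move=> v tv kvu; have v0 : 0 < v := lt_le_trans tgt0 tv.
  apply: large => //; apply: (le_trans (phiTL x Nx)); apply: Phi_le => //.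
    exact: ltW.
  exact: le_trans tv.
have p1 : 1 < p := gain_exponent_gt1 kgt1.
have oot0' := ltW oot0.
have phi_lt1 x : ~ N x -> forall t : R, 0 <= t -> t < b0 -> (phi x t < 1)%E.
  by move=> /NN[N0x _ _]; have [] := H0 x N0x.
exists (glued phi phioo N p t0 T s); split; [|split; [|split]].
- exact: (glued_weak_Phi phiP phiooP mN p1 D1 t00 t0T s0 s1 oot0' dil_oo phiT dil_phi).
- apply: (glued_equivalent phiP phiooP mN N0' p1 t00 t0T s0 s1 oot0' phiT
    L1 b0_gt0 dilphi b20 b21 h1 h0).
  + move=> x Nx t t_ge0 ts; apply: A2a => //.
    by apply: (le_trans ts); rewrite lee_fin.
  + move=> x Nx t t_ge0 ts; apply: A2b => //.
    by apply: (le_trans ts); rewrite lee_fin.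
- exact: (glued_A0 phiP phiooP mN p1 D1 t00 t0T s0 s1 oot0' dil_oo phiT dil_phi).
- exact: (glued_A1 phiP phiooP mN N0' p1 D1 t00 t0T s0 s1 oot0' dil_oo phiT dil_phi
    L1 b0_gt0 dilphi phi_lt1).
- exact: (glued_A2 phiP phiooP p1 t00 t0T s0 s1 phiT).
- exact: (glued_aInc phiP phiooP mN N0' p1 D1 t00 t0T s0 oot0' dil_oo phiT dil_phi).
Qed.

End necessity.

Theorem theorem4p12 (R : realType) (n : nat) (n_gt0 : (0 < n)%N)
    (phi : Rn R n -> R -> \bar R) (phiP : weak_Phi phi)
    (phiA0 : A0 phi) (phiA1 : A1 phi) (phiA2 : A2 phi) :
  maximal_bounded phi <->
  exists psi : Rn R n -> R -> \bar R,
    weak_Phi psi /\ weakly_equivalent phi psi /\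
    [/\ A0 psi, A1 psi, A2 psi & aInc psi].
Proof.
split; first exact: necessity.
move=> [psi [psiP [eqv [psiA0 psiA1 psiA2 psii]]]].
exact: (sufficiency n_gt0 phiP psiP eqv psiA0 psiA1 psiA2 psii).
Qed.
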